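(* In the setting below, let $1\le r<R$ and $1\le k\le M_r$, and assume $S^r_k\ne S_i$ for every $1\le i\le M$ (i.e. $S^r_k$ contains more than one set $S_i$). Let $\tau^{r,\varepsilon}_k$ be a positive function with $\tau^{r,\varepsilon}_k\sim\sum_{i:S_i\subseteq S^r_k}\tau^\varepsilon_i\,\mathbb E(N^\varepsilon(x,i,r))$ uniformly in $x\in S^r_k$. Then for each $t\ge0$ and each $1\le l\le M_r$ with $P^{r,\varepsilon}_{kl}\not\equiv0$, $$\lim_{\varepsilon\downarrow0}\mathbb P\Big(\frac{T^{r,\varepsilon}(x,S^r_l)}{\tau^{r,\varepsilon}_k}\ge t\Big)=e^{-t}$$ uniformly in $x\in S^r_k$.
   Context: Setting: a Markov renewal process on a metric space $S=S_1\cup\dots\cup S_M$ (disjoint Borel sets), embedded chain $(\mathbf X^{x,\varepsilon}_n,\mathbf T^{x,\varepsilon}_n)$ started at $(x,0)$ with transition kernels $Q^\varepsilon(y,\cdot)$ on $S\times[0,\infty)$ depending only on the spatial state; $P^\varepsilon(x,B)=Q^\varepsilon(x,B\times[0,\infty))$; $T^\varepsilon(x,B)$ has law $Q^\varepsilon(x,B\times\cdot)/P^\varepsilon(x,B)$. It satisfies: (a) $P^\varepsilon(x,S_i)=0$ for $x\in S_i$; for $i\ne j$, $P^\varepsilon(x,S_j)$ is $0$ for all $x\in S_i,\varepsilon$ ($P^\varepsilon_{ij}:\equiv0$) or positive with positive $P^\varepsilon_{ij}$, $P^\varepsilon(x,S_j)/P^\varepsilon_{ij}\to1$ uniformly in $x\in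 S_i$, $\sum_jP^\varepsilon_{ij}=1$, indices communicate through positive $P^\varepsilon$; (b) positive $\tau^\varepsilon_i$ with $\mathbb ET^\varepsilon(x,S_j)/\tau^\varepsilon_i\to1$ uniformly in $x\in S_i$ when $P^\varepsilon_{ij}\not\equiv0$; (c) $\mathrm{Var}\,T^\varepsilon(x,S_j)\le C(\tau^\varepsilon_i)^2$ for $\varepsilon\le\varepsilon_0$; (d) for bounded continuous $f$, $\mathbb Ef(T^\varepsilon(x_1,S_{j_1})/\tau^\varepsilon_i)-\mathbb Ef(T^\varepsilon(x_2,S_{j_2})/\tau^\varepsilon_i)\to0$ uniformly in $x_1,x_2\in S_i$ ($P^\varepsilon_{ij_1},P^\varepsilon_{ij_2}\not\equiv0$); (e) distributional limits of $T^{\varepsilon_n}(x_n,S_j)/\tau^{\varepsilon_n}_i$ ($x_n\in S_i$, $\varepsilon_n\downarrow0$) have no atoms; (f) $\lim_{\varepsilon\downarrow0}\prod_{k=1}^n\frac{P^\varepsilon_{a_kb_k}}{P^\varepsilon_{a_kd_k}}\frac{\tau^\varepsilon_a}{\tau^\varepsilon_c}\in[0,\infty]$ whenever defined. Hierarchy: $S^0_i=S_i$, $M_0=M$, $P^{0,\varepsilon}=P^\varepsilon$; $\pi^r$ maps a point or subset to its rank-$r$ cluster; $\theta_0^{x,\varepsilon}(r)=0$, $\theta_n^{x,\varepsilon}(r)=\min\{m>\theta_{n-1}(r):\pi^r(\mathbf X_m)\ne\pi^r(\mathbf X_{\theta_{n-1}(r)})\}$; if $M_r>1$, partition $\{1,\dots,M_r\}$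 into ergodic classes of $P^{r,0}_{ij}=\lim P^{r,\varepsilon}_{ij}$ and transient singletons $E_1,\dots,E_{M_{r+1}}$; $S^{r+1}_k=\bigcup_{i\in E_k}S^r_i$; $\lambda^r_k$ the invariant probability on $E_k$ (unit mass for a transient singleton); $P^{r+1,\varepsilon}_{kl}=\sum_{i\in E_k,\,S^r_j\subseteq S^{r+1}_l}\lambda^r_k(i)P^{r,\varepsilon}_{ij}\big/\sum_{i\in E_k,\,S^r_j\not\subseteq S^{r+1}_k}\lambda^r_k(i)P^{r,\varepsilon}_{ij}$; $R$ is the first rank with $M_R=1$. For $0\le r<R$: $\mathbf X^{x,r,\varepsilon}_n=\mathbf X^{x,\varepsilon}_{\theta_n(r)}$, $\mathbf T^{x,r,\varepsilon}_n=\sum_{m=\theta_{n-1}(r)+1}^{\theta_n(r)}\mathbf T^{x,\varepsilon}_m$ ($n\ge1$); $T^{r,\varepsilon}(x,S^r_j)$ has the law of $\mathbf T^{x,r,\varepsilon}_1$ conditioned on $\mathbf X^{x,r,\varepsilon}_1\in S^r_j$. $N^\varepsilon(x,i,r)=\sum_{n=0}^{\theta^{x,\varepsilon}_1(r)}\chi_{S_i}(\mathbf X^{x,\varepsilon}_n)$ for $x\in\pi^r(S_i)$. *)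

(* Defs.v *)
From HB Require Import structures.
From mathcomp Require Import all_boot all_order all_algebra.
From mathcomp Require Import all_classical all_reals all_analysis.
Set Implicit Arguments. Unset Strict Implicit. Unset Printing Implicit Defensive.
Import Order.TTheory GRing.Theory Num.Theory numFieldNormedType.Exports.
Local Open Scope classical_set_scope.
Local Open Scope ring_scope.

Section Defs.
Context {R : realType}.

Definition unif_lim {T : Type} (F : R -> T -> R) (D : set T) (l : R) :=
  forall e : R, 0 < e -> \forall eps \near 0^'+, forall x, D x -> `|F eps x - l| < e.

Definition bcont (f : R -> R) := continuous f /\ exists Mb : R, forall s, `|f s| <= Mb.

Context {dS : measure_display} {S : measurableType dS}.

Definition Si {M : nat} (cls : S -> 'I_M) (i : 'I_M) : set S := [set x | cls x = i].

(** P(x,B) = Q(x, B x [0,oo)) (Q is supported on S x [0,oo)). *)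
Definition Pk (Q : R.-pker S ~> (S * R)%type) (x : S) (B : set S) : R :=
  fine (Q x (B `*` setT)).

(** E f(T(x,B)), T(x,B) having law Q(x, B x .)/P(x,B). *)
Definition condE (Q : R.-pker S ~> (S * R)%type) (x : S) (B : set S) (f : R -> R) : R :=
  fine (\int[Q x]_(z in B `*` setT) (f z.2)%:E) / Pk Q x B.

Definition hist {d} {O : measurableType d} (X : nat -> O -> S) (T : nat -> O -> R)
  (n : nat) : set (set O) :=
  <<s [set A | exists m, (m <= n)%N /\
        ((exists B : set S, measurable B /\ A = X m @^-1` B) \/
         (exists C : set R, measurable C /\ A = T m @^-1` C))] >>.

(** (X, T) under P is the embedded chain of the Markov renewal process with
    kernel Q started at (x, 0); T n is the n-th holding time. *)
Definition MRchain {d} {O : measurableType d} (P : probability O R)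
  (Q : R.-pker S ~> (S * R)%type) (x : S) (X : nat -> O -> S) (T : nat -> O -> R) :=
  [/\ (forall n, measurable_fun setT (X n)),
      (forall n, measurable_fun setT (T n)),
      (forall w, X 0%N w = x /\ T 0%N w = 0) &
      forall n (G : set O), hist X T n G -> forall B : set (S * R)%type, measurable B ->
        (P (G `&` [set w | B (X n.+1 w, T n.+1 w)]) = \int[P]_(w in G) Q (X n w) B)%E].

Definition nzP {m : nat} (P : R -> 'I_m -> 'I_m -> R) (i j : 'I_m) : bool :=
  `[< exists eps, 0 < eps /\ P eps i j != 0 >].

Definition posrel {m : nat} (P0 : 'I_m -> 'I_m -> R) : rel 'I_m := fun a b => 0 < P0 a b.

Definition ergodic_class {m : nat} (P0 : 'I_m -> 'I_m -> R) (E : pred 'I_m) :=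
  [/\ exists i, E i,
      (forall i j, E i -> E j -> connect (posrel P0) i j) &
      (forall i j, E i -> 0 < P0 i j -> E j)].

Definition transient {m : nat} (P0 : 'I_m -> 'I_m -> R) (i : 'I_m) :=
  exists j, connect (posrel P0) i j && ~~ connect (posrel P0) j i.

(** one step r -> r+1: c maps rank-r clusters to rank-(r+1) clusters *)
Definition hier_step {m m' : nat} (P : R -> 'I_m -> 'I_m -> R)
  (P' : R -> 'I_m' -> 'I_m' -> R) (c : 'I_m -> 'I_m') :=
  exists (P0 : 'I_m -> 'I_m -> R) (lam : 'I_m -> R),
  [/\ (forall i j, (fun eps => P eps i j) @ 0^'+ --> P0 i j),
      (forall k : 'I_m', exists i, c i = k),
      (forall k : 'I_m',
         (ergodic_class P0 [pred i | c i == k] /\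
          forall j, c j = k -> lam j = \sum_(i | c i == k) lam i * P0 i j) \/
         (exists i, (forall a, c a = k <-> a = i) /\ transient P0 i)),
      (forall i, 0 <= lam i) /\ (forall k, \sum_(i | c i == k) lam i = 1) &
      (forall eps k l, P' eps k l =
         if k == l then 0 else
         (\sum_(i | c i == k) \sum_(j | c j == l) lam i * P eps i j) /
         (\sum_(i | c i == k) \sum_(j | c j != k) lam i * P eps i j))].

(** The hierarchy: M_r = Mr r, P^{r,eps} = Pr r eps, pi r maps base index i
    to the rank-r cluster containing S_i; Rtop = R is the first rank with M_R = 1. *)
Definition hierarchy (Mr : nat -> nat) (Rtop : nat)
  (Pr : forall r, R -> 'I_(Mr r) -> 'I_(Mr r) -> R)
  (pi : forall r, 'I_(Mr 0%N) -> 'I_(Mr r)) :=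
  [/\ Mr Rtop = 1%N,
      (forall r, (r < Rtop)%N -> (1 < Mr r)%N),
      (forall i, pi 0%N i = i) &
      forall r, (r < Rtop)%N -> exists c : 'I_(Mr r) -> 'I_(Mr r.+1),
        hier_step (Pr r) (Pr r.+1) c /\ forall i, pi r.+1 i = c (pi r i)].

Definition exit_at {O : Type} {m : nat} (lab : S -> 'I_m) (X : nat -> O -> S)
  (w : O) (n : nat) :=
  [/\ (0 < n)%N, lab (X n w) != lab (X 0%N w) &
      forall n', (0 < n' < n)%N -> lab (X n' w) = lab (X 0%N w)].

Definition exit_event {O : Type} {m : nat} (lab : S -> 'I_m) (X : nat -> O -> S)
  (T : nat -> O -> R) (l : 'I_m) (s : R) : set O :=
  [set w | exists n, exit_at lab X w n /\ lab (X n w) = l /\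
                     s <= \sum_(1 <= k < n.+1) T k w].

Definition exit_to {O : Type} {m : nat} (lab : S -> 'I_m) (X : nat -> O -> S)
  (l : 'I_m) : set O :=
  [set w | exists n, exit_at lab X w n /\ lab (X n w) = l].

(** N(x,i,r) = sum_{n=0}^{theta_1(r)} 1_{S_i}(X_n) *)
Definition Nvisits {O : Type} {M m : nat} (cls : S -> 'I_M) (lab : S -> 'I_m)
  (X : nat -> O -> S) (i : 'I_M) (w : O) : \bar R :=
  (\sum_(n <oo) (if `[< cls (X n w) = i /\
        forall n', (0 < n' < n)%N -> lab (X n' w) = lab (X 0%N w) >]
                  then 1 else 0)%:E)%E.

End Defs.

(* Main.v *)
(** Fix a cluster of rank r. Before leaving it the chain returns to each of its states with
    probability tending to one, so the exit law, and the mean time g still to be spent in the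
    cluster, are asymptotically the same from all of its points; g is asymptotic to tau^r. Let Y be
    the time of the last jump before the exit and G(s) = P(Y >= s tau^r). The mean residual life
    E(Y - s tau^r)^+ / tau^r is the integral of G over [s, oo). It is also close to G(s): at the
    first jump after time s tau^r the mean remaining time is about tau^r, and the overshoot is
    negligible by the variance bound, since the one-step times are o(tau^r). Hence G(s) tends to
    exp(-s). Conditioning on the target cluster is harmless because its exit probability is
    asymptotically constant, and the final holding time is o(tau^r) in probability.

    Recurrence of clusters is carried from rank r to rank r+1 through the invariant measure mu of
    the embedded chain: P^r_{kl} is asymptotic to the mu-flux from k to l divided by the total
    outgoing flux of k, and a Harnack-type inequality for the time-reversed limit chain shows that
    the outgoing fluxes in an ergodic class are asymptotically proportional to lambda^r. Kernel exit
    probabilities are compared with those of the finite chain by eliminating states one at a time,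
    which preserves relative errors. *)
Require Import Defs.
From HB Require Import structures.
From mathcomp Require Import all_boot all_order all_algebra.
From mathcomp Require Import all_classical all_reals all_analysis measurable_realfun.
From mathcomp Require Import ring lra.
Set Implicit Arguments. Unset Strict Implicit. Unset Printing Implicit Defensive.
Import Order.TTheory GRing.Theory Num.Theory numFieldNormedType.Exports.
Local Open Scope classical_set_scope.
Local Open Scope ring_scope.

(** * Exit distributions of finite chains *)

(** A relative error of one step cannot simply be iterated, since the number of jumps before the
    exit from a cluster grows without bound as $\varepsilon\downarrow0$. An exit probability is
    therefore written as a fixed finite expression in the one-step probabilities that uses sums,
    products and quotients but no differences: the escape probability from an eliminated state is a
    sum over exits elsewhere, not one minus a return probability. A relative error of order $d$ in
    the data then stays of order $d$. Errors are kept relative throughout because transition and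
    exit probabilities may be arbitrarily small or identically zero.

    For the kernel, exit probabilities and occupation times are least nonnegative solutions of
    one-step equations, hence bounded above by any supersolution. On paths, a passage time is split
    into its possible integer values, so conditioning always takes place at a fixed index. The time
    estimates are explicit inequalities at fixed $\varepsilon$ whose constants do not depend on the
    starting point; this gives the uniformity in $x$. *)

Definition stochastic {R : realType} {m : nat} (P : 'I_m -> 'I_m -> R) :=
  (forall i j, 0 <= P i j) /\ (forall i, \sum_j P i j = 1).

Definition irreducible_chain {R : realType} {m : nat} (P : 'I_m -> 'I_m -> R) :=
  forall i j, connect (posrel P) i j.

(** A state outside [s] together with irreducibility guarantees that the chain leaves [s], which
    keeps the denominators of the elimination away from zero. *)
Definition proper_seq {T : eqType} (s : seq T) := uniq s /\ exists j, j \notin s.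

Section FiniteChain.
Context {R : realType} {m : nat} (P : 'I_m -> 'I_m -> R).
Hypotheses (Pst : stochastic P) (Pirr : irreducible_chain P).

Lemma connect_invariant (e : rel 'I_m) (Z : 'I_m -> Prop) i j :
  connect e i j -> Z i -> (forall a b, Z a -> e a b -> Z b) -> Z j.
Proof.
move=> /connectP[p ep ->] + H; elim: p i ep => [//|b p IH] i /= /andP[eib ep] Zi.
by apply: IH => //; apply: H eib.
Qed.

(* The probability that, started at [i], the first state outside [s] visited at a positive time is
   in [L], computed by eliminating the states of [s] one by one. *)
Fixpoint exitp (s : seq 'I_m) (L : {pred 'I_m}) (i : 'I_m) : R :=
  if s is a :: s' then
    exitp s' L i
    + exitp s' (pred1 a) i * (exitp s' L a / exitp s' [predC a :: s'] a)
  else \sum_(j | j \in L) P i j.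

Lemma exitp_ge0 s L i : 0 <= exitp s L i.
Proof.
elim: s L i => [|a s IH] L i /=; first by apply: sumr_ge0 => j _; exact: Pst.1.
by rewrite addr_ge0 // mulr_ge0 // divr_ge0.
Qed.

Lemma exitpU s (L1 L2 L : {pred 'I_m}) i :
  (forall j, j \in L -> (j \in L1) (+) (j \in L2)) ->
  (forall j, j \in L1 -> j \in L) -> (forall j, j \in L2 -> j \in L) ->
  exitp s L i = exitp s L1 i + exitp s L2 i.
Proof.
move=> HL H1 H2; elim: s i => [|a s IH] i /=; last by rewrite !IH; ring.
rewrite [LHS](bigID (mem L1)) /=; congr (_ + _); apply: eq_bigl => j.
  by case: (boolP (j \in L1)) => [/H1 ->|]; rewrite ?andbF.
case: (boolP (j \in L)) => /= [/HL|]; first by case: (j \in L1); case: (j \in L2).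
by case: (boolP (j \in L2)) => // /H2 ->.
Qed.

(** Harmonicity and total mass one go through a single induction: eliminating [a] divides by the
    escape probability [D], whose positivity comes from harmonicity for the shorter list, and total
    mass one identifies [1 - D] as the return probability to [a]. *)
Lemma exitp_spec s : proper_seq s ->
  (forall L i, exitp s L i =
     \sum_(j | j \in L) P i j + \sum_(b <- s) P i b * exitp s L b) /\
  (forall i, exitp s [predC s] i = 1).
Proof.
elim: s => [|a s IH] [us [j0 js]].
  split=> [L i|i]; first by rewrite big_nil addr0.
  by rewrite /= (eq_bigl xpredT) // Pst.2.
have /andP[as_ us'] := us.
have [|hs rs] := IH.
  by split => //; exists j0; move: js; rewrite inE negb_or => /andP[].
set D := exitp s [predC a :: s] a.
(* If [D] vanished, harmonicity would carry the value 0 along every positive transition and confine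
   the chain to [a :: s], against the existence of [j0]. *)
have D0 : D != 0.
  apply/negP => /eqP D0.
  have : j0 \in a :: s /\ exitp s [predC a :: s] j0 = 0.
    apply: (connect_invariant (Z := fun j => j \in a :: s /\ exitp s [predC a :: s] j = 0)
      (Pirr a j0)) => [|b c [bs eb] Pbc].
      by rewrite mem_head.
    have := eb; rewrite hs => /eqP; rewrite paddr_eq0; last 2 first.
    - by apply: sumr_ge0 => j _; exact: Pst.1.
    - by apply: sumr_ge0 => j _; rewrite mulr_ge0 ?exitp_ge0 //; exact: Pst.1.
    move=> /andP[/eqP e1 /eqP e2].
    have cs : c \in a :: s.
      apply/negPn/negP => cs.
      have Z : P b c = 0 by apply: (psumr_eq0P (fun j _ => Pst.1 b j) e1).
      by rewrite /posrel Z ltxx in Pbc.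
    split => //; move: cs; rewrite inE => /predU1P[-> //|cs].
    rewrite big_uniq //= in e2.
    have /eqP : P b c * exitp s [predC a :: s] c = 0.
      apply: (psumr_eq0P _ e2) => // j _.
      by rewrite mulr_ge0 ?exitp_ge0 //; exact: Pst.1.
    by rewrite mulf_eq0 (gt_eqF Pbc) /= => /eqP.
  by case => H; rewrite H in js.
have U i : exitp s [predC a :: s] i + exitp s (pred1 a) i = 1.
  rewrite -(rs i); symmetry; apply: exitpU => j; rewrite !inE /= ?inE.
  - by case: eqVneq => [->|_ ->].
  - by rewrite negb_or => /andP[].
  - by move=> /eqP ->.
(* At [a] the geometric series over the returns collapses to a quotient. *)
have Ua L : exitp (a :: s) L a = exitp s L a / D.
  rewrite /= -/D.
  have -> : exitp s (pred1 a) a = 1 - D by rewrite -(U a) -/D; ring.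
  by field.
split => [L i|i].
  rewrite big_cons Ua /= -/D hs (hs (pred1 a) i).
  have -> : \sum_(j | j \in pred1 a) P i j = P i a by rewrite big_pred1_eq.
  have -> : \sum_(b <- s) P i b * (exitp s L b + exitp s (pred1 a) b * (exitp s L a / D))
    = \sum_(b <- s) P i b * exitp s L b
      + (\sum_(b <- s) P i b * exitp s (pred1 a) b) * (exitp s L a / D).
    by rewrite mulr_suml -big_split; apply: eq_bigr => b _ /=; ring.
  ring.
by rewrite /= -/D divff // mulr1 U.
Qed.

Lemma exitp_harmonic s L i : proper_seq s ->
  exitp s L i = \sum_(j | j \in L) P i j + \sum_(b <- s) P i b * exitp s L b.
Proof. by move=> /exitp_spec[->]. Qed.

Lemma exitp_total s i : proper_seq s -> exitp s [predC s] i = 1.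
Proof. by move=> /exitp_spec[]. Qed.

Lemma exitp_le1 s L i : proper_seq s -> {subset L <= [predC s]} -> exitp s L i <= 1.
Proof.
move=> ps Ls; rewrite -(exitp_total i ps).
rewrite (@exitpU s L [predD [predC s] & L] [predC s]) //.
- by rewrite lerDl exitp_ge0.
- by move=> j; rewrite !inE => /= ->; rewrite andbT; case: (j \in L).
- by move=> j; rewrite !inE => /andP[].
Qed.

Lemma exitp_step s L i : proper_seq s -> \sum_(j | j \in L) P i j <= exitp s L i.
Proof.
move=> ps; rewrite exitp_harmonic // lerDl sumr_ge0 // => j _.
by rewrite mulr_ge0 ?exitp_ge0 //; exact: Pst.1.
Qed.

Lemma exitp_escape_gt0 a s : proper_seq (a :: s) -> 0 < exitp s [predC a :: s] a.
Proof.
move=> pas; rewrite lt_neqAle exitp_ge0 andbT eq_sym; apply/eqP => H.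
by have := exitp_total a pas; rewrite /= H invr0 !mulr0 addr0 => /eqP; rewrite eq_sym oner_eq0.
Qed.

(* At a negative minimum over [s], superharmonicity forces the neighbours to stay in [s] and to
   attain the minimum as well; irreducibility then reaches a state outside [s]. *)
Lemma min_principle (s : seq 'I_m) (f : 'I_m -> R) : proper_seq s ->
  (forall i, i \in s -> \sum_(j <- s) P i j * f j <= f i) ->
  forall i, i \in s -> 0 <= f i.
Proof.
move=> [us [j0 j0s]] sup i is_.
pose i0 := [arg min_(a < i | a \in s) f a]%O.
have [a as_ amin] : exists2 a, a \in s & forall b, b \in s -> f a <= f b.
  by case: (@Order.TotalTheory.arg_minP _ _ _ i (mem s) f is_) => a ? ?; exists a.
have [|fa0] := leP 0 (f a); first by move=> /le_trans; apply; exact: amin.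
suff [] : j0 \in s /\ f j0 = f a by rewrite (negPf j0s).
apply: (connect_invariant (Z := fun j => j \in s /\ f j = f a) (Pirr a j0)) => // b c [bs fb] Pbc.
have E1 : \sum_(j in s) P b j * (f j - f a) + \sum_(j in [predC s]) P b j * (- f a) <= 0.
  rewrite -mulr_suml.
  under eq_bigr do rewrite mulrBr.
  rewrite sumrB -mulr_suml.
  have := Pst.2 b; rewrite (bigID (mem s)) /= => S1.
  have := sup _ bs; rewrite fb big_uniq //= => S2.
  have -> : \sum_(j in [predC s]) P b j = 1 - \sum_(i in s) P b i.
    by rewrite -S1 addrAC subrr add0r; apply: eq_bigl => j; rewrite !inE.
  lra.
have T1 j : j \in s -> 0 <= P b j * (f j - f a).
  by move=> js; rewrite mulr_ge0 ?Pst.1 // subr_ge0 amin.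
have T2 j : j \in [predC s] -> 0 <= P b j * (- f a).
  by move=> js; rewrite mulr_ge0 ?Pst.1 // oppr_ge0 ltW.
have S1 := sumr_ge0 _ T1; have S2 := sumr_ge0 _ T2.
have Z1 : \sum_(j in s) P b j * (f j - f a) = 0 by apply/eqP; rewrite eq_le S1 andbT (le_trans _ E1) ?lerDl.
have Z2 : \sum_(j in [predC s]) P b j * (- f a) = 0 by apply/eqP; rewrite eq_le S2 andbT (le_trans _ E1) ?lerDr.
have cs : c \in s.
  apply/negPn/negP => cs.
  have /eqP := psumr_eq0P T2 Z2 cs.
  by rewrite mulf_eq0 (gt_eqF Pbc) oppr_eq0 (lt_eqF fa0).
split=> //; have /eqP := psumr_eq0P T1 Z1 cs.
by rewrite mulf_eq0 (gt_eqF Pbc) subr_eq0 => /eqP.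
Qed.

(** Reaching [a] before leaving [s'] and then exiting [s] into [L] is one way of exiting into [L].
    There are no paths here: the difference of the two sides is superharmonic on [s'], so the
    minimum principle makes it nonnegative. *)
Lemma exitp_via (s s' : seq 'I_m) (a : 'I_m) (L : {pred 'I_m}) :
  proper_seq s -> uniq s' -> a \in s -> a \notin s' -> {subset s' <= s} ->
  forall i, i \in s' -> exitp s' (pred1 a) i * exitp s L a <= exitp s L i.
Proof.
move=> ps us' as_ as' s's i is'; rewrite -subr_ge0; move: i is'.
have ps' : proper_seq s' by split=> //; exists a.
apply: (min_principle ps') => i is'.
rewrite (exitp_harmonic L i ps) (exitp_harmonic (pred1 a) i ps').
rewrite big_pred1_eq.
under eq_bigr do rewrite mulrBr.
rewrite sumrB; under [X in _ - X <= _]eq_bigr do rewrite mulrA.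
rewrite -mulr_suml.
have : P i a * exitp s L a + \sum_(j <- s') P i j * exitp s L j <=
  \sum_(j | j \in L) P i j + \sum_(b <- s) P i b * exitp s L b.
  rewrite -[leLHS]add0r lerD //; first by apply: sumr_ge0 => j _; exact: Pst.1.
  rewrite -[leLHS](big_cons 0 +%R a s' xpredT (fun j => P i j * exitp s L j)).
  rewrite [leLHS]big_uniq /=; last by rewrite as' us'.
  rewrite [leRHS]big_uniq /=; last exact: ps.1.
  rewrite [leRHS](bigID [in a :: s']) /=.
  rewrite [X in _ <= X + _](eq_bigl [in a :: s']); last first.
    move=> j /=; case: (boolP (j \in a :: s')) => H; rewrite ?andbF ?andbT //.
    by move: H; rewrite inE => /predU1P[->|/s's].
  rewrite lerDl; apply: sumr_ge0 => j _.
  by rewrite mulr_ge0 ?exitp_ge0 //; exact: Pst.1.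
lra.
Qed.

(* The absolute values of a left null vector of [P - 1] are subinvariant, hence invariant. *)
Lemma invariant_measure : (0 < m)%N ->
  exists mu : 'I_m -> R, (forall i, 0 < mu i) /\
    (forall j, \sum_i mu i * P i j = mu j).
Proof.
move=> m0.
pose A : 'M[R]_m := \matrix_(i, j) (P i j - (i == j)%:R).
have A1 : A *m const_mx 1 = 0 :> 'cV_m.
  apply/colP => i; rewrite !mxE.
  under eq_bigr do rewrite !mxE mulr1.
  rewrite sumrB Pst.2 (bigD1 i) //= eqxx big1 ?addr0 ?subrr //.
  by move=> j ji; rewrite eq_sym (negPf ji).
have : \det A = 0.
  apply/eqP; rewrite -det_tr; apply/det0P; exists (const_mx 1).
    apply/eqP => /rowP /(_ (Ordinal m0)); rewrite !mxE => /eqP.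
    by rewrite oner_eq0.
  by apply: trmx_inj; rewrite trmx_mul !trmxK trmx_const A1 trmx0.
move=> /eqP/det0P[v v0 vA].
have vP j : \sum_i v 0 i * P i j = v 0 j.
  have /rowP /(_ j) := vA; rewrite !mxE.
  under eq_bigr do rewrite !mxE mulrBr.
  rewrite sumrB [X in _ - X](bigD1 j) //= eqxx mulr1 [X in _ - (_ + X)]big1 ?addr0; last first.
    by move=> i ij; rewrite (negPf ij) mulr0.
  by move=> /eqP; rewrite subr_eq0 => /eqP.
pose mu i := `|v 0 i|.
have mule j : mu j <= \sum_i mu i * P i j.
  rewrite /mu -{1}(vP j); apply: le_trans (ler_norm_sum _ _ _) _.
  by apply: ler_sum => i _; rewrite normrM (ger0_norm (Pst.1 i j)).
have mueq j : \sum_i mu i * P i j = mu j.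
  have S : \sum_j (\sum_i mu i * P i j - mu j) = 0.
    rewrite sumrB exchange_big /=.
    under eq_bigr do rewrite -mulr_sumr Pst.2 mulr1.
    by rewrite subrr.
  apply/eqP; rewrite -subr_eq0; apply/eqP.
  by apply: (psumr_eq0P _ S) => // i _; rewrite subr_ge0.
exists mu; split => // i.
have [k vk] : exists k, v 0 k != 0 by apply/rV0Pn.
apply: (connect_invariant (Z := fun i => 0 < mu i) (Pirr k i)); first by rewrite /mu normr_gt0.
move=> a b mua Pab; rewrite -mueq (bigD1 a) //= ltr_wpDr ?mulr_gt0 //.
by apply: sumr_ge0 => c _; rewrite mulr_ge0 ?normr_ge0 //; exact: Pst.1.
Qed.

End FiniteChain.

(** * Almost subharmonic functions on an irreducible class *)

Section MaxPrinciple.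
Context {R : realType} {n : nat} (E : pred 'I_n) (B : 'I_n -> 'I_n -> R).
Hypotheses (B0 : forall k l, E k -> E l -> 0 <= B k l)
  (B1 : forall k, E k -> \sum_(l | E l) B k l = 1).
Let e := [rel a b | [&& E a, E b & 0 < B a b]].

(* Along an edge k -> b the gap to the maximum grows at most by the factor 1 + 1 / B k b, up to [d]. *)
Lemma gap_propagates k l : connect e k l ->
  exists C, 0 <= C /\ forall (d : R) (D : 'I_n -> R) Mx, 0 <= d ->
    (forall i, E i -> D i <= Mx) ->
    (forall i, E i -> D i <= \sum_(j | E j) B i j * D j + d) ->
    Mx - D l <= C * (Mx - D k + d).
Proof.
move=> /connectP[q eq_ ->] {l}; elim: q k eq_ => [|b q IH] k /=.
  by move=> _; exists 1; split=> // d D Mx d0 _ _; rewrite mul1r lerDl.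
move=> /andP[/and3P[Ek Eb Bkb] /IH[C [C0 HC]]].
exists (C * ((B k b)^-1 + 1)); split.
  by rewrite mulr_ge0 // addr_ge0 // invr_ge0 ltW.
move=> d D Mx d0 DM Dd; have := HC d D Mx d0 DM Dd.
move=> /le_trans; apply; rewrite -mulrA ler_wpM2l //.
have DMk := DM _ Ek.
rewrite mulrDl mul1r lerD //; last by rewrite lerDr subr_ge0.
rewrite mulrC ler_pdivlMr //.
have := Dd _ Ek; rewrite (bigD1 b) //= => H.
have : \sum_(j | E j && (j != b)) B k j * D j <= (1 - B k b) * Mx.
  rewrite -(B1 Ek) [X in X - _](bigD1 b) //= addrAC subrr add0r mulr_suml.
  by apply: ler_sum => j /andP[Ej _]; rewrite ler_wpM2l ?B0 ?DM.
lra.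
Qed.

(** Propagating from a state of maximal [D], where the gap is zero, bounds every gap by a multiple
    of [d]. The constant depends on [B] alone; the functions [D] to which this is applied vary with
    [eps], while [B] comes from the limit chain. *)
Lemma subharmonic_osc : (forall k l, E k -> E l -> connect e k l) ->
  exists C, 0 <= C /\ forall (d : R) (D : 'I_n -> R), 0 <= d ->
    (forall i, E i -> D i <= \sum_(j | E j) B i j * D j + d) ->
    forall k l, E k -> E l -> D k <= D l + C * d.
Proof.
move=> irr.
have /choice[C HC] : forall kl : 'I_n * 'I_n, exists C, 0 <= C /\
    (E kl.1 -> E kl.2 -> forall (d : R) (D : 'I_n -> R) Mx, 0 <= d ->
    (forall i, E i -> D i <= Mx) ->
    (forall i, E i -> D i <= \sum_(j | E j) B i j * D j + d) ->
    Mx - D kl.2 <= C * (Mx - D kl.1 + d)).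
  move=> [k l] /=; have [Ek|Ek] := boolP (E k); last by exists 0.
  have [El|El] := boolP (E l); last by exists 0.
  by have [C [C0 HC]] := gap_propagates (irr _ _ Ek El); exists C.
exists (\sum_kl C kl); split; first by apply: sumr_ge0 => kl _; case: (HC kl).
move=> d D d0 HD k l Ek El.
have [a Ea amax] : exists2 a, E a & forall b, E b -> D b <= D a.
  by case: (@Order.TotalTheory.arg_maxP _ _ _ k E D Ek) => a ? ?; exists a.
have [_ /(_ Ea El d D (D a) d0 amax HD)] := HC (a, l); rewrite /= subrr add0r.
move=> H; rewrite (le_trans (amax k Ek)) // -lerBlDl (le_trans H) //.
rewrite ler_wpM2r // (bigD1 (a, l)) //= lerDl.
by apply: sumr_ge0 => kl _; case: (HC kl).
Qed.
End MaxPrinciple.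

(** * Asymptotic equivalence as the parameter tends to zero *)

Section Asymp.
Context {R : realType}.
Implicit Types F G : R -> R.

(** Multiplied out rather than stated for [F / G], so that [G] may vanish, in which case [F]
    vanishes with it. The inequality also forces [G], and then [F], to be nonnegative near zero. *)
Definition asymp F G :=
  forall d, 0 < d -> \forall e \near 0^'+, `|F e - G e| <= d * G e.

Definition pos_near F := \forall e \near (0:R)^'+, 0 < F e.
Definition ge0_near F := \forall e \near (0:R)^'+, 0 <= F e.

Lemma asymp_near_eq F F' G G' : asymp F G ->
  (\forall e \near (0:R)^'+, F e = F' e) -> (\forall e \near (0:R)^'+, G e = G' e) ->
  asymp F' G'.
Proof. by move=> H HF HG d d0; near=> e; rewrite -(near HF e)// -(near HG e)//; near: e; exact: H. Unshelve. all: by end_near. Qed.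

Lemma asymp_refl F : ge0_near F -> asymp F F.
Proof. by move=> F0 d d0; near=> e; rewrite subrr normr0 mulr_ge0 ?(ltW d0) //; near: e. Unshelve. all: by end_near. Qed.

Lemma asymp_ge0 F G : asymp F G -> ge0_near G /\ ge0_near F.
Proof.
move=> H; have h12 : (0 : R) < 1/2 by [].
have H1 := H _ h12; split; near=> e.
all: have : `|F e - G e| <= 1/2 * G e by near: e.
all: rewrite ler_norml; lra.
Unshelve. all: by end_near. Qed.

Lemma asymp_sum (I : finType) (A : pred I) (F G : I -> R -> R) :
  (forall i, A i -> asymp (F i) (G i)) ->
  asymp (fun e => \sum_(i | A i) F i e) (fun e => \sum_(i | A i) G i e).
Proof.
move=> H d d0; have : \forall e \near 0^'+, forall i, A i -> `|F i e - G i e| <= d * G i e.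
  apply: filter_forall => i; have [Ai|] := boolP (A i); last by move=> _; near=> e.
  by near=> e => _; near: e; exact: H.
move=> {}H; near=> e.
rewrite -sumrB mulr_sumr (le_trans (ler_norm_sum _ _ _)) // ler_sum // => i Ai.
by move: i Ai; near: e.
Unshelve. all: by end_near. Qed.

Lemma asymp_mul F G F' G' : asymp F G -> asymp F' G' ->
  asymp (fun e => F e * F' e) (fun e => G e * G' e).
Proof.
move=> H H' d d0.
(* The error of the product splits into three terms, each at most [d1 * (G e * G' e)] because
   [d1 <= 1]. *)
pose d1 := Num.min (d / 3) 1; have d10 : 0 < d1 by rewrite lt_min divr_gt0 //=.
near=> e.
have h : `|F e - G e| <= d1 * G e by near: e; exact: H.
have h' : `|F' e - G' e| <= d1 * G' e by near: e; exact: H'.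
have G0 : 0 <= G e by near: e; exact: (asymp_ge0 H).1.
have G0' : 0 <= G' e by near: e; exact: (asymp_ge0 H').1.
have d1d : d1 <= d / 3 by rewrite ge_min lexx.
have d11 : d1 <= 1 by rewrite ge_min lexx orbT.
have -> : F e * F' e - G e * G' e =
  (F e - G e) * (F' e - G' e) + (F e - G e) * G' e + G e * (F' e - G' e) by ring.
have GG : 0 <= G e * G' e by rewrite mulr_ge0.
apply: le_trans (ler_normD _ _) _; apply: le_trans (lerD (ler_normD _ _) (lexx _)) _.
rewrite !normrM (ger0_norm G0) (ger0_norm G0').
have a1 : `|F e - G e| * `|F' e - G' e| <= (d1 * G e) * (d1 * G' e) by rewrite ler_pM.
have a2 : `|F e - G e| * G' e <= (d1 * G e) * G' e by rewrite ler_wpM2r.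
have a3 : G e * `|F' e - G' e| <= G e * (d1 * G' e) by rewrite ler_wpM2l.
have a4 : d1 * d1 * (G e * G' e) <= d1 * (G e * G' e).
  by rewrite ler_wpM2r // -[leRHS]mulr1 ler_wpM2l // ltW.
have a5 : d1 * (G e * G' e) <= d/3 * (G e * G' e) by rewrite ler_wpM2r.
nra.
Unshelve. all: by end_near. Qed.

Lemma asymp_inv F G : pos_near G -> asymp F G ->
  asymp (fun e => (F e)^-1) (fun e => (G e)^-1).
Proof.
move=> G0 H d d0.
pose d1 := Num.min (d / 2) (1/2); have d10 : 0 < d1.
  by rewrite lt_min divr_gt0 //= divr_gt0.
near=> e.
have h : `|F e - G e| <= d1 * G e by near: e; exact: H.
have Gp : 0 < G e by near: e.
have d1d : d1 <= d / 2 by rewrite ge_min lexx.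
have d11 : d1 <= 1/2 by rewrite ge_min lexx orbT.
have GF : G e <= 2 * F e by move: h; rewrite ler_norml; nra.
have F0 : 0 < F e by lra.
have -> : (F e)^-1 - (G e)^-1 = (G e - F e) / F e / G e.
  by field; rewrite !gt_eqF.
rewrite !normrM !normfV (gtr0_norm F0) (gtr0_norm Gp) ler_pM2r ?invr_gt0 //.
rewrite ler_pdivrMr // distrC.
apply: le_trans h _; nra.
Unshelve. all: by end_near. Qed.

Lemma asymp_sym F G : asymp F G -> asymp G F.
Proof.
move=> H d d0.
pose d1 := Num.min (d / 2) (1/2); have d10 : 0 < d1.
  by rewrite lt_min divr_gt0 //= divr_gt0.
near=> e.
have h : `|F e - G e| <= d1 * G e by near: e; exact: H.
have Gp : 0 <= G e by near: e; exact: (asymp_ge0 H).1.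
have d1d : d1 <= d / 2 by rewrite ge_min lexx.
have d11 : d1 <= 1/2 by rewrite ge_min lexx orbT.
have GF : G e <= 2 * F e by move: h; rewrite ler_norml; nra.
rewrite distrC; apply: le_trans h _; nra.
Unshelve. all: by end_near. Qed.

Lemma asymp_trans F G K : asymp F G -> asymp G K -> asymp F K.
Proof.
move=> H H' d d0.
pose d1 := Num.min (d / 3) 1; have d10 : 0 < d1 by rewrite lt_min divr_gt0 //=.
near=> e.
have h : `|F e - G e| <= d1 * G e by near: e; exact: H.
have h' : `|G e - K e| <= d1 * K e by near: e; exact: H'.
have G0 : 0 <= G e by near: e; exact: (asymp_ge0 H).1.
have K0 : 0 <= K e by near: e; exact: (asymp_ge0 H').1.
have d1d : d1 <= d / 3 by rewrite ge_min lexx.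
have d11 : d1 <= 1 by rewrite ge_min lexx orbT.
apply: le_trans (ler_distD (G e) _ _) _.
have : G e <= 2 * K e by move: h'; rewrite ler_norml; nra.
nra.
Unshelve. all: by end_near. Qed.

End Asymp.

(** * Fluxes between clusters *)

Section Flux.
Context {R : realType} {m n : nat}.
Variables (P : 'I_m -> 'I_m -> R) (mu : 'I_m -> R) (p : 'I_m -> 'I_n).

Definition flux k l := \sum_(i | p i == k) \sum_(j | p j == l) mu i * P i j.
Definition outflux k := \sum_(l | l != k) flux k l.
Definition block k : seq 'I_m := enum [pred i | p i == k].
(** The cluster of [a] without [a]: leaving this set means either hitting [a] or leaving the
    cluster, so its exit law measures recurrence to [a]. *)
Definition block_minus (a : 'I_m) : seq 'I_m :=
  enum [pred i | (p i == p a) && (i != a)].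

Lemma mem_block k i : (i \in block k) = (p i == k).
Proof. by rewrite mem_enum. Qed.

Lemma mem_block_minus a i : (i \in block_minus a) = (p i == p a) && (i != a).
Proof. by rewrite mem_enum. Qed.

Lemma big_block k (F : 'I_m -> R) : \sum_(i <- block k) F i = \sum_(i | p i == k) F i.
Proof. by rewrite big_enum. Qed.

Lemma block_minus_proper a : proper_seq (block_minus a).
Proof. by split; [exact: enum_uniq|exists a; rewrite mem_block_minus !eqxx]. Qed.

Hypotheses (Pst : stochastic P) (Pirr : irreducible_chain P)
  (mu0 : forall i, 0 < mu i) (muP : forall j, \sum_i mu i * P i j = mu j).
Hypotheses (psurj : forall k, exists i, p i = k) (n1 : (1 < n)%N).

Lemma block_proper k : proper_seq (block k).
Proof.
split; first exact: enum_uniq.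
have [l lk] : exists l : 'I_n, l != k.
  case: (eqVneq k (Ordinal n1)) => [->|H]; last by exists (Ordinal n1); rewrite eq_sym.
  by exists (Ordinal (ltn_trans (ltnSn 0) n1)); apply/eqP => /(congr1 val).
by have [i pi] := psurj l; exists i; rewrite mem_block pi.
Qed.

Lemma flux_ge0 k l : 0 <= flux k l.
Proof. by do 2 (apply: sumr_ge0 => ? _); rewrite mulr_ge0 ?Pst.1 // ltW. Qed.

(** With the internal flux included, outflow and inflow both equal the [mu]-mass of the block, the
    former by row sums and the latter by invariance. The internal flux then cancels. *)
Lemma flux_in_out k : outflux k = \sum_(l | l != k) flux l k.
Proof.
have E1 : \sum_l flux k l = \sum_(i | p i == k) mu i.
  rewrite exchange_big /=; apply: eq_bigr => i _.
  rewrite -[RHS]mulr1 -(Pst.2 i) mulr_sumr.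
  by rewrite (partition_big p predT).
have E2 : \sum_l flux l k = \sum_(i | p i == k) mu i.
  rewrite /flux; under eq_bigr do rewrite exchange_big /=.
  rewrite exchange_big /=; apply: eq_bigr => j _.
  by rewrite -muP (partition_big p predT).
have := E1; rewrite -E2 (bigD1 k) //= [X in _ = X](bigD1 k) //=.
exact: addrI.
Qed.

(* Sum the harmonicity of the exit probability [e] against [mu] over the block: by invariance only
   the mass entering the block from outside survives, weighted by [e]. *)
Lemma flux_harmonic k l : k != l ->
  flux k l = \sum_(j | p j == k)
    exitp P (block k) [pred x | p x == l] j * \sum_(i | p i != k) mu i * P i j.
Proof.
move=> kl; pose e := exitp P (block k) [pred x | p x == l].
rewrite -[LHS]/(flux k l) -/e.
have H i : \sum_(j | p j == l) mu i * P i j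
    = mu i * e i - \sum_(j | p j == k) mu i * P i j * e j.
  rewrite /e (exitp_harmonic Pst Pirr _ i (block_proper k)) big_block.
  rewrite mulrDr !mulr_sumr [X in _ + X - _](eq_bigr (fun j => mu i * P i j * e j)).
    by rewrite addrK; apply: eq_bigl.
  by move=> j _; rewrite mulrA.
rewrite /flux (eq_bigr _ (fun i _ => H i)) sumrB exchange_big /= -sumrB.
apply: eq_bigr => j _; rewrite mulr_sumr -{1}muP mulr_suml.
rewrite [X in X - _](bigID [pred i | p i == k]) /= addrAC subrr add0r.
by apply: eq_bigr => i _; rewrite mulrC.
Qed.

(** The weights in [flux_harmonic] add up to the total inflow, which equals the outflow; [flux k l]
    is thus [outflux k] times an average of the exit probabilities over the block. *)
Lemma flux_bounds k l (a b : R) : k != l ->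
  (forall i, p i = k -> a <= exitp P (block k) [pred x | p x == l] i <= b) ->
  a * outflux k <= flux k l <= b * outflux k.
Proof.
move=> kl H.
have E : outflux k = \sum_(j | p j == k) \sum_(i | p i != k) mu i * P i j.
  rewrite flux_in_out exchange_big /= (partition_big p [pred l | l != k]) //=.
  apply: eq_bigr => l' l'k; rewrite /flux; apply: eq_bigl => i.
  by case: eqVneq => [->|]; rewrite ?l'k ?andbF.
have I0 j : 0 <= \sum_(i | p i != k) mu i * P i j.
  by apply: sumr_ge0 => i _; rewrite mulr_ge0 ?Pst.1 // ltW.
rewrite (flux_harmonic kl) E !mulr_sumr; apply/andP; split; apply: ler_sum => j /eqP pj.
all: by have /andP[] := H j pj => *; rewrite ler_wpM2r.
Qed.

Lemma outflux_gt0 k : 0 < outflux k.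
Proof.
have O0 : 0 <= outflux k by apply: sumr_ge0 => l _; exact: flux_ge0.
rewrite lt_neqAle O0 andbT; apply/eqP => /esym O.
have [i pi] := psurj k; have [_ [j]] := block_proper k; rewrite mem_block => /eqP; apply.
apply: (connect_invariant (Z := fun j => p j = k) (Pirr i j)) => // a b pa Pab.
apply/eqP/negPn/negP => pb.
have F0 : flux k (p b) = 0 by apply: (psumr_eq0P _ O) => // l _; exact: flux_ge0.
have F1 : \sum_(j | p j == p b) mu a * P a j = 0.
  apply: (psumr_eq0P _ F0); last exact/eqP.
  by move=> c _; apply: sumr_ge0 => ? _; rewrite mulr_ge0 ?Pst.1 // ltW.
have /eqP : mu a * P a b = 0.
  by apply: (psumr_eq0P _ F1) => // ? _; rewrite mulr_ge0 ?Pst.1 // ltW.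
by rewrite mulf_eq0 !gt_eqF.
Qed.

End Flux.

Lemma flux_comp {R : realType} {m n n' : nat} (P : 'I_m -> 'I_m -> R) mu
    (p : 'I_m -> 'I_n) (c : 'I_n -> 'I_n') K L :
  flux P mu (c \o p) K L = \sum_(k | c k == K) \sum_(l | c l == L) flux P mu p k l.
Proof.
rewrite /flux (partition_big p [pred k | c k == K]) //=; apply: eq_bigr => k /eqP ck.
rewrite exchange_big /= (partition_big p [pred k | c k == L]) //=; apply: eq_bigr => l /eqP cl.
rewrite exchange_big /=; apply: eq_big => [i|i _].
  by case: (eqVneq (p i) k) => [->|]; rewrite ?andbF // ck eqxx.
apply: eq_bigl => j.
by case: (eqVneq (p j) l) => [->|]; rewrite ?andbF // cl eqxx.
Qed.

(** * Comparison of exit probabilities by the minimum principle *)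

Section Comparison.
Context {R : realType} {m : nat} (P : 'I_m -> 'I_m -> R).
Hypotheses (Pst : stochastic P) (Pirr : irreducible_chain P).

(** The equation for [s] contains additional nonnegative terms from the states of [s] outside [s'],
    so the difference is superharmonic on [s']. *)
Lemma exitp_mono (s s' : seq 'I_m) (L : {pred 'I_m}) :
  proper_seq s -> uniq s' -> {subset s' <= s} ->
  forall i, i \in s' -> exitp P s' L i <= exitp P s L i.
Proof.
move=> ps us' s's i is'; rewrite -subr_ge0; move: i is'.
have ps' : proper_seq s'.
  by split=> //; case: ps => _ [j js]; exists j; apply: contra js; exact: s's.
apply: (min_principle Pst Pirr ps') => i is'.
rewrite (exitp_harmonic Pst Pirr L i ps) (exitp_harmonic Pst Pirr L i ps').
under eq_bigr do rewrite mulrBr.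
rewrite sumrB opprD addrACA subrr add0r lerD2r.
rewrite !big_uniq //=; last exact: ps.1.
rewrite [leRHS](bigID [in s']) /=.
rewrite [X in _ <= X + _](eq_bigl [in s']); last first.
  by move=> j /=; case: (boolP (j \in s')) => H; rewrite ?andbF ?andbT // (s's _ H).
rewrite lerDl; apply: sumr_ge0 => j _.
by rewrite mulr_ge0 ?exitp_ge0 //; exact: Pst.1.
Qed.

(** Optional stopping at the exit from block [k], keeping only the exits into other blocks of [E].
    It passes from a superharmonic function of states to an inequality between the blocks, weighted
    by the exit law of block [k]. *)
Lemma superharmonic_through (n : nat) (p : 'I_m -> 'I_n) (E : pred 'I_n) k
    (f : 'I_m -> R) (d : 'I_n -> R) :
  proper_seq (block p k) -> E k ->
  (forall j, p j = k -> \sum_(b | E (p b)) P j b * f b <= f j) ->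
  (forall b, E (p b) -> p b != k -> d (p b) <= f b) ->
  forall j, p j = k ->
    \sum_(l | E l && (l != k)) exitp P (block p k) [pred x | p x == l] j * d l <= f j.
Proof.
move=> pk Ek fs df j pj; rewrite -subr_ge0.
have : j \in block p k by rewrite mem_block pj.
move: j {pj}; apply: (min_principle Pst Pirr pk) => j; rewrite mem_block => /eqP pj.
rewrite big_block; under eq_bigr do rewrite mulrBr.
have fj := fs j pj.
rewrite sumrB lerBrDr addrAC.
apply: le_trans (_ : \sum_(b | p b == k) P j b * f b +
   \sum_(l | E l && (l != k)) (\sum_(b | p b == l) P j b) * d l <= _); last first.
  apply: le_trans fj; rewrite [leRHS](bigID [pred b | p b == k]) /=.
  rewrite [X in _ <= X + _](eq_bigl [pred b | p b == k]); last first.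
    by move=> b /=; case: (eqVneq (p b) k) => [->|]; rewrite ?Ek ?andbF.
  rewrite lerD2l [leRHS](partition_big p [pred l | E l && (l != k)]) //=.
  apply: ler_sum => l /andP[El lk]; rewrite mulr_suml.
  rewrite [leRHS](eq_bigl [pred b | p b == l]); last first.
    by move=> b /=; case: (eqVneq (p b) l) => [->|]; rewrite ?El ?lk ?andbF.
  apply: ler_sum => b /eqP bl; rewrite ler_wpM2l ?Pst.1 //.
  by rewrite -bl df // bl.
rewrite -addrA lerD2l.
have -> : \sum_(l | E l && (l != k)) exitp P (block p k) [pred x | p x == l] j * d l =
   \sum_(l | E l && (l != k)) ((\sum_(b | p b == l) P j b) * d l +
     \sum_(b | p b == k) P j b * (exitp P (block p k) [pred x | p x == l] b * d l)).
  apply: eq_bigr => l _; rewrite (exitp_harmonic Pst Pirr _ j pk) mulrDl big_block.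
  congr (_ + _); rewrite mulr_suml; apply: eq_bigr => b _; by rewrite mulrA.
rewrite big_split /= exchange_big /=.
under [X in _ + X - _ <= _]eq_bigr do rewrite -mulr_sumr.
by rewrite addrK.
Qed.
End Comparison.

(** * Induction along the hierarchy *)

Lemma near0_ex {R : realType} (A : R -> Prop) :
  (\forall e \near 0^'+, A e) -> exists2 e : R, 0 < e & A e.
Proof.
move=> H; have [e [e0 Ae]] : exists e : R, 0 < e /\ A e.
  by apply: (@filter_ex _ (0 : R)^'+); near=> e; split; near: e; [exact: nbhs_right_gt|].
by exists e.
Unshelve. all: by end_near. Qed.

Section HierStep.
Context {R : realType} {m n n' : nat}.
Variables (P : R -> 'I_m -> 'I_m -> R) (mu : R -> 'I_m -> R).
Variables (p : 'I_m -> 'I_n) (PN : R -> 'I_n -> 'I_n -> R).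
Hypotheses (Pst : forall e : R, 0 < e -> stochastic (P e))
  (Pirr : forall e : R, 0 < e -> irreducible_chain (P e))
  (mu0 : forall e : R, 0 < e -> forall i, 0 < mu e i)
  (muP : forall e : R, 0 < e -> forall j, \sum_i mu e i * P e i j = mu e j).
Hypotheses (psurj : forall k, exists i, p i = k) (n1 : (1 < n)%N).

Let fl (e : R) (k l : 'I_n) := flux (P e) (mu e) p k l.
Let out (e : R) (k : 'I_n) := outflux (P e) (mu e) p k.

(* From any state of a block, any other state of it is reached before leaving the block with
   probability tending to one. *)
Definition recurrent_blocks (q : nat) (p : 'I_m -> 'I_q) := forall i a, p i = p a -> i != a ->
  forall d, 0 < d -> \forall e \near 0^'+,
    1 - d <= exitp (P e) (block_minus p a) (pred1 a) i.

(** The invariant of the induction over ranks, multiplied out so that identically zero transitions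
    are allowed. The diagonal is treated apart because [flux k k] is internal to the block and
    unrelated to exits. *)
Definition flux_ratio (q : nat) (p : 'I_m -> 'I_q) (PN : R -> 'I_q -> 'I_q -> R) :=
  (forall k l, k != l ->
    asymp (fun e => PN e k l * outflux (P e) (mu e) p k)
          (fun e => flux (P e) (mu e) p k l)) /\
  (forall e : R, 0 < e -> forall k, PN e k k = 0).

Hypothesis rec : recurrent_blocks p.

Lemma fl_ge0 k l : ge0_near (fun e => fl e k l).
Proof. by near=> e; apply: flux_ge0; [apply: Pst|apply: mu0]. Unshelve. all: by end_near. Qed.

Lemma out_gt0 k : pos_near (out^~ k).
Proof.
by near=> e; apply: outflux_gt0 => //; [apply: Pst|apply: Pirr|apply: mu0].
Unshelve. all: by end_near. Qed.

Lemma fl_le_out k l : k != l -> \forall e \near 0^'+, fl e k l <= out e k.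
Proof.
move=> kl; near=> e; rewrite /out /outflux (bigD1 l) 1?eq_sym //= lerDl.
apply: sumr_ge0 => j _; apply: flux_ge0; [exact: Pst|exact: mu0].
Unshelve. all: by end_near. Qed.

(** Recurrence makes the exit probability [g] into [l] nearly constant on the block: from [a] the
    chain meets [b] first with probability at least [r], so [r * g b <= g a]. A weighted mean of [g]
    is the ratio of [fl] to [out], hence each value is close to that ratio. *)
Lemma exitp_flux k l i : k != l -> p i = k ->
  asymp (fun e => exitp (P e) (block p k) [pred x | p x == l] i * out e k) (fun e => fl e k l).
Proof.
move=> kl pi d d0.
(* The bound [r >= 1 / 2] gives [x <= 2 * fl e k l], and [1 - r <= d / 2] then yields the relative
   error [d]. *)
pose r := 1 - Num.min (d / 2) (1 / 2).
have r12 : 1 / 2 <= r by rewrite /r lerBrDl -lerBrDr ge_min; apply/orP; right; lra.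
have r1 : r < 1 by rewrite /r ltrBlDr ltrDl lt_min divr_gt0 //=.
have rd : 1 - r <= d / 2 by rewrite /r subKr ge_min lexx.
have rec' : \forall e \near 0^'+, forall a b, p a = k -> p b = k -> a != b ->
    r <= exitp (P e) (block_minus p b) (pred1 b) a.
  apply: filter_forall => a; apply: filter_forall => b.
  have [pa|] := eqVneq (p a) k; last by move=> pa; near=> e => pa'; rewrite pa' eqxx in pa.
  have [pb|] := eqVneq (p b) k; last by move=> pb; near=> e => _ pb'; rewrite pb' eqxx in pb.
  have [ab|ab] := eqVneq a b; first by near=> e.
  near=> e => _ _ _; rewrite /r; near: e; apply: rec => //; first by rewrite pa pb.
  by rewrite lt_min divr_gt0 //=.
near=> e.
have e0 : 0 < e by near: e; exact: nbhs_right_gt.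
pose g := exitp (P e) (block p k) [pred x | p x == l].
have g0 a : 0 <= g a by apply: exitp_ge0; exact: Pst.
have gg a b : p a = k -> p b = k -> r * g b <= g a.
  move=> pa pb; have [->|ab] := eqVneq a b; first by rewrite ler_piMl // ltW.
  have H : r <= exitp (P e) (block_minus p b) (pred1 b) a by move: a b pa pb ab; near: e.
  apply: le_trans (ler_wpM2r (g0 b) H) _.
  apply: exitp_via => //; [exact: Pst|exact: Pirr|exact: block_proper|
    exact: enum_uniq|by rewrite mem_block pb|
    by rewrite mem_block_minus !eqxx| | ].
  - by move=> j; rewrite mem_block_minus mem_block pb => /andP[].
  - by rewrite mem_block_minus pa pb eqxx.
have /andP[h1 h2] : r * g i * out e k <= fl e k l <= r^-1 * g i * out e k.
  apply: flux_bounds => // [||||a pa]; [exact: Pst|exact: Pirr|exact: mu0|exact: muP|].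
  by rewrite gg // /= [r^-1 * _]mulrC ler_pdivlMr; [rewrite mulrC gg|lra].
have o0 : 0 < out e k by near: e; exact: out_gt0.
rewrite -/(g i); set x := g i * out e k.
have {}h1 : r * x <= fl e k l by rewrite mulrA.
have {}h2 : r * fl e k l <= x.
  by move: h2; rewrite -mulrA -/x [r^-1 * x]mulrC ler_pdivlMr; [rewrite mulrC|lra].
have x0 : 0 <= x by rewrite mulr_ge0 // ltW.
have F0 : 0 <= fl e k l by rewrite (le_trans _ h1) // mulr_ge0 //; lra.
have x2 : x <= 2 * fl e k l by nra.
have hx : (1 - r) * x <= d / 2 * x by rewrite ler_wpM2r.
have hF : (1 - r) * fl e k l <= d / 2 * fl e k l by rewrite ler_wpM2r.
have hd : d * x <= d * (2 * fl e k l) by rewrite ler_wpM2l // ltW.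
rewrite ler_norml; apply/andP; split; nra.
Unshelve. all: by end_near. Qed.

Variables (P0 : 'I_n -> 'I_n -> R).
Hypotheses (PN0 : forall k l, (fun e => PN e k l) @ 0^'+ --> P0 k l)
  (ratio : flux_ratio p PN).

(** The error is measured against the whole outflux since [P0 k l] may be zero. *)
Lemma flux_lim k l d : k != l -> 0 < d ->
  \forall e \near 0^'+, `|fl e k l - P0 k l * out e k| <= d * out e k.
Proof.
move=> kl d0; have d20 : 0 < d / 2 by rewrite divr_gt0.
near=> e.
have h1 : `|PN e k l * out e k - fl e k l| <= d / 2 * fl e k l.
  by near: e; exact: ratio.1.
have h2 : `|P0 k l - PN e k l| <= d / 2.
  by near: e; move/cvgrPdist_le : (PN0 (k:=k) (l:=l)); exact.
have o0 : 0 < out e k by near: e; exact: out_gt0.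
have fo : fl e k l <= out e k by near: e; exact: fl_le_out.
move: h1 h2; rewrite !ler_norml => /andP[? ?] /andP[? ?]; apply/andP; split; nra.
Unshelve. all: by end_near. Qed.

Lemma lim_diag k : P0 k k = 0.
Proof.
apply/eqP; rewrite -normr_le0; apply/ler_addgt0Pl => d d0; rewrite addr0.
have /cvgrPdist_le /(_ _ d0) H := PN0 (k:=k) (l:=k).
have [|e e0] := @near0_ex R (fun e => `|P0 k k - PN e k k| <= d); first exact: H.
by rewrite ratio.2 // subr0.
Qed.

Lemma lim_ge0 k l : 0 <= P0 k l.
Proof.
have [->|kl] := eqVneq k l; first by rewrite lim_diag.
rewrite leNgt; apply/negP => P00.
have [|e e0 [h [f0 o0]]] := @near0_ex R (fun e =>
   `|fl e k l - P0 k l * out e k| <= (- P0 k l / 2) * out e k /\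
   (0 <= fl e k l /\ 0 < out e k)).
  near=> e; do !split; near: e; [apply: flux_lim => //|exact: fl_ge0|exact: out_gt0].
  by rewrite divr_gt0 // oppr_gt0.
by move: h; rewrite ler_norml => /andP[_]; nra.
Unshelve. all: by end_near. Qed.

(** The fluxes to the other clusters add up to the outflux exactly; dividing by the outflux and
    passing to the limit gives the row sum. *)
Lemma lim_sum1 k : \sum_l P0 k l = 1.
Proof.
rewrite (bigD1 k) //= lim_diag add0r; apply/eqP; rewrite -subr_eq0 -normr_le0.
apply/ler_addgt0Pl => d d0; rewrite addr0.
have n0 : (0 : R) < n%:R by rewrite ltr0n (ltn_trans _ n1).
have H : \forall e \near 0^'+, forall l, k != l ->
    `|fl e k l - P0 k l * out e k| <= (d / n%:R) * out e k.
  apply: filter_forall => l; have [->|kl] := eqVneq k l; first by near=> e.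
  by near=> e => _; near: e; apply: flux_lim; rewrite // divr_gt0.
have [|e e0 [h o0]] := @near0_ex R (fun e =>
   (forall l, k != l -> `|fl e k l - P0 k l * out e k| <= (d / n%:R) * out e k) /\
   (0 < out e k)).
  by near=> e; split; near: e; last exact: out_gt0.
rewrite -(ler_pM2r o0) -{1}(gtr0_norm o0) -normrM mulrBl mul1r mulr_suml -{1}/(out e k).
rewrite {2}/out /outflux -/fl -sumrB.
apply: le_trans (ler_norm_sum _ _ _) _.
apply: le_trans (_ : \sum_(l | l != k) (d / n%:R) * out e k <= _).
  by apply: ler_sum => l lk; rewrite distrC; apply: h; rewrite eq_sym.
rewrite sumr_const -[leLHS]mulr_natl.
apply: le_trans (_ : n%:R * (d / n%:R * out e k) <= _).
  rewrite ler_wpM2r ?ler_nat //; first by rewrite mulr_ge0 ?divr_ge0 ?ltW.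
  by rewrite -[X in (_ <= X)%N](card_ord n) max_card.
by rewrite mulrA mulrCA divff ?mulr1 // gt_eqF.
Unshelve. all: by end_near. Qed.

Variables (c : 'I_n -> 'I_n') (PN' : R -> 'I_n' -> 'I_n' -> R) (lam : 'I_n -> R).
Hypotheses (csurj : forall K, exists k, c k = K) (n'1 : (1 < n')%N)
  (classes : forall K,
     (ergodic_class P0 [pred k | c k == K] /\
      forall l, c l = K -> lam l = \sum_(k | c k == K) lam k * P0 k l) \/
     (exists k, (forall a, c a = K <-> a = k) /\ transient P0 k))
  (lam0 : forall k, 0 <= lam k) (lam1 : forall K, \sum_(k | c k == K) lam k = 1)
  (PN'E : forall e K L, PN' e K L = if K == L then 0 else
     (\sum_(k | c k == K) \sum_(l | c l == L) lam k * PN e k l) /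
     (\sum_(k | c k == K) \sum_(l | c l != K) lam k * PN e k l)).

Lemma blocks_compat_surj K : exists i, (c \o p) i = K.
Proof. by have [k <-] := csurj K; have [i <-] := psurj k; exists i. Qed.

Lemma sum_classes K (F : 'I_n -> R) :
  \sum_(L | L != K) \sum_(l | c l == L) F l = \sum_(l | c l != K) F l.
Proof.
rewrite [RHS](partition_big c [pred L | L != K]) //=; apply: eq_bigr => L LK.
by apply: eq_bigl => l; case: (eqVneq (c l) L) => [->|]; rewrite ?LK ?andbF.
Qed.

Section Ergodic.
Variable K : 'I_n'.
Hypotheses (erg : ergodic_class P0 [pred k | c k == K])
  (inv : forall l, c l = K -> lam l = \sum_(k | c k == K) lam k * P0 k l).

Lemma class_connect k l : c k = K -> c l = K ->
  connect [rel a b | [&& c a == K, c b == K & 0 < P0 a b]] k l.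
Proof.
case: erg => _ /(_ k l)/= + clo ck cl; rewrite ck cl eqxx => /(_ isT isT).
move=> /connectP[q]; elim: q k ck => [|b q IH] k ck /=; first by move=> _ ->.
move=> /andP[kb bq] lq; have cb : c b == K by apply: (clo k b) kb => /=; rewrite ck.
apply: (@connect_trans _ _ b); last by apply: IH => //; exact/eqP.
by apply: connect1; rewrite /= ck eqxx cb.
Qed.

Lemma class_lim_sum k : c k = K -> \sum_(l | c l == K) P0 k l = 1.
Proof.
move=> ck; rewrite -(lim_sum1 k) [RHS](bigID [pred l | c l == K]) /=.
rewrite [X in _ = _ + X]big1 ?addr0 // => l cl.
apply/eqP/negPn/negP => H; case: erg => _ _ /(_ k l); rewrite /= ck eqxx (negPf cl).
by rewrite lt_neqAle eq_sym H lim_ge0 => /(_ isT isT).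
Qed.

Lemma class_lim0 k l : c k = K -> c l != K -> P0 k l = 0.
Proof.
move=> ck cl; apply/eqP/negPn/negP => H; case: erg => _ _ /(_ k l).
by rewrite /= ck eqxx (negPf cl) lt_neqAle eq_sym H lim_ge0 => /(_ isT isT).
Qed.

Lemma lam_gt0 k : c k = K -> 0 < lam k.
Proof.
move=> ck; have [a ca la] : exists2 a, c a = K & 0 < lam a.
  apply: contrapT => H; have := lam1 K; rewrite big1 => [/eqP|a /eqP ca].
    by rewrite eq_sym oner_eq0.
  by apply/eqP; rewrite eq_le lam0 andbT leNgt; apply/negP => ?; apply: H; exists a.
apply: (connect_invariant (Z := fun k => c k = K -> 0 < lam k) (class_connect ca ck)) => //.
move=> x y Hx /= /and3P[/eqP cx /eqP cy Pxy] _; rewrite inv // (bigD1 x) /= ?cx ?eqxx //.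
rewrite ltr_wpDr ?mulr_gt0 ?Hx //.
by apply: sumr_ge0 => z _; rewrite mulr_ge0 ?lam0 // lim_ge0.
Qed.

(** The weights [lam k * P0 k l / lam l], read as a transition from [l] to [k], form the time
    reversal of the limit chain: rows sum to one by invariance of [lam], and the edges are those of
    [P0] reversed, so the class stays irreducible. *)
Lemma reversed_osc : exists C, 0 <= C /\ forall (d : R) (D : 'I_n -> R), 0 <= d ->
  (forall l, c l = K -> D l <= \sum_(k | c k == K) lam k * P0 k l / lam l * D k + d) ->
  forall k l, c k = K -> c l = K -> D k <= D l + C * d.
Proof.
have [|||C [C0 HC]] :=
  @subharmonic_osc R n [pred k | c k == K] (fun l k => lam k * P0 k l / lam l).
- by move=> k l _ _; rewrite divr_ge0 ?mulr_ge0 ?lam0 ?lim_ge0.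
- move=> k /= /eqP ck; rewrite -mulr_suml -inv // divff // gt_eqF //.
  exact: lam_gt0.
- move=> k l /eqP ck /eqP cl.
  have := class_connect cl ck; rewrite connect_rev /=; apply: connect_sub => a b /=.
  move=> /and3P[/eqP cb /eqP ca Pab]; apply: connect1; rewrite /= ca cb !eqxx /=.
  by rewrite divr_gt0 ?mulr_gt0 ?lam_gt0.
exists C; split=> // d D d0 HD k l ck cl.
by apply: (HC d D d0) => /= [j /eqP cj||]; rewrite ?HD ?ck ?cl.
Qed.

Let mE e := \sum_(k | c k == K) out e k.

Lemma mE_gt0 : pos_near mE.
Proof.
have [k ck] := csurj K; near=> e; rewrite /mE (bigD1 k) ?ck //= ltr_wpDr //.
  by apply: sumr_ge0 => l _; apply: sumr_ge0 => j _; apply: flux_ge0; [exact: Pst|exact: mu0].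
by near: e; exact: out_gt0.
Unshelve. all: by end_near. Qed.

(** An ergodic class is closed for the limit chain, so the flux leaving it is negligible against
    [mE]; flux balance for the coarser partition transfers this to the flux entering it. *)
Lemma class_inflow d : 0 < d ->
  \forall e \near 0^'+, \sum_(l | c l == K) \sum_(k | c k != K) fl e k l <= d * mE e.
Proof.
move=> d0.
have n0 : (0 : R) < n%:R by rewrite ltr0n (ltn_trans _ n1).
have H : \forall e \near 0^'+, forall k l, c k = K -> c l != K ->
    fl e k l <= (d / n%:R) * out e k.
  apply: filter_forall => k; apply: filter_forall => l.
  have [ck|ck] := eqVneq (c k) K; last by near=> e => ck'; rewrite ck' eqxx in ck.
  have [cl|cl] := eqVneq (c l) K; first by near=> e.
  have kl : k != l by apply: contra_neq cl => <-.
  near=> e => _ _.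
  have : `|fl e k l - P0 k l * out e k| <= d / n%:R * out e k.
    by near: e; apply: flux_lim; rewrite // divr_gt0.
  by rewrite class_lim0 // mul0r subr0; apply: le_trans; exact: ler_norm.
near=> e; have e0 : 0 < e by near: e; exact: nbhs_right_gt.
have -> : \sum_(l | c l == K) \sum_(k | c k != K) fl e k l =
   \sum_(k | c k == K) \sum_(l | c l != K) fl e k l.
  have := flux_in_out (c \o p) (Pst e0) (muP e0) K.
  rewrite /outflux; under eq_bigr do rewrite flux_comp.
  under [X in _ = X -> _]eq_bigr do rewrite flux_comp exchange_big /=.
  rewrite exchange_big [X in _ = X -> _]exchange_big /=.
  under eq_bigr do rewrite sum_classes.
  by under [X in _ = X -> _]eq_bigr do rewrite sum_classes.
rewrite mulr_sumr; apply: ler_sum => k /eqP ck.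
apply: le_trans (_ : \sum_(l | c l != K) (d / n%:R) * out e k <= _).
  by apply: ler_sum => l cl; move: k l ck cl; near: e.
have o0 : 0 < out e k by move: k {ck}; near: e; apply: filter_forall; exact: out_gt0.
rewrite sumr_const -[leLHS]mulr_natl.
apply: le_trans (_ : n%:R * (d / n%:R * out e k) <= _).
  rewrite ler_wpM2r ?ler_nat //; first by rewrite mulr_ge0 ?divr_ge0 ?ltW.
  by rewrite -[X in (_ <= X)%N](card_ord n) max_card.
by rewrite mulrA mulrCA divff ?mulr1 // gt_eqF.
Unshelve. all: by end_near. Qed.

(* Balance of fluxes makes [out / lam] almost harmonic for the time reversal of the limit chain on
   the class, hence almost constant there. *)
Lemma lam_outflux k : c k = K -> asymp (fun e => lam k * mE e) (fun e => out e k).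
Proof.
move=> ck; apply: asymp_sym => d d0.
have [C [C0 HC]] := reversed_osc.
pose La := \sum_(l | c l == K) (lam l)^-1.
have La_ge l : c l = K -> (lam l)^-1 <= La.
  move=> cl; rewrite /La (bigD1 l) ?cl //= lerDl.
  by apply: sumr_ge0 => j _; rewrite invr_ge0.
have La0 : 0 <= La by apply: sumr_ge0 => j _; rewrite invr_ge0.
(* Chosen so that the oscillation bound [C * (2 * d1 * La * mE e)] is at most [d * mE e]; the [+ 1]
   covers a vanishing [C]. *)
pose d1 := d / (C * (2 * La) + 1).
have den0 : 0 < C * (2 * La) + 1 by rewrite ltr_wpDl // mulr_ge0 // mulr_ge0.
have d10 : 0 < d1 by rewrite divr_gt0.
have H1 : \forall e \near 0^'+, forall k l, k != l ->
    `|fl e k l - P0 k l * out e k| <= d1 * out e k.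
  apply: filter_forall => i; apply: filter_forall => j.
  have [->|ij] := eqVneq i j; first by near=> e.
  by near=> e => _; near: e; exact: flux_lim.
near=> e; have e0 : 0 < e by near: e; exact: nbhs_right_gt.
have H2 : \sum_(l | c l == K) \sum_(k | c k != K) fl e k l <= d1 * mE e.
  by near: e; exact: class_inflow.
have o0 i : 0 < out e i by move: i; near: e; apply: filter_forall; exact: out_gt0.
have H1e : forall k l, k != l -> `|fl e k l - P0 k l * out e k| <= d1 * out e k.
  near: e; exact: H1.
have m0 : 0 < mE e by near: e; exact: mE_gt0.
pose D i := out e i / lam i.
have lamD i : c i = K -> lam i * D i = out e i.
  by move=> ci; rewrite /D mulrCA divff ?mulr1 // gt_eqF // lam_gt0.
(* The outflux of [l] equals its inflow. The part from the class is [P0 k l * out e k] with errors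
   adding up to at most [d1 * mE e], the part from outside is at most another [d1 * mE e], and
   dividing by [lam l] costs at most [La]. *)
have HD l : c l = K ->
    D l <= \sum_(k | c k == K) lam k * P0 k l / lam l * D k + 2 * d1 * La * mE e.
  move=> cl; apply: le_trans (_ : (\sum_(k | c k == K) P0 k l * out e k + 2 * d1 * mE e)
                               / lam l <= _); last first.
    rewrite mulrDl lerD //.
      rewrite mulr_suml; apply: ler_sum => i /eqP ci.
      by rewrite -(lamD _ ci) le_eqVlt; apply/orP; left; apply/eqP; ring.
    rewrite mulrAC ler_wpM2r ?(ltW m0) // ler_wpM2l ?La_ge //.
    by rewrite mulr_ge0 // ltW.
  have outE : out e l = \sum_(k | k != l) fl e k l.
    exact: flux_in_out (Pst e0) (muP e0) l.
  rewrite ler_pM2r ?invr_gt0 ?lam_gt0 // outE.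
  rewrite (bigID [pred k | c k == K]) /=.
  have -> : 2 * d1 * mE e = d1 * mE e + d1 * mE e by ring.
  rewrite addrA lerD //; last first.
    apply: le_trans H2; rewrite [leRHS](bigD1 l) ?cl //=.
    rewrite [leLHS](eq_bigl [pred k | c k != K]); last first.
      by move=> i /=; case: (eqVneq i l) => [->|]; rewrite ?cl ?eqxx.
    rewrite lerDl; apply: sumr_ge0 => i _; apply: sumr_ge0 => j _.
    by apply: flux_ge0; [exact: Pst|exact: mu0].
  rewrite /mE mulr_sumr -big_split /= [leRHS](bigD1 l) ?cl //= -[leLHS]add0r.
  apply: lerD; first by rewrite addr_ge0 // mulr_ge0 ?lim_ge0 // ltW.
  rewrite (eq_bigl [pred i | (c i == K) && (i != l)]); last by move=> i /=; rewrite andbC.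
  apply: ler_sum => i /andP[_ il]; have := H1e _ _ il; rewrite ler_norml => /andP[_].
  by rewrite lerBlDl.
have {HC} osc i j : c i = K -> c j = K -> D i <= D j + d * mE e.
  move=> ci cj; have c0 : 0 <= 2 * d1 * La * mE e.
    by apply: mulr_ge0 (ltW m0); apply: mulr_ge0 La0; apply: mulr_ge0 (ltW d10).
  apply: le_trans (HC _ _ c0 HD _ _ ci cj) _.
  rewrite lerD2l; have -> : C * (2 * d1 * La * mE e) = (C * (2 * La) * d1) * mE e by ring.
  rewrite ler_pM2r // /d1 mulrA ler_pdivrMr // mulrC ler_pM2l // lerDl //.
(* The [lam]-mean of [D] over the class is [mE e], so small oscillation places every [D k] near
   [mE e]. *)
have mED : mE e = \sum_(l | c l == K) lam l * D l.
  by apply: eq_bigr => l /eqP cl; rewrite lamD.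
have mEc x : x = \sum_(l | c l == K) lam l * x by rewrite -mulr_suml lam1 mul1r.
have h1 : D k <= mE e + d * mE e.
  rewrite {1}(mEc (D k)) {1}mED (mEc (d * mE e)) -big_split /=.
  by apply: ler_sum => l /eqP cl; rewrite -mulrDr ler_wpM2l // osc.
have h2 : mE e <= D k + d * mE e.
  rewrite (mEc (D k)) {1}mED (mEc (d * mE e)) -big_split /=.
  by apply: ler_sum => l /eqP cl; rewrite -mulrDr ler_wpM2l // osc.
rewrite -(lamD _ ck) -mulrBr normrM (ger0_norm (lam0 k)) mulrCA ler_wpM2l //.
by rewrite ler_norml; apply/andP; split; lra.
Unshelve. all: by end_near. Qed.

End Ergodic.

Let mass K e := \sum_(k | c k == K) out e k.

Lemma mass_outflux K k : c k = K -> asymp (fun e => lam k * mass K e) (fun e => out e k).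
Proof.
move=> ck; have [[erg inv]|[a [aK _]]] := classes K; first exact: lam_outflux.
have ak : forall i, (c i == K) = (i == k).
  by have -> : k = a; [exact/aK|move=> i; apply/eqP/eqP => /aK].
have l1 : lam k = 1 by rewrite -(lam1 K) (eq_bigl _ _ ak) big_pred1_eq.
apply: asymp_near_eq (asymp_refl (F := out^~ k) _) _ _.
- by near=> e; rewrite ltW //; near: e; exact: out_gt0.
- by near=> e; rewrite /mass (eq_bigl _ _ ak) big_pred1_eq l1 mul1r.
- by near=> e.
Unshelve. all: by end_near. Qed.

Lemma mass_gt0 K : pos_near (mass K).
Proof. exact: mE_gt0. Qed.

Lemma weighted_flux k l : k != l ->
  asymp (fun e => lam k * PN e k l * mass (c k) e) (fun e => fl e k l).
Proof.
move=> kl; apply: asymp_trans (ratio.1 _ _ kl).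
have PN_ge0 : ge0_near (fun e => PN e k l).
  near=> e; have : 0 <= PN e k l * out e k.
    by near: e; have [] := asymp_ge0 (ratio.1 _ _ kl).
  by rewrite pmulr_lge0 //; near: e; exact: out_gt0.
apply: asymp_near_eq (asymp_mul (asymp_refl PN_ge0) (mass_outflux (erefl (c k)))) _ _.
  by near=> e; rewrite mulrCA mulrA.
by near=> e.
Unshelve. all: by end_near. Qed.

(** Multiplying the numerator and the denominator of the quotient defining [PN'] by [mass K] turns
    them, asymptotically, into the flux and the outflux of the coarser partition. *)
Lemma flux_ratio_step : flux_ratio (c \o p) PN'.
Proof.
split; last by move=> e e0 K; rewrite PN'E eqxx.
move=> K L KL.
have num : asymp (fun e => (\sum_(k | c k == K) \sum_(l | c l == L) lam k * PN e k l) * mass K e)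
    (fun e => flux (P e) (mu e) (c \o p) K L).
  apply: asymp_near_eq (asymp_sum (A := [pred k | c k == K]) (F := fun k e =>
     \sum_(l | c l == L) lam k * PN e k l * mass (c k) e) (G := fun k e =>
     \sum_(l | c l == L) fl e k l) _) _ _.
  - move=> k /= /eqP ck; apply: asymp_sum => l /eqP cl; apply: weighted_flux.
    by apply: contra_neq KL => kl; rewrite -ck -cl kl.
  - near=> e; rewrite mulr_suml; apply: eq_bigr => k /eqP ck.
    by rewrite mulr_suml ck.
  - by near=> e; rewrite flux_comp.
have den : asymp (fun e => (\sum_(k | c k == K) \sum_(l | c l != K) lam k * PN e k l) * mass K e)
    (fun e => outflux (P e) (mu e) (c \o p) K).
  apply: asymp_near_eq (asymp_sum (A := [pred k | c k == K]) (F := fun k e =>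
     \sum_(l | c l != K) lam k * PN e k l * mass (c k) e) (G := fun k e =>
     \sum_(l | c l != K) fl e k l) _) _ _.
  - move=> k /= /eqP ck; apply: asymp_sum => l cl; apply: weighted_flux.
    by apply: contra_neq cl => <-.
  - near=> e; rewrite mulr_suml; apply: eq_bigr => k /eqP ck.
    by rewrite mulr_suml ck.
  - near=> e; rewrite /outflux; under [RHS]eq_bigr do rewrite flux_comp.
    by rewrite [RHS]exchange_big /=; apply: eq_bigr => k _; rewrite sum_classes.
have out'0 : pos_near (fun e => outflux (P e) (mu e) (c \o p) K).
  near=> e; apply: outflux_gt0 => //; [exact: Pst|exact: Pirr|exact: mu0|].
  exact: blocks_compat_surj.
have out'r : ge0_near (fun e => outflux (P e) (mu e) (c \o p) K).
  by near=> e; apply: ltW; near: e.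
apply: asymp_near_eq (asymp_mul (asymp_mul num (asymp_inv out'0 den)) (asymp_refl out'r)) _ _.
  near=> e; congr (_ * _); rewrite PN'E (negPf KL) invfM mulrACA divff ?mulr1 //.
  by rewrite gt_eqF //; near: e; exact: mass_gt0.
near=> e; rewrite mulfVK // gt_eqF //; near: e; exact: out'0.
Unshelve. all: by end_near. Qed.

(* With [f] the probability to reach [a] inside the class and [D k] the largest defect [1 - f] over
   the block [k], [D] is almost subharmonic for the limit chain and small at the block of [a]. *)
Lemma recurrent_blocks_step : recurrent_blocks (c \o p).
Proof.
move=> i a /= cia ia d d0.
(* A transient cluster is a class of its own; its block does not change, and the claim is the
   hypothesis at the lower rank. *)
have [[erg inv]|[k0 [k0K _]]] := classes (c (p a)); last first.
  have pia : p i = p a by have /k0K -> := cia; symmetry; exact/k0K.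
  have -> : block_minus (c \o p) a = block_minus p a; last exact: rec.
  apply: eq_enum => j; rewrite !inE /=; congr (_ && _).
  by apply/eqP/eqP => [/k0K ->|-> //]; symmetry; exact/k0K.
set K := c (p a) in erg inv cia.
have n0 : (0 : R) < n%:R by rewrite ltr0n (ltn_trans _ n1).
have [|||C [C0 HC]] := @subharmonic_osc R n [pred k | c k == K] P0.
- by move=> *; exact: lim_ge0.
- by move=> k /eqP; exact: class_lim_sum.
- by move=> k l /eqP ck /eqP cl; exact: class_connect.
(* Fitted to the final bound: [d1] for the block of [a] and [C] times [n * d1] for the defect of
   subharmonicity, together at most [(1 + C) * (n + 1) * d1 = d]. *)
pose d1 := d / ((1 + C) * (n%:R + 1)).
have den0 : 0 < (1 + C) * (n%:R + 1) by apply: mulr_gt0; lra.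
have d10 : 0 < d1 by rewrite divr_gt0.
have R1 : \forall e \near 0^'+, forall j, p j = p a -> j != a ->
    1 - d1 <= exitp (P e) (block_minus p a) (pred1 a) j.
  apply: filter_forall => j; have [pj|pj] := eqVneq (p j) (p a); last first.
    by near=> e => pj'; rewrite pj' eqxx in pj.
  have [ja|ja] := eqVneq j a; first by near=> e.
  by near=> e => _ _; near: e; exact: rec.
have R2 : \forall e \near 0^'+, forall j l, p j != l ->
    P0 (p j) l - d1 <= exitp (P e) (block p (p j)) [pred x | p x == l] j.
  apply: filter_forall => j; apply: filter_forall => l.
  have [jl|jl] := eqVneq (p j) l; first by near=> e.
  have h := exitp_flux jl (erefl (p j)).
  have d12 : 0 < Num.min (d1 / 2) (1/2) by rewrite lt_min !divr_gt0.
  near=> e => _.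
  have o0 : 0 < out e (p j) by near: e; exact: out_gt0.
  have h1 : `|exitp (P e) (block p (p j)) [pred x | p x == l] j * out e (p j) - fl e (p j) l|
       <= Num.min (d1 / 2) (1/2) * fl e (p j) l by near: e; exact: h.
  have h2 : `|fl e (p j) l - P0 (p j) l * out e (p j)| <= d1/2 * out e (p j).
    by near: e; apply: flux_lim => //; rewrite divr_gt0.
  have h3 : fl e (p j) l <= out e (p j) by near: e; exact: fl_le_out.
  have h4 : 0 <= fl e (p j) l by near: e; exact: fl_ge0.
  have h5 : Num.min (d1 / 2) (1/2) * fl e (p j) l <= d1/2 * fl e (p j) l.
    by rewrite ler_wpM2r // ge_min lexx.
  rewrite -(ler_pM2r o0); move: h1 h2; rewrite !ler_norml => /andP[? _] /andP[? _].
  nra.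
near=> e; have e0 : 0 < e by near: e; exact: nbhs_right_gt.
have R1e : forall j, p j = p a -> j != a ->
    1 - d1 <= exitp (P e) (block_minus p a) (pred1 a) j by near: e.
have R2e : forall j l, p j != l ->
    P0 (p j) l - d1 <= exitp (P e) (block p (p j)) [pred x | p x == l] j by near: e.
have Pse := Pst e0; have Pie := Pirr e0.
set s := block_minus (c \o p) a.
have ps : proper_seq s by exact: block_minus_proper.
(* With the value 1 at [a], a direct jump to [a] is a term of the sum over the class, and [f]
   satisfies one equation at all other states. *)
pose f j := if j == a then 1 else exitp (P e) s (pred1 a) j.
have f0 j : 0 <= f j by rewrite /f; case: ifP => // _; exact: exitp_ge0.
have f1 j : f j <= 1.
  rewrite /f; case: ifP => // _; apply: exitp_le1 => // b.
  by rewrite !inE => /eqP ->; rewrite mem_block_minus !eqxx.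
pose D k := \big[Num.max/0]_(j | p j == k) (1 - f j).
have D0 k : 0 <= D k by exact: bigmax_ge_id.
have D1 k : D k <= 1 by apply: bigmax_le => // j _; rewrite lerBlDr lerDl.
have Df j : 1 - D (p j) <= f j.
  by rewrite lerBlDl -lerBlDr /D (bigD1 j) //= le_max lexx.
have fsup j : j != a -> \sum_(b | c (p b) == K) P e j b * f b <= f j.
  move=> ja; rewrite {2}/f (negPf ja) (exitp_harmonic Pse Pie _ _ ps) big_pred1_eq.
  rewrite (bigD1 a) //= {1}/f eqxx mulr1 lerD2l big_uniq //=; last exact: ps.1.
  rewrite le_eqVlt; apply/orP; left; apply/eqP; apply: eq_big => b.
    by rewrite mem_block_minus.
  by move=> /andP[_ ba]; rewrite /f (negPf ba).
have Da : D (p a) <= d1.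
  apply: bigmax_le => [|j /eqP pj]; first exact: ltW.
  rewrite /f; case: eqVneq => [_|ja]; first by rewrite subrr ltW.
  rewrite lerBlDr addrC -lerBlDr; apply: le_trans (R1e j pj ja) _.
  apply: exitp_mono => //; first exact: enum_uniq.
    by move=> b; rewrite !mem_block_minus /= => /andP[/eqP -> ->]; rewrite eqxx.
  by rewrite mem_block_minus pj eqxx.
have HD k : c k == K -> D k <= \sum_(l | c l == K) P0 k l * D l + n%:R * d1.
  move=> /eqP ck.
  have S0 : 0 <= \sum_(l | c l == K) P0 k l * D l.
    by apply: sumr_ge0 => l _; rewrite mulr_ge0 ?lim_ge0.
  have nd : d1 <= n%:R * d1 by rewrite ler_peMl ?(ltW d10) // ler1n (ltn_trans _ n1).
  (* In the block of [a] the inequality for [f] fails at [a] itself, but there [D] is already at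
     most [d1]. *)
  have [ka|ka] := eqVneq k (p a).
    by rewrite {1}ka (le_trans Da) // (le_trans nd) // lerDr.
  apply: bigmax_le => [|j /eqP pj]; first by rewrite addr_ge0 // mulr_ge0 ?ltW.
  have := @superharmonic_through R m (P e) Pse Pie n p [pred k | c k == K] k f
    (fun l => 1 - D l) (block_proper psurj n1 k) _ _ _ j pj.
  rewrite /= ck eqxx => /(_ isT) H.
  rewrite lerBlDr addrC -lerBlDr; apply: le_trans (H _ _); last 2 first.
  - move=> b pb; apply: fsup; apply: contra_neq ka => ba; by rewrite -pb ba.
  - by move=> b _ _; exact: Df.
  apply: le_trans (_ : \sum_(l | (c l == K) && (l != k)) (P0 k l - d1) * (1 - D l) <= _).
    have -> : \sum_(l | (c l == K) && (l != k)) (P0 k l - d1) * (1 - D l) =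
      \sum_(l | (c l == K) && (l != k)) P0 k l - \sum_(l | (c l == K) && (l != k)) P0 k l * D l
      - \sum_(l | (c l == K) && (l != k)) d1 * (1 - D l).
      by rewrite -!sumrB; apply: eq_bigr => l _; ring.
    have -> : \sum_(l | (c l == K) && (l != k)) P0 k l = 1.
      by rewrite -(class_lim_sum erg ck) [RHS](bigD1 k) ?ck //= lim_diag add0r.
    rewrite [X in 1 - (X + _) <= _](bigD1 k) ?ck //= lim_diag mul0r add0r opprD addrA.
    rewrite lerD2l lerN2 -mulr_sumr mulrC ler_wpM2r ?(ltW d10) //.
    apply: le_trans (_ : \sum_(l | (c l == K) && (l != k)) 1 <= _).
      by apply: ler_sum => l _; rewrite lerBlDr lerDl.
    by rewrite sumr_const ler_nat -[X in (_ <= X)%N](card_ord n) max_card.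
  apply: ler_sum => l /andP[_ lk]; rewrite ler_wpM2r ?subr_ge0 //.
  by have := R2e j l; rewrite pj eq_sym; exact.
have := HC (n%:R * d1) D _ HD (p i) (p a); rewrite /= cia eqxx => /(_ _ isT isT) H.
have Hi : 1 - D (p i) <= f i by exact: Df.
rewrite /f (negPf ia) in Hi; apply: le_trans Hi.
rewrite lerD2l lerN2; apply: le_trans (H _) _; first by rewrite mulr_ge0 // ltW.
apply: le_trans (_ : (1 + C) * (n%:R + 1) * d1 <= _).
  have : 0 <= C * d1 by rewrite mulr_ge0 // ltW.
  have : 0 <= n%:R * d1 by rewrite mulr_ge0 // ltW.
  lra.
by rewrite /d1 mulrC divfK // gt_eqF.
Unshelve. all: by end_near. Qed.

End HierStep.

Section Hierarchy.
Context {R : realType} (Mr : nat -> nat) (Rtop : nat).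
Variables (Pr : forall r, R -> 'I_(Mr r) -> 'I_(Mr r) -> R)
  (pi : forall r, 'I_(Mr 0%N) -> 'I_(Mr r)).
Arguments pi : clear implicits.
Arguments Pr : clear implicits.
Hypothesis hier : hierarchy Rtop Pr pi.

Lemma cluster_surj r : (r <= Rtop)%N -> forall k, exists i, pi r i = k.
Proof.
case: hier => _ _ pi0 step; elim: r => [_ k|r IH rR K]; first by exists k; rewrite pi0.
have [c [[P0 [lam [_ csurj _ _ _]]] piE]] := step _ rR.
by have [k <-] := csurj K; have [i <-] := IH (ltnW rR) k; exists i.
Qed.

(** A nonzero quotient has a nonzero term in its numerator, rank after rank. The resulting single
    jump from cluster [k] to cluster [l] makes the exit probability into [l] positive. *)
Lemma rank_edge r e k l : (r <= Rtop)%N -> Pr r e k l != 0 ->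
  exists i j, [/\ pi r i = k, pi r j = l & Pr 0%N e i j != 0].
Proof.
case: hier => _ _ pi0 step; elim: r k l => [k l _ H|r IH K L rR].
  by exists k, l; rewrite !pi0.
have [c [[P0 [lam [_ _ _ _ ->]]] piE]] := step _ rR.
have [_|KL] := ifPn; first by rewrite eqxx.
move=> H; have {H} : exists k l, [/\ c k = K, c l = L & Pr r e k l != 0].
  apply: contrapT => N; move: H; rewrite big1 ?mul0r ?eqxx // => k /eqP ck.
  rewrite big1 // => l /eqP cl; have [->|P1] := eqVneq (Pr r e k l) 0; first by rewrite mulr0.
  by case: N; exists k, l.
move=> [k [l [<- <-]]] /(IH _ _ (ltnW rR))[i [j [<- <- Pij]]].
by exists i, j; rewrite !piE.
Qed.

Variable mu : R -> 'I_(Mr 0%N) -> R.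
Hypotheses (Pst : forall e : R, 0 < e -> stochastic (Pr 0%N e))
  (Pirr : forall e : R, 0 < e -> irreducible_chain (Pr 0%N e))
  (Pdiag : forall (e : R) i, 0 < e -> Pr 0%N e i i = 0)
  (mu0 : forall e : R, 0 < e -> forall i, 0 < mu e i)
  (muP : forall e : R, 0 < e -> forall j, \sum_i mu e i * Pr 0%N e i j = mu e j).

(** At rank 0 the blocks are single states: recurrence is vacuous, and as the diagonal is zero,
    [outflux k] is just [mu e k]. The inductive step for the ratios uses that the next rank still
    has more than one cluster, hence [r < Rtop]. *)
Lemma clusters_recurrent_ratio r : (r < Rtop)%N ->
  recurrent_blocks (Pr 0%N) (pi r) /\ flux_ratio (Pr 0%N) mu (pi r) (Pr r).
Proof.
have [_ M1 pi0 step] := hier.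
elim: r => [_|r IH rR].
  split=> [i a|]; first by rewrite !pi0 => -> /eqP.
  split=> [k l kl|e e0 k]; last by rewrite Pdiag.
  have fluxE e a b : flux (Pr 0%N e) (mu e) (pi 0%N) a b = mu e a * Pr 0%N e a b.
    rewrite /flux (eq_bigl (pred1 a)) => [|i]; last by rewrite /= pi0.
    by rewrite big_pred1_eq (eq_bigl (pred1 b)) => [|i]; rewrite ?big_pred1_eq //= pi0.
  apply: asymp_near_eq (asymp_refl (F := fun e => mu e k * Pr 0%N e k l) _) _ _.
  - by near=> e; rewrite mulr_ge0 ?(Pst _).1 // ltW // mu0.
  - near=> e; rewrite mulrC; congr (_ * _).
    rewrite /outflux; under eq_bigr do rewrite fluxE.
    rewrite -mulr_sumr -[LHS]mulr1 -(_ : \sum_(j | j != k) Pr 0%N e k j = 1) //.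
    by rewrite -((Pst (e:=e) _).2 k) // [RHS](bigD1 k) //= Pdiag // add0r.
  - by near=> e; rewrite fluxE.
have rR' := ltnW rR; have [rec ratio] := IH rR'.
have [c [[P0 [lam [PN0 csurj cls [lam0 lam1] PE]]] piE]] := step _ rR'.
have -> : pi r.+1 = c \o pi r by apply/funext => i; rewrite /= piE.
have psurj := cluster_surj (ltnW rR').
split.
  exact: (@recurrent_blocks_step R _ _ _ _ mu _ _ Pst Pirr mu0 muP psurj (M1 _ rR') rec
    P0 PN0 ratio c lam cls).
exact: (@flux_ratio_step R _ _ _ _ mu _ _ Pst Pirr mu0 muP psurj (M1 _ rR')
    P0 PN0 ratio c _ lam csurj (M1 _ rR) cls lam0 lam1 PE).
Unshelve. all: by end_near. Qed.

End Hierarchy.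

(** * Exit kernels and mean occupation *)

Section Green.
Context {R : realType} {dS : measure_display} {S : measurableType dS} {M : nat}.
Variables (cls : S -> 'I_M) (Q : R.-pker S ~> (S * R)%type).
Hypothesis cls_meas : forall i, measurable (Si cls i).
Local Open Scope ereal_scope.

Definition lands (B : {pred 'I_M}) : set (S * R) := [set z | cls z.1 \in B].

Definition step_in (B : {pred 'I_M}) (f : S -> \bar R) (x : S) : \bar R :=
  \int[Q x]_(z in lands B) f z.1.

Fixpoint visit_cost (B : {pred 'I_M}) (c : S -> \bar R) (n : nat) : S -> \bar R :=
  if n is n'.+1 then step_in B (visit_cost B c n') else c.

(* The mean total of [c] over the visits, time 0 included, made before leaving [B]. *)
Definition green (B : {pred 'I_M}) (c : S -> \bar R) (x : S) : \bar R :=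
  \sum_(n <oo) visit_cost B c n x.

(** Exits at different steps are disjoint, so their one-step probabilities add up. The starting
    point may lie outside [B], as happens for returns to an eliminated class. *)
Definition Kexit (B L : {pred 'I_M}) := green B (fun y => Q y (lands L)).

Lemma measurable_cls (B : {pred 'I_M}) : measurable [set x | cls x \in B].
Proof.
rewrite (_ : [set x | _] = \bigcup_(i in [set i | i \in B]) Si cls i).
  by apply: fin_bigcup_measurable => // i _; exact: cls_meas.
by apply/seteqP; split => [x xB|x [i iB xi]]; [exists (cls x)|rewrite /= xi].
Qed.

Lemma measurable_lands B : measurable (lands B).
Proof.
have := @measurable_fst _ _ S R measurableT _ (measurable_cls B).
by rewrite setTI.
Qed.
Hint Resolve measurable_lands : core.

Lemma measurable_fst_comp D (f : S -> \bar R) : measurable_fun setT f ->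
  measurable_fun D (fun z : S * R => f z.1).
Proof.
move=> mf; apply: (@measurable_funTS _ _ _ _ D (fun z : S * R => f z.1)).
by apply: (measurableT_comp mf); exact: measurable_fst.
Qed.

Lemma measurable_kernel_integral (f : S * R -> \bar R) D : measurable D ->
  (forall z, 0 <= f z) -> measurable_fun setT f ->
  measurable_fun setT (fun x => \int[Q x]_(z in D) f z).
Proof.
move=> mD f0 mf; under eq_fun do rewrite integral_mkcond.
apply: measurable_fun_integral_kernel.
- by move=> U mU; exact: measurable_kernel.
- by move=> z; apply: erestrict_ge0.
- by apply/(measurable_restrictT _ _).1 => //; exact: measurable_funTS.
Qed.

Lemma step_in_ge0 B f x : (forall y, 0 <= f y) -> 0 <= step_in B f x.
Proof. by move=> f0; exact: integral_ge0. Qed.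

Lemma measurable_step_in B f : (forall y, 0 <= f y) -> measurable_fun setT f ->
  measurable_fun setT (step_in B f).
Proof.
move=> f0 mf; apply: (measurable_kernel_integral (f := fun z => f z.1)) => //.
exact: measurable_fst_comp.
Qed.

Lemma le_step_in (B B' : {pred 'I_M}) f g x : {subset B <= B'} ->
  (forall y, 0 <= f y) -> (forall y, 0 <= g y) ->
  measurable_fun setT f -> measurable_fun setT g ->
  (forall y, cls y \in B -> f y <= g y) -> step_in B f x <= step_in B' g x.
Proof.
move=> BB' f0 g0 mf mg fg; rewrite /step_in.
apply: le_trans (_ : \int[Q x]_(z in lands B) g z.1 <= _).
  by apply: ge0_le_integral => // *; [exact: measurable_fst_comp|exact: measurable_fst_comp|exact: fg].
by apply: ge0_subset_integral => //; [exact: measurable_fst_comp|move=> z; exact: BB'].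
Qed.

Lemma step_inD B f g x : (forall y, 0 <= f y) -> (forall y, 0 <= g y) ->
  measurable_fun setT f -> measurable_fun setT g ->
  step_in B (fun y => f y + g y) x = step_in B f x + step_in B g x.
Proof. by move=> *; apply: ge0_integralD => //; exact: measurable_fst_comp. Qed.

Lemma step_inZ B k f x : (0 <= k)%R -> (forall y, 0 <= f y) -> measurable_fun setT f ->
  step_in B (fun y => k%:E * f y) x = k%:E * step_in B f x.
Proof. by move=> *; apply: ge0_integralZl_EFin => //; exact: measurable_fst_comp. Qed.

Lemma step_in_cst B k x : (0 <= k)%R -> step_in B (cst k%:E) x = k%:E * Q x (lands B).
Proof. by move=> k0; rewrite /step_in integral_cst. Qed.

Lemma step_inU (B B1 B2 : {pred 'I_M}) f x : (forall y, 0 <= f y) ->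
  measurable_fun setT f ->
  (forall j, j \in B = (j \in B1) || (j \in B2)) ->
  (forall j, j \in B1 -> j \notin B2) ->
  step_in B f x = step_in B1 f x + step_in B2 f x.
Proof.
move=> f0 mf BE Bd; rewrite /step_in -ge0_integral_setU //.
- by congr (integral _ _ _); apply/seteqP; split => z; rewrite /lands /= BE => /orP.
- exact: measurable_fst_comp.
- rewrite disj_set2E; apply/eqP/seteqP; split => // z [/= /Bd zB2 zB].
  by rewrite zB in zB2.
Qed.

Section Cost.
Variables (B : {pred 'I_M}) (c : S -> \bar R).
Hypotheses (c0 : forall y, 0 <= c y) (mc : measurable_fun setT c).

Lemma visit_cost_ge0 n x : 0 <= visit_cost B c n x.
Proof. by elim: n x => //= n IH x; exact: step_in_ge0. Qed.
Hint Resolve visit_cost_ge0 : core.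

Lemma measurable_visit_cost n : measurable_fun setT (visit_cost B c n).
Proof. by elim: n => //= n IH; exact: measurable_step_in. Qed.
Hint Resolve measurable_visit_cost : core.

Lemma green_ge0 x : 0 <= green B c x.
Proof. exact: nneseries_ge0. Qed.

Lemma measurable_green : measurable_fun setT (green B c).
Proof. by apply: ge0_emeasurable_sum. Qed.

Lemma green_eq x : green B c x = c x + step_in B (green B c) x.
Proof.
rewrite /green nneseries_recl // /step_in integral_nneseries //; first last.
  by move=> n; exact: measurable_fst_comp.
by congr (_ + _); rewrite -nneseries_addn //; apply: eq_eseriesr => i _; rewrite addn1.
Qed.

Lemma green_sumS n x : \sum_(0 <= k < n.+1) visit_cost B c k x
  = c x + step_in B (fun y => \sum_(0 <= k < n) visit_cost B c k y) x.
Proof.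
rewrite big_nat_recl //=; congr (_ + _).
by rewrite /step_in ge0_integral_sum // => k; exact: measurable_fst_comp.
Qed.

(** By induction every partial sum of the series lies below a supersolution. Partial sums are used
    because finiteness of the limit is not known in advance; upper bounds on kernel quantities come
    from exhibiting a suitable [f]. *)
Lemma green_min (A : {pred 'I_M}) (f : S -> \bar R) : {subset B <= A} ->
  (forall y, 0 <= f y) -> measurable_fun setT f ->
  (forall x, cls x \in A -> c x + step_in B f x <= f x) ->
  forall x, cls x \in A -> green B c x <= f x.
Proof.
move=> BA f0 mf sup x xA; apply: lime_le; first exact: is_cvg_nneseries.
apply: nearW => n; elim: n x xA => [|n IH] x xA; first by rewrite big_geq.
rewrite green_sumS; apply: le_trans (sup x xA); rewrite leeD2l //.
apply: le_step_in => // [y||y /BA /IH //]; first exact: sume_ge0.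
exact: emeasurable_sum.
Qed.

End Cost.

Lemma greenD B c1 c2 x : (forall y, 0 <= c1 y) -> (forall y, 0 <= c2 y) ->
  measurable_fun setT c1 -> measurable_fun setT c2 ->
  green B (fun y => c1 y + c2 y) x = green B c1 x + green B c2 x.
Proof.
move=> c10 c20 mc1 mc2; rewrite /green -nneseriesD; last 2 first.
- by move=> *; exact: visit_cost_ge0.
- by move=> *; exact: visit_cost_ge0.
apply: eq_eseriesr => n _; elim: n x => //= n IH x.
rewrite -step_inD //; last 4 first.
- by move=> *; exact: visit_cost_ge0.
- by move=> *; exact: visit_cost_ge0.
- exact: measurable_visit_cost.
- exact: measurable_visit_cost.
by apply: eq_integral => z _; rewrite IH.
Qed.

Lemma greenZ B k c x : (0 <= k)%R -> (forall y, 0 <= c y) -> measurable_fun setT c ->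
  green B (fun y => k%:E * c y) x = k%:E * green B c x.
Proof.
move=> k0 c0 mc; rewrite /green -nneseriesZl; last by move=> *; exact: visit_cost_ge0.
apply: eq_eseriesr => n _; elim: n x => //= n IH x.
rewrite -step_inZ //; last 2 first.
- by move=> *; exact: visit_cost_ge0.
- exact: measurable_visit_cost.
by apply: eq_integral => z _; rewrite IH.
Qed.

Lemma measurable_cost L : measurable_fun setT (fun y => Q y (lands L)).
Proof. exact: measurable_kernel. Qed.

End Green.

(* Replaces a strong Markov argument: the renewal inequality at the state being eliminated is
   applied to the infimum of [g] itself. *)
Lemma inf_bootstrap {R : realType} {T : Type} (D : set T) (g : T -> R) (a b : R) :
  0 < b -> (forall y, D y -> 0 <= g y) ->
  (forall m, 0 <= m -> (forall y, D y -> m <= g y) ->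
    forall y, D y -> a + (1 - b) * m <= g y) ->
  forall y, D y -> a / b <= g y.
Proof.
move=> b0 g0 H y Dy; pose m := inf [set g z | z in D].
have lb z : D z -> m <= g z.
  by move=> Dz; apply: ge_inf; [exists 0 => _ [x Dx <-]; exact: g0|exists z].
have ne : [set g z | z in D] !=set0 by exists (g y), y.
have m0 : 0 <= m by apply: lb_le_inf => // _ [z Dz <-]; exact: g0.
have : a + (1 - b) * m <= m by apply: lb_le_inf => // _ [z Dz <-]; exact: H.
move=> h; rewrite (le_trans _ (lb y Dy)) // ler_pdivrMr //; lra.
Qed.

(** * Eliminating one class of points from the kernel *)

Section Elimination.
Context {R : realType} {dS : measure_display} {S : measurableType dS} {M : nat}.
Variables (cls : S -> 'I_M) (Q : R.-pker S ~> (S * R)%type).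
Hypothesis cls_meas : forall i, measurable (Si cls i).

Local Notation lands := (@lands R dS S M cls).
Local Notation Kexit := (Kexit cls Q).

Definition kexit (B L : {pred 'I_M}) x := fine (Kexit B L x).

Let ml L : measurable (lands L). Proof. exact: measurable_lands. Qed.
Hint Resolve ml : core.
Let Q0 L y : (0 <= Q y (lands L))%E. Proof. by []. Qed.
Let mQ L : measurable_fun setT (fun y => Q y (lands L)). Proof. exact: measurable_cost. Qed.
Hint Resolve mQ : core.

Lemma prob_lands_le1 L x : (Q x (lands L) <= 1)%E.
Proof. by rewrite -(@prob_kernel _ _ _ _ _ Q x); apply: le_measure; rewrite ?inE. Qed.

Lemma landsU (L L1 L2 : {pred 'I_M}) x :
  (forall j, (j \in L) = (j \in L1) || (j \in L2)) ->
  (forall j, j \in L1 -> j \notin L2) ->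
  Q x (lands L) = (Q x (lands L1) + Q x (lands L2))%E.
Proof.
move=> LE Ld; rewrite -measureU //.
  by congr (Q x _); apply/seteqP; split => z; rewrite /lands /= LE => /orP.
by apply/seteqP; split => // z [/= /Ld /negP].
Qed.

Lemma Kexit_ge0 B L x : (0 <= Kexit B L x)%E.
Proof. exact: green_ge0. Qed.

(** The constant 1 is a supersolution, as [L] and [B] are disjoint. *)
Lemma Kexit_le1 (B L : {pred 'I_M}) x : (forall j, j \in L -> j \notin B) -> (Kexit B L x <= 1)%E.
Proof.
move=> LB; apply: (green_min cls_meas _ _ (A := predT) (f := cst 1%E)) => // y _.
rewrite step_in_cst // mul1e -(@landsU [predU L & B] L B) //; exact: prob_lands_le1.
Qed.

Lemma KexitE (B L : {pred 'I_M}) x : (forall j, j \in L -> j \notin B) ->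
  Kexit B L x = (kexit B L x)%:E.
Proof.
move=> LB; rewrite /kexit fineK // ge0_fin_numE ?Kexit_ge0 //.
by apply: le_lt_trans (Kexit_le1 x LB) _; rewrite ltry.
Qed.

Lemma kexit_ge0 B L x : 0 <= kexit B L x.
Proof. by rewrite fine_ge0 // Kexit_ge0. Qed.

Lemma kexit_le1 (B L : {pred 'I_M}) x : (forall j, j \in L -> j \notin B) -> kexit B L x <= 1.
Proof. by move=> LB; rewrite -lee_fin -KexitE // Kexit_le1. Qed.

Lemma kexitU (B L L1 L2 : {pred 'I_M}) x :
  (forall j, j \in L -> j \notin B) ->
  (forall j, (j \in L) = (j \in L1) || (j \in L2)) ->
  (forall j, j \in L1 -> j \notin L2) ->
  kexit B L x = kexit B L1 x + kexit B L2 x.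
Proof.
move=> LB LE Ld; apply: EFin_inj; rewrite EFinD -!KexitE //; last 2 first.
- by move=> j j2; apply: LB; rewrite LE j2 orbT.
- by move=> j j2; apply: LB; rewrite LE j2.
rewrite /Kexit -greenD //; congr (green _ _ _ _ _).
by apply/funext => y; exact: landsU.
Qed.

Lemma kexit_ext (B B' L L' : {pred 'I_M}) x : B =i B' -> L =i L' -> kexit B L x = kexit B' L' x.
Proof.
move=> BB LL; rewrite /kexit /Kexit /green; congr fine; apply: eq_eseriesr => n _.
have lE A A' : A =i A' -> lands A = lands A'.
  by move=> AA; apply/seteqP; split => z; rewrite /lands /= AA.
elim: n x => [|n IH] x /=; first by rewrite (lE L L').
by rewrite /step_in (lE B B') //; apply: eq_integral => z _; rewrite IH.
Qed.

Variables (B B' : {pred 'I_M}) (a : 'I_M).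
Hypotheses (aB : a \notin B) (B'E : forall j, (j \in B') = (j == a) || (j \in B)).

(** The right-hand side stops the chain at class [a] and grants it the value [rho] there. The
    hypothesis says that [rho] is enough to continue from class [a], which makes the right-hand side
    a supersolution for [B']. *)
Lemma elimination_upper (L : {pred 'I_M}) (rho : R) : 0 <= rho ->
  (forall j, j \in L -> j \notin B') ->
  (forall y, cls y = a -> kexit B L y + rho * kexit B (pred1 a) y <= rho) ->
  forall x, kexit B' L x <= kexit B L x + rho * kexit B (pred1 a) x.
Proof.
move=> r0 LB' H x.
have LB j : j \in L -> j \notin B by move=> /LB'; rewrite B'E negb_or => /andP[].
have aB1 j : j \in pred1 a -> j \notin B by rewrite inE => /eqP ->.
rewrite -lee_fin EFinD EFinM -!KexitE //.
pose f y := (Kexit B L y + rho%:E * Kexit B (pred1 a) y)%E.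
have f0 y : (0 <= f y)%E by rewrite adde_ge0 ?mule_ge0 ?Kexit_ge0.
have mK A : measurable_fun setT (Kexit B A) by exact: measurable_green.
have mf : measurable_fun setT f by apply: emeasurable_funD => //; exact: measurable_funeM.
rewrite -/(f x); apply: (green_min cls_meas _ _ (A := predT)) => // y _.
rewrite (@step_inU _ _ _ _ _ _ cls_meas B' B (pred1 a)) //; last 2 first.
- by move=> j; rewrite B'E orbC.
- by move=> j jB; rewrite inE; apply: contraNneq aB => <-.
have -> : f y = (Q y (lands L) + step_in cls Q B (Kexit B L) y
    + rho%:E * (Q y (lands (pred1 a)) + step_in cls Q B (Kexit B (pred1 a)) y))%E.
  by rewrite /f /Kexit -!green_eq.
have -> : step_in cls Q B f y = (step_in cls Q B (Kexit B L) y
    + rho%:E * step_in cls Q B (Kexit B (pred1 a)) y)%E.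
  rewrite -step_inZ //; last by move=> z; exact: Kexit_ge0.
  rewrite -step_inD // => [z|z|]; first exact: Kexit_ge0.
    by rewrite mule_ge0 ?Kexit_ge0.
  exact: measurable_funeM.
have : (step_in cls Q (pred1 a) f y <= rho%:E * Q y (lands (pred1 a)))%E.
  rewrite -step_in_cst //; apply: le_step_in => // z; rewrite inE => /eqP za.
  by rewrite /f !KexitE // -EFinM -EFinD lee_fin H.
have : (0 <= step_in cls Q B (Kexit B (pred1 a)) y)%E.
  by apply: step_in_ge0 => z; exact: Kexit_ge0.
move: (step_in cls Q B (Kexit B (pred1 a)) y) => u u0.
move: (step_in cls Q (pred1 a) f y) (step_in cls Q B (Kexit B L) y) => w v wQ.
rewrite [X in (_ <= _ + X)%E]ge0_muleDr // -!addeA leeD2l // leeD2l //.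
by rewrite addeC leeD2r.
Qed.

(** Cutting at the first hit of class [a] leaves at least [m] to come. Here the supersolution is the
    exit probability from [B'], for the cost of jumping into [L] or, with weight [m], into class
    [a]. *)
Lemma elimination_lower (L : {pred 'I_M}) (m : R) : 0 <= m ->
  (forall j, j \in L -> j \notin B') ->
  (forall y, cls y = a -> m <= kexit B' L y) ->
  forall x, kexit B L x + m * kexit B (pred1 a) x <= kexit B' L x.
Proof.
move=> m0 LB' H x.
have LB j : j \in L -> j \notin B by move=> /LB'; rewrite B'E negb_or => /andP[].
have aB1 j : j \in pred1 a -> j \notin B by rewrite inE => /eqP ->.
rewrite -lee_fin EFinD EFinM -!KexitE //.
have mK A A' : measurable_fun setT (Kexit A A') by exact: measurable_green.
rewrite /Kexit -greenZ // -greenD //; last 2 first.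
- by move=> y; rewrite mule_ge0.
- exact: measurable_funeM.
apply: (green_min cls_meas _ _ (A := predT)) => // [y||y||y _].
- by rewrite adde_ge0 // mule_ge0.
- by apply: emeasurable_funD => //; exact: measurable_funeM.
- exact: Kexit_ge0.
- exact: mK.
rewrite [leRHS]green_eq // -/(Kexit B' L) -addeA leeD2l //.
rewrite (step_inU Q cls_meas y (Kexit_ge0 B' L) (mK B' L) B'E aB1).
have : (m%:E * Q y (lands (pred1 a)) <= step_in cls Q (pred1 a) (Kexit B' L) y)%E.
  rewrite -step_in_cst //; apply: le_step_in => // [z|z]; first exact: Kexit_ge0.
  by rewrite inE => /eqP za; rewrite KexitE // lee_fin H.
move: (step_in cls Q (pred1 a) (Kexit B' L) y) (step_in cls Q B (Kexit B' L) y) => v w.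
by move=> vQ; rewrite leeD2r.
Qed.

(** For a single state the geometric series of returns has the value exit over escape. A class
    contains many points, so that value is only confined between the worst ratios [al / bh] and
    [ah / bl]. *)
Lemma elimination_bounds (L : {pred 'I_M}) (al ah bl bh : R) :
  (forall j, j \in L -> j \notin B') -> 0 <= ah -> 0 < bl -> 0 < bh ->
  (forall y, kexit B [predC B] y = 1) ->
  (forall y, cls y = a -> al <= kexit B L y <= ah) ->
  (forall y, cls y = a -> bl <= kexit B [predC B'] y <= bh) ->
  (forall x, kexit B L x + al / bh * kexit B (pred1 a) x <= kexit B' L x
      <= kexit B L x + ah / bl * kexit B (pred1 a) x) /\
  (forall x, kexit B' [predC B'] x = 1).
Proof.
move=> LB' ah0 bl0 bh0 tot HL HC.
have aB1 j : j \in pred1 a -> j \notin B by rewrite inE => /eqP ->.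
have compl y : kexit B [predC B'] y + kexit B (pred1 a) y = 1.
  rewrite -(tot y); symmetry; apply: kexitU => j; rewrite !inE //= B'E.
    by case: eqVneq => [->|_]; rewrite ?aB ?orbF.
  by rewrite negb_or => /andP[].
have CB' j : j \in [predC B'] -> j \notin B' by rewrite inE.
have lowL y : cls y = a -> al / bh <= kexit B' L y.
  apply: (@inf_bootstrap R S [set y | cls y = a]) => // [z _|m m0 Hm z /= za].
    exact: kexit_ge0.
  apply: le_trans (elimination_lower m0 LB' Hm z).
  have /andP[h1 _] := HL z za; have /andP[_ h2] := HC z za; have := compl z.
  nra.
(* The same bootstrap with every exit as target gives [bl / bl]: a uniform lower bound on the escape
   probability makes the exit almost sure. *)
have lowC y : cls y = a -> 1 <= kexit B' [predC B'] y.
  rewrite -{1}(@divff _ bl) ?gt_eqF //.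
  apply: (@inf_bootstrap R S [set y | cls y = a]) => // [z _|m m0 Hm z /= za].
    exact: kexit_ge0.
  apply: le_trans (elimination_lower m0 CB' Hm z).
  have m1 : m <= 1 by apply: le_trans (Hm z za) (kexit_le1 z CB').
  have /andP[h1 h2] := HC z za; have := compl z.
  nra.
split=> x; first (apply/andP; split).
(* The value granted at class [a] must be nonnegative. For negative [al] the extra term is
   nonpositive, and the value 0 suffices. *)
- have [al0|al0] := leP 0 al.
    by apply: elimination_lower => //; rewrite divr_ge0 // ltW.
  apply: le_trans (elimination_lower (lexx 0) LB' (fun y _ => kexit_ge0 _ _ _) x).
  rewrite mul0r addr0 gerDl nmulr_rle0 ?kexit_ge0 //.
  by rewrite pmulr_llt0 // invr_gt0.
- apply: elimination_upper => //; first by rewrite divr_ge0 // ltW.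
  move=> y ya; have /andP[_ h1] := HL y ya; have /andP[h2 _] := HC y ya.
  have := compl y; set r := ah / bl => cy.
  have r0 : 0 <= r by rewrite divr_ge0 // ltW.
  have rE : ah = r * bl by rewrite /r divfK // gt_eqF.
  nra.
- apply/eqP; rewrite eq_le kexit_le1 //=.
  by rewrite -(compl x) -{1}[kexit B (pred1 a) x]mul1r elimination_lower.
Qed.

End Elimination.

(** * Kernel exit probabilities against those of the finite chain *)

Lemma additive_pred {R : realType} {M : nat} (F : {pred 'I_M} -> \bar R) (L : {pred 'I_M}) :
  (forall L L1 L2 : {pred 'I_M}, (forall j, (j \in L) = (j \in L1) || (j \in L2)) ->
     (forall j, j \in L1 -> j \notin L2) -> F L = F L1 + F L2)%E ->
  F pred0 = 0%E -> F L = (\sum_(j | j \in L) F (pred1 j))%E.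
Proof.
move=> FD F0.
have H (s : seq 'I_M) : uniq s -> (F [in s] = \sum_(j <- s) F (pred1 j))%E.
  elim: s => [_|a s IH /andP[as_ us]].
    by rewrite big_nil -F0 (FD _ pred0 pred0) // F0 adde0.
  rewrite big_cons -IH // (FD [in a :: s] (pred1 a) [in s]) // => j; rewrite !inE //.
  by move=> /eqP ->.
rewrite -big_enum -H ?enum_uniq // (FD L [in enum L] pred0) ?F0 ?adde0 // => j.
by rewrite mem_enum orbF.
Qed.

(** The expression [u + v * (A / B)] is the recursion defining [exitp]. With [h] at most [1 / 5] and
    [d / 5], the accumulated factors stay between [1 - d] and [1 + d]. *)
Lemma elimination_error {R : realFieldType} (h d A B u v k kL ka : R) :
  0 < h -> h <= 1 / 5 -> h <= d / 5 -> 0 <= A -> 0 < B -> 0 <= u -> 0 <= v ->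
  `|kL - u| <= h * u -> `|ka - v| <= h * v ->
  kL + (1 - h) * A / ((1 + h) * B) * ka <= k ->
  k <= kL + (1 + h) * A / ((1 - h) * B) * ka ->
  `|k - (u + v * (A / B))| <= d * (u + v * (A / B)).
Proof.
move=> h0 h15 hd5 A0 B0 u0 v0; rewrite !ler_norml => /andP[l1 l2] /andP[a1 a2].
set q := A / B; have q0 : 0 <= q by rewrite divr_ge0 // ltW.
have -> : (1 - h) * A / ((1 + h) * B) = (1 - h) / (1 + h) * q.
  by rewrite /q; field; apply/andP; split; apply: lt0r_neq0; lra.
have -> : (1 + h) * A / ((1 - h) * B) = (1 + h) / (1 - h) * q.
  by rewrite /q; field; apply/andP; split; apply: lt0r_neq0; lra.
move=> lo hi.
have c1 : (1 + h) / (1 - h) * (1 + h) <= 1 + d.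
  by rewrite mulrAC ler_pdivrMr; [nra|lra].
have c2 : 1 - d <= (1 - h) / (1 + h) * (1 - h).
  by rewrite mulrAC ler_pdivlMr; [nra|lra].
have c3 : 0 <= (1 + h) / (1 - h) by rewrite divr_ge0; lra.
have c4 : 0 <= (1 - h) / (1 + h) by rewrite divr_ge0; lra.
have hi' : k <= (1 + h) * u + (1 + h) / (1 - h) * q * ((1 + h) * v).
  apply: le_trans hi _; apply: lerD; first lra.
  by apply: ler_wpM2l; [exact: mulr_ge0|lra].
have lo' : (1 - h) * u + (1 - h) / (1 + h) * q * ((1 - h) * v) <= k.
  apply: le_trans lo; apply: lerD; first lra.
  by apply: ler_wpM2l; [exact: mulr_ge0|lra].
have vq0 : 0 <= v * q by exact: mulr_ge0.
have C1 := ler_wpM2r vq0 c1; have C2 := ler_wpM2r vq0 c2.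
have U1 : h * u <= d * u by apply: ler_wpM2r => //; lra.
apply/andP; split; nra.
Qed.

Section KernelAsymptotics.
Context {R : realType} {dS : measure_display} {S : measurableType dS} {M : nat}.
Variable cls : S -> 'I_M.
Hypothesis cls_meas : forall i, measurable (Si cls i).

Lemma lands_pred1 j : Si cls j `*` setT = lands cls (pred1 j) :> set (S * R).
Proof.
by apply/seteqP; split => z; rewrite /Si /lands /= inE; [move=> [-> _]|move=> /eqP].
Qed.

Lemma lands_sum (Q : R.-pker S ~> (S * R)%type) (L : {pred 'I_M}) x :
  Q x (lands cls L) = (\sum_(j | j \in L) Pk Q x (Si cls j))%:E.
Proof.
rewrite (additive_pred (F := fun L => Q x (lands cls L))) //; last 2 first.
- by move=> *; exact: landsU.
- by rewrite (_ : lands cls pred0 = set0) ?measure0 //; apply/seteqP; split.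
rewrite -sumEFin; apply: eq_bigr => j _; rewrite /Pk lands_pred1 fineK //.
rewrite ge0_fin_numE //; apply: le_lt_trans (prob_lands_le1 Q cls_meas _ _) _.
by rewrite ltry.
Qed.

Variables (Q : R -> R.-pker S ~> (S * R)%type) (P : R -> 'I_M -> 'I_M -> R).
Hypotheses (Pst : forall e : R, 0 < e -> stochastic (P e))
  (Pirr : forall e : R, 0 < e -> irreducible_chain (P e))
  (QP : forall i j d, 0 < d -> \forall e \near (0:R)^'+, forall x, cls x = i ->
     `|Pk (Q e) x (Si cls j) - P e i j| <= d * P e i j).

Lemma one_step_asymp (L : {pred 'I_M}) d : 0 < d -> \forall e \near (0:R)^'+, forall x,
  `|fine (Q e x (lands cls L)) - \sum_(j | j \in L) P e (cls x) j|
    <= d * \sum_(j | j \in L) P e (cls x) j.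
Proof.
move=> d0.
have H : \forall e \near (0:R)^'+, forall i j, forall x, cls x = i ->
     `|Pk (Q e) x (Si cls j) - P e i j| <= d * P e i j.
  by apply: filter_forall => i; apply: filter_forall => j; exact: QP.
near=> e => x.
have {}He : forall i j, forall x, cls x = i ->
     `|Pk (Q e) x (Si cls j) - P e i j| <= d * P e i j by near: e.
rewrite lands_sum /= -sumrB mulr_sumr (le_trans (ler_norm_sum _ _ _)) //.
by apply: ler_sum => j _; exact: He.
Unshelve. all: by end_near. Qed.

Lemma kexit_nil (Q0 : R.-pker S ~> (S * R)%type) (B L : {pred 'I_M}) x : B =i pred0 ->
  kexit cls Q0 B L x = fine (Q0 x (lands cls L)).
Proof.
move=> B0; rewrite /kexit /Kexit green_eq //; last exact: measurable_cost.
rewrite /step_in (_ : lands cls B = set0) ?integral_set0 ?adde0 //.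
by apply/seteqP; split => z //; rewrite /lands /= B0.
Qed.

(** Each elimination enlarges the relative error by a bounded factor and the length of [s] is fixed,
    so the comparison is uniform in the starting point. Almost sure exit is carried along because
    the next elimination relies on it. *)
Lemma kexit_asymp (s : seq 'I_M) : proper_seq s ->
  (forall L : {pred 'I_M}, (forall j, j \in L -> j \notin s) -> forall d, 0 < d ->
     \forall e \near (0:R)^'+, forall x,
       `|kexit cls (Q e) [in s] L x - exitp (P e) s L (cls x)|
         <= d * exitp (P e) s L (cls x)) /\
  (\forall e \near (0:R)^'+, forall x, kexit cls (Q e) [in s] [predC s] x = 1).
Proof.
elim: s => [_|a s IH pas].
  split=> [L _ d d0|].
    near=> e => x; rewrite kexit_nil //=; move: x; near: e; exact: one_step_asymp.
  near=> e => x; rewrite kexit_nil // (_ : lands cls _ = setT) ?prob_kernel //.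
  by apply/seteqP; split => // z _; rewrite /lands /= inE.
have [/andP[as_ us] [j0 j0s]] := pas.
have ps : proper_seq s.
  by split => //; exists j0; move: j0s; rewrite inE negb_or => /andP[].
have [IHL IHtot] := IH ps.
have aP j : j \in pred1 a -> j \notin s by rewrite inE => /eqP ->.
have CP j : j \in [predC a :: s] -> j \notin s by rewrite !inE negb_or => /andP[].
have sE j : (j \in [in a :: s]) = (j == a) || (j \in [in s]) by rewrite !inE.
suff main L : (forall j, j \in L -> j \notin a :: s) -> forall d, 0 < d ->
    \forall e \near (0:R)^'+, (forall x,
       `|kexit cls (Q e) [in a :: s] L x - exitp (P e) (a :: s) L (cls x)|
         <= d * exitp (P e) (a :: s) L (cls x)) /\
       forall x, kexit cls (Q e) [in a :: s] [predC a :: s] x = 1.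
  split=> [L Ls d d0|]; first by apply: filterS (main L Ls d d0) => e [].
  have CC j : j \in [predC a :: s] -> j \notin a :: s by rewrite !inE.
  by apply: filterS (main _ CC 1 ltr01) => e [].
move=> Ls d d0.
have LP j : j \in L -> j \notin s by move=> /Ls; rewrite inE negb_or => /andP[].
pose h := Num.min d 1 / 5.
have h0 : 0 < h by rewrite divr_gt0 // lt_min d0 ltr01.
near=> e; have e0 : 0 < e by near: e; exact: nbhs_right_gt.
have HL : forall x, `|kexit cls (Q e) [in s] L x - exitp (P e) s L (cls x)|
    <= h * exitp (P e) s L (cls x) by near: e; exact: IHL.
have Ha : forall x, `|kexit cls (Q e) [in s] (pred1 a) x - exitp (P e) s (pred1 a) (cls x)|
    <= h * exitp (P e) s (pred1 a) (cls x) by near: e; exact: IHL.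
have HC : forall x, `|kexit cls (Q e) [in s] [predC a :: s] x - exitp (P e) s [predC a :: s] (cls x)|
    <= h * exitp (P e) s [predC a :: s] (cls x) by near: e; exact: IHL.
have Htot : forall x, kexit cls (Q e) [in s] [predC s] x = 1 by near: e.
pose A := exitp (P e) s L a; pose B := exitp (P e) s [predC a :: s] a.
have B0 : 0 < B by apply: exitp_escape_gt0; [exact: Pst|exact: Pirr|].
have A0 : 0 <= A by apply: exitp_ge0; exact: Pst.
have h15 : h <= 1 / 5 by rewrite ler_pM2r // ge_min lexx orbT.
have hd5 : h <= d / 5 by rewrite ler_pM2r // ge_min lexx.
have [|||||||bnd tot] := @elimination_bounds R dS S M cls (Q e) cls_meas [in s] [in a :: s] a
  as_ sE L ((1 - h) * A) ((1 + h) * A) ((1 - h) * B) ((1 + h) * B).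
- exact: Ls.
- by rewrite mulr_ge0 //; lra.
- by rewrite mulr_gt0 //; lra.
- by rewrite mulr_gt0 //; lra.
- exact: Htot.
- move=> y ya; have := HL y; rewrite ya -/A ler_norml => /andP[? ?]; apply/andP; split; lra.
- move=> y ya; have := HC y; rewrite ya -/B ler_norml => /andP[? ?]; apply/andP; split; lra.
split; last exact: tot.
move=> x; have /andP[lo hi] := bnd x.
have /= := HL x; have /= := Ha x; rewrite -/A -/B.
move=> av lu; apply: (elimination_error (h := h) (A := A) (B := B) _ _ _ A0 B0 _ _ lu av) => //.
- by apply: exitp_ge0; exact: Pst.
- by apply: exitp_ge0; exact: Pst.
Unshelve. all: by end_near. Qed.

End KernelAsymptotics.

(** * Costs accumulated through repeated returns *)

Section Return.
Context {R : realType} {dS : measure_display} {S : measurableType dS} {M : nat}.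
Variables (cls : S -> 'I_M) (Q : R.-pker S ~> (S * R)%type).
Hypothesis cls_meas : forall i, measurable (Si cls i).
Variables (A B : {pred 'I_M}) (a : 'I_M).
Hypotheses (aB : a \notin B) (AE : forall j, (j \in A) = (j == a) || (j \in B)).
Variable c : S -> \bar R.
Hypotheses (c0 : forall y, (0 <= c y)%E) (mc : measurable_fun setT c).
Local Notation green := (green cls Q).
Local Notation kexit := (kexit cls Q).

(** The chain pays [c x] at once and, if it meets class [a] at a later step before leaving [A], at
    least [m] from then on. *)
Lemma green_return (m : R) : 0 <= m ->
  (forall y, cls y = a -> m%:E <= green A c y)%E ->
  forall x, (c x + (m * kexit B (pred1 a) x)%:E <= green A c x)%E.
Proof.
move=> m0 H x.
have aP j : j \in pred1 a -> j \notin B by rewrite inE => /eqP ->.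
have mQ : measurable_fun setT (fun y => Q y (lands cls (pred1 a))) by exact: measurable_cost.
have fge y : (0 <= green A c y)%E by exact: green_ge0.
have mf : measurable_fun setT (green A c) by exact: measurable_green.
pose c' y := (c y + m%:E * Q y (lands cls (pred1 a)))%E.
have c'0 y : (0 <= c' y)%E by rewrite adde_ge0 // mule_ge0.
have mc' : measurable_fun setT c'.
  by apply: emeasurable_funD => //; exact: measurable_funeM.
apply: le_trans (_ : green B c' x <= _)%E; last first.
  apply: (green_min cls_meas c'0 mc' (A := predT)) => // y _.
  rewrite [leRHS]green_eq // /c' -addeA leeD2l //.
  rewrite (step_inU Q cls_meas y fge mf AE aP).
  have : (m%:E * Q y (lands cls (pred1 a)) <= step_in cls Q (pred1 a) (green A c) y)%E.
    by rewrite -step_in_cst //; apply: le_step_in => // z; rewrite inE => /eqP; exact: H.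
  move: (step_in cls Q (pred1 a) (green A c) y) (step_in cls Q B (green A c) y) => v w.
  by move=> vQ; rewrite leeD2r.
rewrite /c' greenD //; last 2 first.
- by move=> y; rewrite mule_ge0.
- exact: measurable_funeM.
rewrite greenZ // EFinM -KexitE // leeD2r // green_eq // leeDl //.
by apply: step_in_ge0 => y; exact: green_ge0.
Qed.

(** If each return to class [a] fails with probability at most [d], the class is visited about
    [1 / d] times on average, at cost at least [g] each time. *)
Lemma green_amplify (d g : R) : 0 < d -> d <= 1 -> 0 <= g ->
  (forall y, cls y \in A -> 1 - d <= kexit B (pred1 a) y) ->
  (forall y, cls y = a -> g%:E <= c y)%E ->
  forall x, cls x \in A -> (((1 - d) * (g / d))%:E <= green A c x)%E.
Proof.
move=> d0 d1 g0 kd gc x xA.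
have low y : cls y = a -> ((g / d)%:E <= green A c y)%E.
  move=> ya.
  have gd0 : 0 <= g / d by rewrite divr_ge0 // ltW.
  (* The total cost may be infinite; truncating at the target [g / d] gives the real-valued function
     that the infimum argument needs. *)
  have fE z : ((fine (mine (green A c z) (g / d)%:E))%:E = mine (green A c z) (g / d)%:E).
    rewrite fineK // ge0_fin_numE ?le_min ?green_ge0 ?lee_fin //.
    by rewrite gt_min ltry orbT.
  suff : g / d <= fine (mine (green A c y) (g / d)%:E).
    by rewrite -lee_fin fE le_min => /andP[].
  apply: (@inf_bootstrap R S [set y | cls y = a]
    (fun z => fine (mine (green A c z) (g / d)%:E)) g d) => // [z _|m m0 Hm z /= za].
    by rewrite fine_ge0 // le_min green_ge0 // lee_fin.
  have zA : cls z \in A by rewrite AE za eqxx.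
  have hm w : cls w = a -> (m%:E <= green A c w)%E.
    by move=> wa; have := Hm w wa; rewrite -lee_fin fE le_min => /andP[].
  have mgd : m <= g / d by have := Hm z za; rewrite -lee_fin fE le_min lee_fin => /andP[].
  rewrite -lee_fin fE le_min; apply/andP; split.
    apply: le_trans (green_return m0 hm z); rewrite EFinD.
    apply: leeD; first exact: gc.
    by rewrite lee_fin mulrC ler_wpM2l // kd.
  rewrite lee_fin; apply: le_trans (_ : g + (1 - d) * (g / d) <= _).
    by rewrite lerD2l ler_wpM2l // subr_ge0.
  by rewrite le_eqVlt; apply/orP; left; apply/eqP; field; exact: lt0r_neq0.
have gd0 : 0 <= g / d by rewrite divr_ge0 // ltW.
apply: le_trans (green_return gd0 low x); rewrite -[leLHS]add0e.
apply: leeD; first exact: c0.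
by rewrite lee_fin mulrC ler_wpM2l // kd.
Qed.
End Return.

Lemma measurable_label {R : realType} {dS : measure_display} {S : measurableType dS} {M : nat}
    (cls : S -> 'I_M) (f : 'I_M -> R) : (forall i, measurable (Si cls i)) ->
  measurable_fun setT (fun y => (f (cls y))%:E).
Proof.
move=> cls_meas _ Y mY; rewrite setTI.
rewrite (_ : _ @^-1` _ = [set x | cls x \in [pred i | `[< Y (f i)%:E >]]]).
  exact: measurable_cls.
apply/seteqP; split => x /=; rewrite unfold_in /=; first by move=> Yx; exact/asboolP.
by move=> /asboolP.
Qed.

(** * Exit rates and occupation inside one cluster *)

Section ClusterLimits.
Context {R : realType} {dS : measure_display} {S : measurableType dS} {M n : nat}.
Variables (cls : S -> 'I_M).
Hypothesis cls_meas : forall i, measurable (Si cls i).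
Variables (Q : R -> R.-pker S ~> (S * R)%type) (P : R -> 'I_M -> 'I_M -> R).
Hypotheses (Pst : forall e : R, 0 < e -> stochastic (P e))
  (Pirr : forall e : R, 0 < e -> irreducible_chain (P e))
  (Pdiag : forall (e : R) i, 0 < e -> P e i i = 0)
  (QP : forall i j d, 0 < d -> \forall e \near (0:R)^'+, forall x, cls x = i ->
     `|Pk (Q e) x (Si cls j) - P e i j| <= d * P e i j).
Variables (p : 'I_M -> 'I_n) (k : 'I_n).
Hypotheses (psurj : forall k, exists i, p i = k) (n1 : (1 < n)%N)
  (rec : recurrent_blocks P p) (big : (1 < #|[pred i | p i == k]|)%N).

Let A : {pred 'I_M} := [pred i | p i == k].

Let blockA a j : p a = k -> (j \in A) = (j == a) || (j \in [in block_minus p a]).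
Proof.
move=> pa; rewrite !inE mem_block_minus pa.
by case: (eqVneq j a) => [->|_]; rewrite ?pa ?eqxx ?andbT.
Qed.

(** [recurrent_blocks] speaks of distinct states only. A second state [b] of the cluster bounds the
    probability of leaving directly from [a], since a direct departure misses [b]. Otherwise the
    first jump goes to another state of the cluster, from which [a] is reached again. *)
Lemma self_return a d : p a = k -> 0 < d ->
  \forall e \near (0:R)^'+, 1 - d <= exitp (P e) (block_minus p a) (pred1 a) a.
Proof.
move=> pa d0.
have [b pb ba] : exists2 b, p b = k & b != a.
  apply: contrapT => H; move: big; rewrite ltnNge => /negP; apply.
  rewrite -(card1 a); apply: subset_leq_card; apply/fintype.subsetP => b; rewrite !inE => /eqP pb.
  by apply/negPn/negP => ba; apply: H; exists b.
pose h := Num.min (d / 2) 1; have h0 : 0 < h by rewrite lt_min divr_gt0 //= ltr01.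
have hd : h <= d / 2 by rewrite ge_min lexx.
have h1 : h <= 1 by rewrite ge_min lexx orbT.
have R1 : \forall e \near (0:R)^'+, forall j, p j = k -> j != a ->
    1 - h <= exitp (P e) (block_minus p a) (pred1 a) j.
  apply: filter_forall => j; have [pj|pj] := eqVneq (p j) k; last first.
    by near=> e => pj'; rewrite pj' eqxx in pj.
  have [ja|ja] := eqVneq j a; first by near=> e.
  by near=> e => _ _; near: e; apply: rec => //; rewrite pj pa.
near=> e; have e0 : 0 < e by near: e; exact: nbhs_right_gt.
have Pse := Pst e0; have Pie := Pirr e0.
have R1e : forall j, p j = k -> j != a ->
    1 - h <= exitp (P e) (block_minus p a) (pred1 a) j by near: e.
have R2 : 1 - h <= exitp (P e) (block_minus p b) (pred1 b) a.
  by near: e; apply: rec; rewrite ?pa ?pb // eq_sym.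
have pba := block_minus_proper p b.
have out : \sum_(j | p j != k) P e a j <= h.
  have := exitp_total Pse Pie a pba.
  rewrite (@exitpU _ _ (P e) _ (pred1 b) [pred j | p j != k]).
  - have := exitp_step Pse Pie [pred j | p j != k] a pba; rewrite /=; lra.
  - move=> j; rewrite !inE mem_block_minus pb.
    by case: (eqVneq j b) => [->|_]; rewrite ?pb ?eqxx //= andbT.
  - by move=> j; rewrite !inE mem_block_minus => /eqP ->; rewrite !eqxx.
  - by move=> j; rewrite !inE mem_block_minus pb => /negPf ->.
have ins : \sum_(j <- block_minus p a) P e a j = 1 - \sum_(j | p j != k) P e a j.
  rewrite -(Pse.2 a) [X in X - _](bigID [pred j | p j == k]) /= addrK.
  rewrite [RHS](bigD1 a) /= ?pa ?eqxx // Pdiag // add0r big_uniq ?enum_uniq //=.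
  by apply: eq_bigl => j; rewrite mem_block_minus pa.
rewrite (exitp_harmonic Pse Pie _ _ (block_minus_proper p a)) big_pred1_eq Pdiag // add0r.
apply: le_trans (_ : \sum_(j <- block_minus p a) P e a j * (1 - h) <= _).
  rewrite -mulr_suml ins; nra.
rewrite !big_uniq ?enum_uniq //=; apply: ler_sum => j; rewrite mem_block_minus pa => /andP[/eqP pj ja].
by rewrite ler_wpM2l ?R1e //; exact: Pse.1.
Unshelve. all: by end_near. Qed.

Lemma kexit_return a d : p a = k -> 0 < d -> \forall e \near (0:R)^'+, forall x, cls x \in A ->
  1 - d <= kexit cls (Q e) [in block_minus p a] (pred1 a) x.
Proof.
move=> pa d0.
pose h := Num.min (d / 2) 1; have h0 : 0 < h by rewrite lt_min divr_gt0 //= ltr01.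
have hd : h <= d / 2 by rewrite ge_min lexx.
have h1 : h <= 1 by rewrite ge_min lexx orbT.
have R1 : \forall e \near (0:R)^'+, forall j, p j = k ->
    1 - h <= exitp (P e) (block_minus p a) (pred1 a) j.
  apply: filter_forall => j; have [pj|pj] := eqVneq (p j) k; last first.
    by near=> e => pj'; rewrite pj' eqxx in pj.
  have [->|ja] := eqVneq j a; first by near=> e => _; near: e; exact: self_return.
  by near=> e => _; near: e; apply: rec => //; rewrite pj pa.
have aN j : j \in pred1 a -> j \notin block_minus p a.
  by rewrite inE mem_block_minus => /eqP ->; rewrite !eqxx.
have [W _] := kexit_asymp cls_meas Pst Pirr QP (block_minus_proper p a).
near=> e => x /eqP xA.
have R1e : 1 - h <= exitp (P e) (block_minus p a) (pred1 a) (cls x).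
  by apply: (near R1 e) => //.
have := near (W _ aN _ h0) e => /(_ _)/(_ x); rewrite ler_norml => /(_ _)/andP[//|lo _].
nra.
Unshelve. all: by end_near. Qed.

(** From [y] the class of [x] is met before the exit with probability near one, and on that class
    the exit probability is at least [(1 - h) * r], while at [x] it is at most [(1 + h) * r]. *)
Lemma kexit_osc (L : {pred 'I_M}) d : (forall j, j \in L -> j \notin A) -> 0 < d ->
  \forall e \near (0:R)^'+, forall x y, cls x \in A -> cls y \in A ->
    kexit cls (Q e) A L x <= (1 + d) * kexit cls (Q e) A L y.
Proof.
move=> LA d0.
(* Small enough for [1 + h <= (1 + d) * (1 - h) ^ 2]. *)
pose h := Num.min d 1 / 6; have h0 : 0 < h by rewrite divr_gt0 // lt_min d0 ltr01.
have h16 : h <= 1 / 6 by rewrite ler_pM2r // ge_min lexx orbT.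
have hd6 : h <= d / 6 by rewrite ler_pM2r // ge_min lexx.
have ABl : A =i [in block p k] by move=> j; rewrite !inE mem_block.
have LB j : j \in L -> j \notin block p k by move=> /LA; rewrite mem_block.
have [W _] := kexit_asymp cls_meas Pst Pirr QP (block_proper psurj n1 k).
have Kr : \forall e \near (0:R)^'+, forall a, p a = k -> forall x, cls x \in A ->
  1 - h <= kexit cls (Q e) [in block_minus p a] (pred1 a) x.
  apply: filter_forall => a; have [pa|pa] := eqVneq (p a) k; last first.
    by near=> e => pa'; rewrite pa' eqxx in pa.
  by near=> e => _; near: e; exact: kexit_return.
near=> e => x y xA yA; have e0 : 0 < e by near: e; exact: nbhs_right_gt.
have We : forall x, `|kexit cls (Q e) [in block p k] L x - exitp (P e) (block p k) L (cls x)|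
         <= h * exitp (P e) (block p k) L (cls x) by near: e; exact: W.
have Ke : forall a, p a = k -> forall x, cls x \in A ->
  1 - h <= kexit cls (Q e) [in block_minus p a] (pred1 a) x by near: e.
have WA z : `|kexit cls (Q e) A L z - exitp (P e) (block p k) L (cls z)|
    <= h * exitp (P e) (block p k) L (cls z).
  by rewrite (kexit_ext cls (Q e) z ABl (fun j => erefl (j \in L))).
set K := kexit cls (Q e) A L in WA *.
set r := exitp (P e) (block p k) L (cls x).
have r0 : 0 <= r by apply: exitp_ge0; exact: Pst.
have xk : p (cls x) = k by apply/eqP.
have LN j : j \in L -> j \notin A := LA j.
have m0 : 0 <= (1 - h) * r by rewrite mulr_ge0 //; lra.
have low z : cls z = cls x -> (((1 - h) * r)%:E <= green cls (Q e) A (fun y => Q e y (lands cls L)) z)%E.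
  move=> zx; rewrite -/(Kexit cls (Q e) A L) KexitE // lee_fin.
  have := WA z; rewrite zx -/r ler_norml -/K => /andP[? ?]; lra.
have xB : cls x \notin [in block_minus p (cls x)] by rewrite ?inE mem_block_minus !eqxx.
have H := @green_return R dS S M cls (Q e) cls_meas A [in block_minus p (cls x)] (cls x)
  xB (fun j => blockA j xk) _ (fun=> measure_ge0 _ _) (measurable_cost _ cls_meas L)
  _ m0 low y.
rewrite -/(Kexit cls (Q e) A L) KexitE // in H.
have {H} : (1 - h) * r * kexit cls (Q e) [in block_minus p (cls x)] (pred1 (cls x)) y <= K y.
  by rewrite -lee_fin; apply: le_trans H; rewrite leeDr.
have kx := Ke _ xk y yA.
have := WA x; rewrite -/r ler_norml => /andP[? Kx] Ky.
have Ky2 : (1 - h) * r * (1 - h) <= K y by apply: le_trans Ky; rewrite ler_wpM2l.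
apply: le_trans (_ : (1 + h) * r <= _); first by lra.
apply: le_trans (_ : (1 + d) * ((1 - h) * r * (1 - h)) <= _); last by rewrite ler_wpM2l //; lra.
have -> : (1 + d) * ((1 - h) * r * (1 - h)) = ((1 + d) * (1 - h) * (1 - h)) * r by ring.
rewrite ler_wpM2r //; nra.
Unshelve. all: by end_near. Qed.

(** Every visit to class [i] is a fresh chance of jumping into [L], and there are about [1 / h]
    visits before the exit; the one-step chance is therefore small against the exit probability. *)
Lemma exit_rate_small (L : {pred 'I_M}) d i : (forall j, j \in L -> j \notin A) ->
  p i = k -> 0 < d ->
  \forall e \near (0:R)^'+, forall x, cls x \in A ->
    \sum_(j | j \in L) P e i j <= d * kexit cls (Q e) A L x.
Proof.
move=> LA pi d0.
pose h := Num.min d 1 / 6; have h0 : 0 < h by rewrite divr_gt0 // lt_min d0 ltr01.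
have h16 : h <= 1 / 6 by rewrite ler_pM2r // ge_min lexx orbT.
have hd6 : h <= d / 6 by rewrite ler_pM2r // ge_min lexx.
have O1 := one_step_asymp cls_meas QP L h0.
near=> e => x xA; have e0 : 0 < e by near: e; exact: nbhs_right_gt.
set s := \sum_(j | j \in L) P e i j.
have s0 : 0 <= s by apply: sumr_ge0 => j _; exact: (Pst e0).1.
have Oe : forall x, `|fine (Q e x (lands cls L)) - \sum_(j | j \in L) P e (cls x) j|
    <= h * \sum_(j | j \in L) P e (cls x) j by near: e.
have Ke : forall x, cls x \in A ->
  1 - h <= kexit cls (Q e) [in block_minus p i] (pred1 i) x by near: e; exact: kexit_return.
have g0 : 0 <= (1 - h) * s by rewrite mulr_ge0 //; lra.
have gc y : cls y = i -> (((1 - h) * s)%:E <= Q e y (lands cls L))%E.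
  move=> yi; have := Oe y; rewrite yi -/s lands_sum //= ler_norml lee_fin => /andP[? ?]; lra.
have iB : i \notin [in block_minus p i] by rewrite ?inE mem_block_minus !eqxx.
have := @green_amplify R dS S M cls (Q e) cls_meas A [in block_minus p i] i iB
  (fun j => blockA j pi) _ (fun=> measure_ge0 _ _) (measurable_cost _ cls_meas L) h _ h0 _ g0 Ke gc x xA.
rewrite -/(Kexit cls (Q e) A L) KexitE // lee_fin => H.
have {}H : (1 - h) * ((1 - h) * s / h) <= kexit cls (Q e) A L x by apply: H; lra.
apply: le_trans (_ : d * ((1 - h) * ((1 - h) * s / h)) <= _); last by rewrite ler_wpM2l // ltW.
have -> : d * ((1 - h) * ((1 - h) * s / h)) = (d / h * (1 - h) * (1 - h)) * s.
  by field; exact: lt0r_neq0.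
have d6 : 6 <= d / h by rewrite ler_pdivlMr //; lra.
rewrite -{1}[s]mul1r ler_wpM2r //; nra.
Unshelve. all: by end_near. Qed.

(** The same amplification with the holding scales as cost: about [1 / h] visits to class [i], each
    contributing [tau e i]. *)
Lemma green_dominates (tau : R -> 'I_M -> R) d i :
  (forall e : R, 0 < e -> forall i, 0 < tau e i) -> p i = k -> 0 < d ->
  \forall e \near (0:R)^'+, forall x, cls x \in A ->
    ((tau e i)%:E <= d%:E * green cls (Q e) A (fun y => (tau e (cls y))%:E) x)%E.
Proof.
move=> tau0 pi d0.
pose h := Num.min d 1 / 6; have h0 : 0 < h by rewrite divr_gt0 // lt_min d0 ltr01.
have h16 : h <= 1 / 6 by rewrite ler_pM2r // ge_min lexx orbT.
have hd6 : h <= d / 6 by rewrite ler_pM2r // ge_min lexx.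
near=> e => x xA; have e0 : 0 < e by near: e; exact: nbhs_right_gt.
have Ke : forall x, cls x \in A ->
  1 - h <= kexit cls (Q e) [in block_minus p i] (pred1 i) x by near: e; exact: kexit_return.
have iB : i \notin [in block_minus p i] by rewrite ?inE mem_block_minus !eqxx.
have t0 : 0 <= tau e i by rewrite ltW // tau0.
have gc y : cls y = i -> ((tau e i)%:E <= (tau e (cls y))%:E)%E by move=> ->.
have := @green_amplify R dS S M cls (Q e) cls_meas A [in block_minus p i] i iB
  (fun j => blockA j pi) _ _ _ h _ h0 _ t0 Ke gc x xA.
have c0 y : (0 <= (tau e (cls y))%:E)%E by rewrite lee_fin ltW // tau0.
have h1 : h <= 1 by lra.
move=> /(_ c0 (measurable_label (tau e) cls_meas) h1) H.
apply: le_trans (lee_wpmul2l _ H); last by rewrite lee_fin ltW.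
rewrite -EFinM lee_fin.
have -> : d * ((1 - h) * (tau e i / h)) = (d / h * (1 - h)) * tau e i.
  by field; exact: lt0r_neq0.
have d6 : 6 <= d / h by rewrite ler_pdivlMr //; lra.
rewrite -{1}[tau e i]mul1r ler_wpM2r //; nra.
Unshelve. all: by end_near. Qed.

End ClusterLimits.

(** * Moments of the holding times *)

Section HoldingTimes.
Context {R : realType} {dS : measure_display} {S : measurableType dS} {M : nat}.
Variables (cls : S -> 'I_M).
Hypothesis cls_meas : forall i, measurable (Si cls i).

(** Left unnormalized, the mean holding time is additive in the target [L]. The positive part makes
    the integrand nonnegative everywhere, not just almost everywhere. *)
Definition hold (Q0 : R.-pker S ~> (S * R)%type) (L : {pred 'I_M}) x : \bar R :=
  (\int[Q0 x]_(z in lands cls L) (Num.max z.2 0)%:E)%E.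

Definition hold2 (Q0 : R.-pker S ~> (S * R)%type) x : \bar R :=
  (\int[Q0 x]_z (Num.max z.2 0 ^+ 2)%:E)%E.

Let ml L : measurable (lands cls L : set (S * R)). Proof. exact: measurable_lands. Qed.
Hint Resolve ml : core.

Lemma measurable_pos_snd : measurable_fun [set: S * R] (fun z : S * R => Num.max z.2 0).
Proof. by apply: measurable_maxr; [exact: measurable_snd|exact: measurable_cst]. Qed.

Lemma measurable_time (D : set (S * R)) : measurable_fun D (fun z : S * R => (Num.max z.2 0)%:E).
Proof.
apply: measurable_funTS; apply/measurable_EFinP; exact: measurable_pos_snd.
Qed.

Lemma measurable_time2 (D : set (S * R)) :
  measurable_fun D (fun z : S * R => (Num.max z.2 0 ^+ 2)%:E).
Proof.
apply: measurable_funTS; apply/measurable_EFinP; apply: measurable_funX.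
exact: measurable_pos_snd.
Qed.

Lemma time_ge0 (z : S * R) : (0 <= (Num.max z.2 0)%:E)%E.
Proof. by rewrite lee_fin le_max lexx orbT. Qed.

Lemma time2_ge0 (z : S * R) : (0 <= (Num.max z.2 0 ^+ 2)%:E)%E.
Proof. by rewrite lee_fin sqr_ge0. Qed.

Section Additive.
Variables (mu : {measure set (S * R) -> \bar R}) (f : S * R -> \bar R).
Hypotheses (f0 : forall z, (0 <= f z)%E) (mf : measurable_fun setT f).

Lemma integral_landsU (L L1 L2 : {pred 'I_M}) :
  (forall j, (j \in L) = (j \in L1) || (j \in L2)) ->
  (forall j, j \in L1 -> j \notin L2) ->
  (\int[mu]_(z in lands cls L) f z =
   \int[mu]_(z in lands cls L1) f z + \int[mu]_(z in lands cls L2) f z)%E.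
Proof.
move=> LE Ld; rewrite -ge0_integral_setU //.
- by congr (integral _ _ _); apply/seteqP; split => z; rewrite /lands /= LE => /orP.
- exact: measurable_funTS.
- rewrite disj_set2E; apply/eqP/seteqP; split => // z [/= /Ld zB2 zB].
  by rewrite zB in zB2.
Qed.

Lemma integral_lands_sum (L : {pred 'I_M}) :
  (\int[mu]_(z in lands cls L) f z =
   \sum_(j | j \in L) \int[mu]_(z in lands cls (pred1 j)) f z)%E.
Proof.
apply: (additive_pred (F := fun L => (\int[mu]_(z in lands cls L) f z)%E)).
  exact: integral_landsU.
by rewrite (_ : lands cls pred0 = set0) ?integral_set0 //; apply/seteqP; split.
Qed.
End Additive.

Section FixedParameter.
Variables (Q0 : R.-pker S ~> (S * R)%type).
Hypothesis neg0 : forall x, Q0 x (setT `*` [set t | t < 0]) = 0%E.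

Lemma hold_condE x j : 0 < condE Q0 x (Si cls j) id -> 0 < Pk Q0 x (Si cls j) ->
  hold Q0 (pred1 j) x = (condE Q0 x (Si cls j) id * Pk Q0 x (Si cls j))%:E.
Proof.
move=> c0 p0; have E : hold Q0 (pred1 j) x = (\int[Q0 x]_(z in Si cls j `*` setT) (z.2)%:E)%E.
  rewrite lands_pred1 /hold; apply: ae_eq_integral => //.
  - exact: measurable_time.
  - by apply: measurable_funTS; apply/measurable_EFinP; exact: measurable_snd.
  exists (setT `*` [set t | t < 0]); split.
  - by apply: measurableX => //; rewrite -[X in measurable X]set_itvNyo; exact: measurable_itv.
  - exact: neg0.
  - move=> z /= /not_implyP[_ H]; split => //=; rewrite ltNge; apply/negP => z0.
    by apply: H; rewrite /Num.max ltNge z0.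
rewrite E; have cE : condE Q0 x (Si cls j) id * Pk Q0 x (Si cls j) =
    fine (\int[Q0 x]_(z in Si cls j `*` setT) (z.2)%:E)%E.
  by rewrite /condE divfK // gt_eqF.
(* [fine] sends infinite values to 0, so a positive product shows that the integral is finite. *)
have := mulr_gt0 c0 p0; rewrite cE.
by case: (\int[Q0 x]_(z in _) _)%E => [r| |] //=; rewrite ltxx.
Qed.

Lemma hold_null x j : Pk Q0 x (Si cls j) = 0 -> hold Q0 (pred1 j) x = 0%E.
Proof.
move=> H; apply: null_set_integral => //; first exact: measurable_time.
by rewrite lands_sum // big_pred1_eq H.
Qed.

(** The square of a time is at most twice its squared deviation from [c] plus [2 * c ^+ 2]. The
    variance contributes [2 * C], and [c <= 2 * t] contributes 8. *)
Lemma hold2_bound x (C t : R) : 0 <= C -> 0 <= t ->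
  (forall j, Pk Q0 x (Si cls j) = 0 \/ [/\ 0 <= condE Q0 x (Si cls j) id <= 2 * t &
     (\int[Q0 x]_(z in Si cls j `*` setT) ((z.2 - condE Q0 x (Si cls j) id) ^+ 2)%:E
        <= (C * t ^+ 2 * Pk Q0 x (Si cls j))%:E)%E]) ->
  (hold2 Q0 x <= ((2 * C + 8) * t ^+ 2)%:E)%E.
Proof.
move=> C0 t0 H; have lT : lands cls predT = [set: S * R] by apply/seteqP; split.
rewrite /hold2 -lT integral_lands_sum; [|exact: time2_ge0|exact: measurable_time2].
have S1 : \sum_(j | j \in predT) Pk Q0 x (Si cls j) = 1.
  by apply: EFin_inj; rewrite -lands_sum // lT prob_kernel.
have -> : (2 * C + 8) * t ^+ 2 = \sum_(j | j \in predT) (2 * C + 8) * t ^+ 2 * Pk Q0 x (Si cls j).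
  by rewrite -mulr_sumr S1 mulr1.
rewrite -sumEFin; apply: lee_sum => j _.
have p0 : 0 <= Pk Q0 x (Si cls j) by rewrite fine_ge0.
have [P0|[/andP[c0 c2] V]] := H j.
  rewrite null_set_integral ?P0 ?mulr0 //; first exact: measurable_time2.
  by rewrite lands_sum // big_pred1_eq P0.
set c := condE _ _ _ _ in c0 c2 V.
have mV : measurable_fun (lands cls (pred1 j)) (fun z : S * R => ((z.2 - c) ^+ 2)%:E).
  apply: measurable_funTS; apply/measurable_EFinP; apply: measurable_funX.
  by apply: measurable_funB; [exact: measurable_snd|exact: measurable_cst].
have V0 (z : S * R) : (0 <= ((z.2 - c) ^+ 2)%:E)%E by rewrite lee_fin sqr_ge0.
apply: le_trans (_ : \int[Q0 x]_(z in lands cls (pred1 j))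
   ((2%:E * ((z.2 - c) ^+ 2)%:E) + (2 * c ^+ 2)%:E) <= _)%E.
  apply: ge0_le_integral => //.
  - by move=> z _; exact: time2_ge0.
  - exact: measurable_time2.
  - by apply: emeasurable_funD => //; exact: measurable_funeM.
  - move=> z _; rewrite -EFinM -EFinD lee_fin.
    rewrite /Num.max; case: ifP => _; last by have := sqr_ge0 (z.2 - 2 * c); lra.
    by rewrite expr0n /= addr_ge0 // mulr_ge0 // sqr_ge0.
rewrite ge0_integralD //; last 3 first.
- by move=> z _; rewrite mule_ge0 // lee_fin.
- exact: measurable_funeM.
- by move=> z _; rewrite lee_fin mulr_ge0 // sqr_ge0.
rewrite ge0_integralZl_EFin // integral_cst // lands_sum // big_pred1_eq -EFinM.
rewrite -lands_pred1; apply: le_trans (leeD2r _ (lee_wpmul2l _ V)) _.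
  by rewrite lee_fin.
rewrite -EFinM -EFinD lee_fin.
have c4 : c ^+ 2 <= 4 * t ^+ 2 by nra.
have := ler_wpM2r p0 c4; nra.
Qed.
End FixedParameter.

Variables (Q : R -> R.-pker S ~> (S * R)%type) (P : R -> 'I_M -> 'I_M -> R)
  (tau : R -> 'I_M -> R).
Hypotheses (neg0 : forall eps x, Q eps x (setT `*` [set t | t < 0]) = 0%E)
  (Pst : forall e : R, 0 < e -> stochastic (P e))
  (Ppos : forall i j, nzP P i j -> forall e : R, 0 < e -> 0 < P e i j)
  (QP : forall i j d, 0 < d -> \forall e \near (0:R)^'+, forall x, cls x = i ->
     `|Pk (Q e) x (Si cls j) - P e i j| <= d * P e i j)
  (tau0 : forall e i, 0 < e -> 0 < tau e i)
  (mean : forall i j, nzP P i j ->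
     unif_lim (fun eps x => condE (Q eps) x (Si cls j) id / tau eps i) (Si cls i) 1)
  (var : exists (C eps0 : R), 0 < eps0 /\ forall eps, 0 < eps <= eps0 ->
     forall i j, nzP P i j -> forall x, Si cls i x ->
       (\int[Q eps x]_(z in Si cls j `*` setT)
           ((z.2 - condE (Q eps) x (Si cls j) id) ^+ 2)%:E
        <= (C * tau eps i ^+ 2 * Pk (Q eps) x (Si cls j))%:E)%E).

Lemma nzP_cases i j : nzP P i j \/ forall e : R, 0 < e -> P e i j = 0.
Proof.
have [nz|nz] := boolP (nzP P i j); [by left|right => e e0].
apply/eqP/negPn/negP => H; move: nz; rewrite /nzP => /asboolP; apply.
by exists e.
Qed.

Lemma hold_one i j d : 0 < d -> \forall e \near (0:R)^'+, forall x, cls x = i ->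
  hold (Q e) (pred1 j) x = (fine (hold (Q e) (pred1 j) x))%:E /\
  `|fine (hold (Q e) (pred1 j) x) - tau e i * P e i j| <= d * (tau e i * P e i j).
Proof.
move=> d0; have [nz|z] := nzP_cases i j; last first.
  have H := QP i j ltr01.
  near=> e => x xi; have e0 : 0 < e by near: e; exact: nbhs_right_gt.
  have : forall x, cls x = i -> `|Pk (Q e) x (Si cls j) - P e i j| <= 1 * P e i j by near: e.
  move=> /(_ x xi); rewrite z // mulr0 subr0 normr_le0 => /eqP P0.
  by rewrite hold_null //= mulr0 subr0 normr0 mulr0.
pose h := Num.min d 1 / 6; have h0 : 0 < h by rewrite divr_gt0 // lt_min d0 ltr01.
have h16 : h <= 1 / 6 by rewrite ler_pM2r // ge_min lexx orbT.
have hd6 : h <= d / 6 by rewrite ler_pM2r // ge_min lexx.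
have H := QP i j h0; have H2 := mean nz h0.
near=> e => x xi; have e0 : 0 < e by near: e; exact: nbhs_right_gt.
have p0 := Ppos nz e0; have t0 := tau0 i e0.
have : forall x, cls x = i -> `|Pk (Q e) x (Si cls j) - P e i j| <= h * P e i j by near: e.
move=> /(_ x xi); rewrite ler_norml => /andP[p1 p2].
have : forall x, Si cls i x -> `|condE (Q e) x (Si cls j) id / tau e i - 1| < h by near: e.
move=> /(_ x xi); set c := condE _ _ _ _; pose q := Pk (Q e) x (Si cls j).
have cE : c = c / tau e i * tau e i by rewrite divfK // gt_eqF.
rewrite ltr_norml; set s := c / tau e i in cE * => /andP[s1 s2].
have q0 : 0 < q by rewrite -/q in p1; nra.
have c0 : 0 < c by rewrite cE mulr_gt0 //; lra.
rewrite hold_condE //; split => //=; rewrite -/c -/q cE.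
have -> : s * tau e i * q - tau e i * P e i j = tau e i * (s * q - P e i j) by ring.
rewrite normrM (gtr0_norm t0) mulrCA ler_pM2l // ler_norml -/q in p1 p2 *.
have a1 : s * q <= (1 + h) * ((1 + h) * P e i j).
  by apply: ler_pM; lra.
have a2 : (1 - h) * ((1 - h) * P e i j) <= s * q.
  by apply: ler_pM; [lra|nra|lra|lra].
have b1 : h * h * P e i j <= h * P e i j by rewrite ler_wpM2r ?(ltW p0) //; nra.
have b2 : h * P e i j <= d / 6 * P e i j by rewrite ler_wpM2r ?(ltW p0).
apply/andP; split; nra.
Unshelve. all: by end_near. Qed.

Lemma hold_asymp (L : {pred 'I_M}) d : 0 < d -> \forall e \near (0:R)^'+, forall x,
  (((1 - d) * (tau e (cls x) * \sum_(j | j \in L) P e (cls x) j))%:E <= hold (Q e) L x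
   <= ((1 + d) * (tau e (cls x) * \sum_(j | j \in L) P e (cls x) j))%:E)%E.
Proof.
move=> d0; have H : \forall e \near (0:R)^'+, forall i j, forall x, cls x = i ->
    hold (Q e) (pred1 j) x = (fine (hold (Q e) (pred1 j) x))%:E /\
    `|fine (hold (Q e) (pred1 j) x) - tau e i * P e i j| <= d * (tau e i * P e i j).
  by apply: filter_forall => i; apply: filter_forall => j; exact: hold_one.
near=> e => x.
have He : forall i j, forall x, cls x = i ->
    hold (Q e) (pred1 j) x = (fine (hold (Q e) (pred1 j) x))%:E /\
    `|fine (hold (Q e) (pred1 j) x) - tau e i * P e i j| <= d * (tau e i * P e i j).
  by near: e.
have -> : hold (Q e) L x = (\sum_(j | j \in L) fine (hold (Q e) (pred1 j) x))%:E.
  rewrite {1}/hold integral_lands_sum; [|exact: time_ge0|exact: measurable_time].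
  by rewrite -sumEFin; apply: eq_bigr => j _; have [] := He _ j x erefl.
rewrite !lee_fin !mulr_sumr; apply/andP; split; apply: ler_sum => j _.
all: have [_] := He _ j x erefl; rewrite ler_norml => /andP[? ?]; lra.
Unshelve. all: by end_near. Qed.

Lemma hold2_asymp : exists2 C : R, 0 < C & \forall e \near (0:R)^'+, forall x,
  (hold2 (Q e) x <= (C * tau e (cls x) ^+ 2)%:E)%E.
Proof.
have [C [eps0 [eps00 V]]] := var.
(* The variance constant comes without a sign, whereas the moment bound takes a nonnegative one. *)
exists (2 * `|C| + 8); first by rewrite ltr_wpDl // mulr_ge0.
have H2 : \forall e \near (0:R)^'+, forall i j, nzP P i j -> forall x, Si cls i x ->
    `|condE (Q e) x (Si cls j) id / tau e i - 1| < 1.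
  apply: filter_forall => i; apply: filter_forall => j.
  have [nz|nz] := boolP (nzP P i j); last by near=> e.
  by near=> e => _; near: e; exact: mean.
have H1 : \forall e \near (0:R)^'+, forall i j, forall x, cls x = i ->
     `|Pk (Q e) x (Si cls j) - P e i j| <= 1 * P e i j.
  by apply: filter_forall => i; apply: filter_forall => j; exact: QP.
near=> e => x; have e0 : 0 < e by near: e; exact: nbhs_right_gt.
have e1 : e <= eps0 by near: e; exact: nbhs_right_le.
have H1e : forall i j, forall x, cls x = i ->
     `|Pk (Q e) x (Si cls j) - P e i j| <= 1 * P e i j by near: e.
have H2e : forall i j, nzP P i j -> forall x, Si cls i x ->
    `|condE (Q e) x (Si cls j) id / tau e i - 1| < 1 by near: e.
have t0 := tau0 (cls x) e0.
apply: hold2_bound => //; first exact: ltW.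
move=> j; have [nz|z] := nzP_cases (cls x) j; last first.
  by left; have := H1e _ j x erefl; rewrite z // mulr0 subr0 normr_le0 => /eqP.
right; split.
  have := H2e _ _ nz x erefl; rewrite ltr_norml.
  set q := condE _ _ _ _ / _ => /andP[? ?].
  have -> : condE (Q e) x (Si cls j) id = q * tau e (cls x) by rewrite divfK // gt_eqF.
  by apply/andP; split; [apply: mulr_ge0; lra|apply: ler_wpM2r; lra].
apply: le_trans (V e _ _ _ nz x erefl) _; first by rewrite e0.
by rewrite lee_fin ler_wpM2r ?fine_ge0 // ler_wpM2r ?sqr_ge0 // ler_norm.
Unshelve. all: by end_near. Qed.

End HoldingTimes.

(** * Kernels with equal integrated mass on every measurable set *)

Section KernelIntegral.
Context {R : realType} {d1 d2} {Y : measurableType d1} {Z : measurableType d2}.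
Import HBNNSimple.

(** On the range [Num.max r 0] is [r]; written this way, every coefficient is nonnegative without
    reference to the range. *)
Lemma nnsfun_seq (g : {nnsfun Z >-> R}) : exists s : seq R, forall z,
  g z = \sum_(r <- s) Num.max r 0 * \1_(g @^-1` [set r]) z.
Proof.
exists (finmap.enum_fset (fset_set (range g))) => z; rewrite {1}fimfunE fsbig_finite //=.
apply: eq_bigr => r _; rewrite indicE.
case: (boolP (z \in _)) => zr; rewrite ?mulr0 //.
by move: zr; rewrite inE /= => <-; rewrite max_l.
Qed.

Variables (mu : {measure set Y -> \bar R}) (D : set Y) (mD : measurable D).

Lemma integral_kernel_nnsfun (k : Y -> {measure set Z -> \bar R}) (g : {nnsfun Z >-> R}) s :
  (forall U, measurable U -> measurable_fun setT (k ^~ U)) ->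
  (forall z, g z = \sum_(r <- s) Num.max r 0 * \1_(g @^-1` [set r]) z) ->
  (\int[mu]_(y in D) \int[k y]_z (g z)%:E =
   \sum_(r <- s) (Num.max r 0)%:E * \int[mu]_(y in D) k y (g @^-1` [set r]))%E.
Proof.
move=> mk gs.
have m0 (r : R) : 0 <= Num.max r 0 by rewrite le_max lexx orbT.
have mg r : measurable (g @^-1` [set r]).
  by rewrite -[X in measurable X]setTI; exact: measurable_funP.
transitivity (\int[mu]_(y in D) (\sum_(r <- s) (Num.max r 0)%:E * k y (g @^-1` [set r])))%E.
  apply: eq_integral => y _.
  under eq_integral do rewrite gs -sumEFin.
  rewrite ge0_integral_sum //; last 2 first.
  - by move=> r; apply/measurable_EFinP/measurable_funM => //; exact: measurable_cst.
  - by move=> r z _; rewrite lee_fin mulr_ge0.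
  apply: eq_bigr => r _; under eq_integral do rewrite EFinM.
  rewrite ge0_integralZl_EFin //; first by rewrite integral_indic // setIT.
  exact/measurable_EFinP.
rewrite ge0_integral_sum //; last 2 first.
- by move=> r; apply: measurable_funeM; apply: measurable_funTS; exact: mk.
- by move=> r y _; rewrite mule_ge0 // lee_fin.
apply: eq_bigr => r _; rewrite ge0_integralZl_EFin //.
by apply: measurable_funTS; exact: mk.
Qed.

Lemma integral_kernel_lim (k : Y -> {measure set Z -> \bar R}) (f : Z -> \bar R)
    (mf : measurable_fun setT f) : (forall z, 0 <= f z)%E ->
  (forall U, measurable U -> measurable_fun setT (k ^~ U)) ->
  (\int[mu]_(y in D) \int[k y]_z f z =
   limn (fun n => \int[mu]_(y in D) \int[k y]_z (nnsfun_approx measurableT mf n z)%:E))%E.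
Proof.
move=> f0 mk; pose f_ := nnsfun_approx measurableT mf.
transitivity (\int[mu]_(y in D) limn (fun n => \int[k y]_z (f_ n z)%:E))%E.
  apply: eq_integral => y _; rewrite -monotone_convergence //; last 3 first.
  - by move=> n; exact/measurable_EFinP.
  - by move=> n z _; rewrite lee_fin.
  - by move=> z _ a b ab; rewrite lee_fin; exact/lefP/nd_nnsfun_approx.
  by apply: eq_integral => z _; apply/esym/cvg_lim => //; exact: cvg_nnsfun_approx.
rewrite monotone_convergence //.
- move=> n; apply: measurable_funTS; apply: measurable_fun_integral_kernel => //.
  + by move=> z; rewrite lee_fin.
  + exact/measurable_EFinP.
- by move=> n y _; apply: integral_ge0 => // z _; rewrite lee_fin.
- move=> y _ a b ab; apply: ge0_le_integral => //.
  + by move=> z _; rewrite lee_fin.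
  + exact/measurable_EFinP.
  + exact/measurable_EFinP.
  + by move=> z _; rewrite lee_fin; exact/lefP/nd_nnsfun_approx.
Qed.

(** Approximating the inner integrand by simple functions extends the identity from sets to
    functions. It is applied with the Dirac mass at the next state and holding time against [Q] at
    the current state, which upgrades the defining property of [MRchain]. *)
Lemma eq_kernel_integral (k1 k2 : Y -> {measure set Z -> \bar R}) (f : Z -> \bar R) :
  (forall U, measurable U -> measurable_fun setT (k1 ^~ U)) ->
  (forall U, measurable U -> measurable_fun setT (k2 ^~ U)) ->
  (forall U, measurable U ->
    \int[mu]_(y in D) k1 y U = \int[mu]_(y in D) k2 y U)%E ->
  (forall z, 0 <= f z)%E -> measurable_fun setT f ->
  (\int[mu]_(y in D) \int[k1 y]_z f z = \int[mu]_(y in D) \int[k2 y]_z f z)%E.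
Proof.
move=> mk1 mk2 kE f0 mf; rewrite (integral_kernel_lim mf f0 mk1) (integral_kernel_lim mf f0 mk2).
congr (limn _); apply/funext => n; have [s gs] := nnsfun_seq (nnsfun_approx measurableT mf n).
rewrite (integral_kernel_nnsfun mk1 gs) (integral_kernel_nnsfun mk2 gs).
by apply: eq_bigr => r _; rewrite kE.
Qed.

End KernelIntegral.

(** * Paths before the exit *)

Section Path.
Context {R : realType} {dS : measure_display} {S : measurableType dS} {M : nat}.
Context {dO : measure_display} {O : measurableType dO}.
Variables (cls : S -> 'I_M) (Q : R.-pker S ~> (S * R)%type) (P : probability O R).
Variables (x : S) (X : nat -> O -> S) (T : nat -> O -> R) (A : {pred 'I_M}).
Hypotheses (cls_meas : forall i, measurable (Si cls i)) (MR : MRchain P Q x X T)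
  (xA : cls x \in A).

Local Notation Z n := (fun w => (X n w, T n w)).
Local Notation histn := (hist X T).

Let mX n : measurable_fun setT (X n). Proof. by case: MR => /(_ n). Qed.
Let mT n : measurable_fun setT (T n). Proof. by case: MR => _ /(_ n). Qed.
Hint Resolve mX mT : core.

(** The generators inside [hist], named so that the history up to [n] can serve as a measurable type
    of its own. *)
Definition hist_gen n : set (set O) := [set G | exists m, (m <= n)%N /\
  ((exists B : set S, measurable B /\ G = X m @^-1` B) \/
   (exists C : set R, measurable C /\ G = T m @^-1` C))].

Lemma hist_measurable n G : histn n G -> measurable G.
Proof.
apply: smallest_sub; first exact: sigma_algebra_measurable.
by move=> _ [m [_ [[B [mB ->]]|[C [mC ->]]]]]; rewrite -[X in measurable X]setTI;
  [exact: mX|exact: mT].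
Qed.

Lemma hist_mono n m G : (n <= m)%N -> histn n G -> histn m G.
Proof.
move=> nm; apply: sub_sigma_algebra2 => F [k [kn H]]; exists k; split => //.
exact: leq_trans nm.
Qed.

Lemma histI n G H : histn n G -> histn n H -> histn n (G `&` H).
Proof. exact: (@measurableI _ (g_sigma_algebraType (hist_gen n))). Qed.

Lemma histC n G : histn n G -> histn n (~` G).
Proof. exact: (@measurableC _ (g_sigma_algebraType (hist_gen n))). Qed.

Lemma histT n : histn n setT.
Proof. exact: (@measurableT _ (g_sigma_algebraType (hist_gen n))). Qed.

Lemma histX n m B : (m <= n)%N -> measurable B -> histn n (X m @^-1` B).
Proof. by move=> mn mB; apply: sub_sigma_algebra; exists m; split => //; left; exists B. Qed.

(* Holding times are nonnegative only almost surely; their positive parts make [Sp] monotone along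
   every path. *)
Definition Tp k w : R := Num.max (T k w) 0.
Definition Sp n w : R := \sum_(1 <= k < n.+1) Tp k w.

Lemma Tp_ge0 k w : 0 <= Tp k w. Proof. by rewrite le_max lexx orbT. Qed.

Lemma SpS n w : Sp n.+1 w = Sp n w + Tp n.+1 w.
Proof. by rewrite /Sp big_nat_recr. Qed.

Lemma Sp0 w : Sp 0 w = 0. Proof. by rewrite /Sp big_geq. Qed.

Lemma Sp_mono n m w : (n <= m)%N -> Sp n w <= Sp m w.
Proof.
move=> nm; rewrite -(subnKC nm); elim: (m - n)%N => [|k IH]; first by rewrite addn0.
by rewrite addnS SpS (le_trans IH) // lerDl Tp_ge0.
Qed.

Lemma hist_Sp n m s : (m <= n)%N -> histn n [set w | s <= Sp m w].
Proof.
move=> mn.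
have mTp k : (k <= n)%N ->
    measurable_fun setT (Tp k : g_sigma_algebraType (hist_gen n) -> R).
  move=> kn; apply: measurable_maxr; last exact: measurable_cst.
  move=> _ C mC; rewrite setTI; apply: sub_sigma_algebra; exists k; split => //.
  by right; exists C.
have mSp : measurable_fun setT (Sp m : g_sigma_algebraType (hist_gen n) -> R).
  elim: m mn => [_|m IH mn].
    by rewrite (_ : Sp 0 = cst 0); [exact: measurable_cst|apply/funext => w; rewrite Sp0].
  rewrite (_ : Sp m.+1 = Sp m \+ Tp m.+1); last by apply/funext => w; rewrite SpS.
  by apply: measurable_funD; [exact: IH (ltnW mn)|exact: mTp].
have mI : measurable [set y : R | s <= y] by rewrite -set_itvcy; exact: measurable_itv.
by have := mSp measurableT _ mI; rewrite setTI.
Qed.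

Definition alive n : set O := [set w | forall m, (m <= n)%N -> cls (X m w) \in A].
Definition at_ n (L : {pred 'I_M}) : set O := [set w | cls (X n w) \in L].

Lemma hist_at n m L : (m <= n)%N -> histn n (at_ m L).
Proof. by move=> mn; apply: (@histX n m [set y | cls y \in L]) => //; exact: measurable_cls. Qed.

Lemma aliveS n : alive n.+1 = alive n `&` at_ n.+1 A.
Proof.
apply/seteqP; split => w; first by move=> H; split => [m mn|]; apply: H => //; exact: leqW.
by move=> [H1 H2] m; rewrite leq_eqVlt => /predU1P[-> //|]; rewrite ltnS; exact: H1.
Qed.

Lemma X0 w : X 0%N w = x. Proof. by case: MR => _ _ /(_ w)[]. Qed.

Lemma alive0 : alive 0 = setT.
Proof. by apply/seteqP; split => // w _ m; rewrite leqn0 => /eqP ->; rewrite X0. Qed.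

Lemma hist_alive n : histn n (alive n).
Proof.
elim: n => [|n IH]; first by rewrite alive0; exact: histT.
by rewrite aliveS; apply: histI; [exact: hist_mono IH|exact: hist_at].
Qed.

Lemma alive_sub n m : (n <= m)%N -> alive m `<=` alive n.
Proof. by move=> nm w H k kn; apply: H; exact: leq_trans nm. Qed.

Lemma mZ n : measurable_fun setT (Z n).
Proof. exact: measurable_fun_pair. Qed.

Lemma one_step n F (f : S * R -> \bar R) : histn n F -> (forall z, 0 <= f z)%E ->
  measurable_fun setT f ->
  (\int[P]_(w in F) f (X n.+1 w, T n.+1 w) = \int[P]_(w in F) \int[Q (X n w)]_z f z)%E.
Proof.
move=> hF f0 mf; have mF := hist_measurable hF.
have mdir U : measurable U -> measurable_fun setT (fun w => \d_(X n.+1 w, T n.+1 w) U : \bar R).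
  move=> mU; apply/measurable_EFinP.
  have mI : measurable_fun setT (\1_U : S * R -> R) by exact: measurable_indic.
  exact: (measurableT_comp mI (mZ n.+1)).
have mQ U : measurable U -> measurable_fun setT (fun w => Q (X n w) U).
  by move=> mU; exact: (measurableT_comp (measurable_kernel Q U mU) (mX n)).
transitivity (\int[P]_(w in F) \int[\d_(X n.+1 w, T n.+1 w)]_z f z)%E.
  apply: eq_integral => w _; rewrite integral_dirac // diracT mul1e //.
apply: (eq_kernel_integral mF mdir mQ) => // U mU.
case: MR => _ _ _ /(_ n F hF U mU) <-; rewrite setIC -integral_indic //.
rewrite -[X in measurable X]setTI; exact: mZ.
Qed.

Lemma one_step_lands n F L (f : S * R -> \bar R) : histn n F -> (forall z, 0 <= f z)%E ->
  measurable_fun setT f ->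
  (\int[P]_(w in F `&` at_ n.+1 L) f (X n.+1 w, T n.+1 w) =
   \int[P]_(w in F) \int[Q (X n w)]_(z in lands cls L) f z)%E.
Proof.
move=> hF f0 mf; rewrite integral_mkcondr.
have mL := @measurable_lands R _ _ _ _ cls_meas L.
transitivity (\int[P]_(w in F) \int[Q (X n w)]_z (f \_ (lands cls L)) z)%E; last first.
  by apply: eq_integral => w _; rewrite -integral_mkcond.
have mfL : measurable_fun setT (f \_ (lands cls L)).
  by apply/(measurable_restrictT _ _).1 => //; exact: measurable_funTS.
have fL0 z : (0 <= (f \_ (lands cls L)) z)%E by exact: erestrict_ge0.
rewrite -(one_step hF fL0 mfL); apply: eq_integral => w _; rewrite !patchE.
by rewrite (_ : (w \in at_ n.+1 L) = ((X n.+1 w, T n.+1 w) \in lands cls L)) //; apply/idP/idP; rewrite !inE.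
Qed.

(** [visit_cost] unfolds from its starting point, so the induction on [k] advances the conditioning
    index [n]; [F] stays in the growing history. *)
Lemma alive_visit_cost (c : S -> \bar R) k n F : (forall y, 0 <= c y)%E ->
  measurable_fun setT c -> histn n F ->
  (\int[P]_(w in F `&` alive n) visit_cost cls Q A c k (X n w) =
   \int[P]_(w in F `&` alive (n + k)) c (X (n + k)%N w))%E.
Proof.
move=> c0 mc; elim: k n F => [n F _|k IH n F hF]; first by rewrite addn0.
rewrite /= /step_in -addSnnS.
have hFn : histn n (F `&` alive n) by apply: histI => //; exact: hist_alive.
rewrite -(one_step_lands A hFn (f := fun z => visit_cost cls Q A c k z.1)) /=.
- by rewrite -setIA -aliveS IH //; apply: hist_mono hF.
- by move=> z; exact: visit_cost_ge0.
- by apply: measurable_fst_comp; exact: measurable_visit_cost.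
Qed.

Lemma alive_green (c : S -> \bar R) n F : (forall y, 0 <= c y)%E ->
  measurable_fun setT c -> histn n F ->
  (\int[P]_(w in F `&` alive n) green cls Q A c (X n w) =
   \sum_(k <oo) \int[P]_(w in F `&` alive (n + k)) c (X (n + k)%N w))%E.
Proof.
move=> c0 mc hF; have mF : measurable (F `&` alive n).
  by apply: (@hist_measurable n); apply: histI => //; exact: hist_alive.
rewrite /green integral_nneseries //.
- by apply: eq_eseriesr => k _; exact: alive_visit_cost.
- move=> k; apply: measurable_funTS.
  exact: (measurableT_comp (measurable_visit_cost Q cls_meas A c0 mc k) (mX n)).
- by move=> k w _; exact: visit_cost_ge0.
Qed.

Lemma measure_disjoint_bigcup (F : nat -> set O) : (forall n, measurable (F n)) ->
  trivIset setT F -> P (\bigcup_n F n) = (\sum_(n <oo) P (F n))%E.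
Proof. by move=> mF tF; rewrite measure_semi_bigcup //; exact: bigcupT_measurable. Qed.

Section Exit.
Variable L : {pred 'I_M}.
Hypothesis LA : forall j, j \in L -> j \notin A.

(** Indexed by the last step inside [A]; the landing in [L] is at step [n.+1]. *)
Definition exits n : set O := alive n `&` at_ n.+1 L.
Definition exit_ : set O := \bigcup_n exits n.

Lemma hist_exits n : histn n.+1 (exits n).
Proof. by rewrite /exits; apply: histI; [exact: (hist_mono (leqnSn n) (@hist_alive n))|exact: hist_at]. Qed.

Lemma exits_disjoint n m w : exits n w -> exits m w -> n = m.
Proof.
wlog nm : n m / (n <= m)%N.
  by move=> H; have [/H|/ltnW /H h a b] := leqP n m; [exact|exact/esym/h].
move: nm; rewrite leq_eqVlt => /predU1P[//|nm] [_ /LA /negP Ln] [/(_ _ nm)].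
by [].
Qed.

Lemma exits_prob n F : histn n F -> F `<=` alive n ->
  P (F `&` exits n) = (\int[P]_(w in F) Q (X n w) (lands cls L))%E.
Proof.
move=> hF Fn; have mF := hist_measurable hF.
have -> : F `&` exits n = F `&` at_ n.+1 L.
  by apply/seteqP; split => w [Fw]; [move=> []|move=> ?; split => //; split => //; exact: Fn].
have m1 : measurable (F `&` at_ n.+1 L).
  by apply: measurableI => //; apply: (@hist_measurable n.+1); exact: hist_at.
rewrite -[LHS]mul1e -integral_cst //.
rewrite (one_step_lands L hF (f := cst 1%E)) //.
by apply: eq_integral => w _; rewrite integral_cst ?mul1e //; exact: measurable_lands.
Qed.

(** The Markov property at the fixed index [n]. On [F] no exit has occurred, so all exits have index
    [n + k], and their disjoint union matches the series of [Kexit] term by term. *)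
Lemma exit_prob n F : histn n F -> F `<=` alive n ->
  P (F `&` exit_) = (\int[P]_(w in F) Kexit cls Q A L (X n w))%E.
Proof.
move=> hF Fn.
have FnE k : F `&` exits (n + k) = (F `&` alive (n + k)) `&` exits (n + k).
  by rewrite -setIA; congr (_ `&` _); rewrite /exits setIA setIid.
have -> : F `&` exit_ = \bigcup_k (F `&` exits (n + k)%N).
  apply/seteqP; split => w.
    move=> [Fw [m _ wm]]; have [nm|mn] := leqP n m.
      by exists (m - n)%N => //; rewrite subnKC.
    have := Fn w Fw m.+1 mn; case: wm => _ /LA /negP; by [].
  by move=> [k _ [Fw wk]]; split => //; exists (n + k)%N.
have hk k : histn (n + k) (F `&` alive (n + k)).
  by apply: histI (@hist_alive _); apply: (hist_mono _ hF); exact: leq_addr.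
rewrite measure_disjoint_bigcup //; last 2 first.
- move=> k; rewrite FnE; apply: measurableI; first exact: (hist_measurable (hk k)).
  exact: (hist_measurable (@hist_exits _)).
- move=> i j _ _ [w [[_ wi] [_ wj]]]; apply/(@addnI n).
  exact: exits_disjoint wi wj.
have FE : F = F `&` alive n by apply/esym/setIidPl.
rewrite [in RHS]FE alive_green //; last exact: measurable_cost.
by apply: eq_eseriesr => k _; rewrite FnE exits_prob // => w [].
Qed.
End Exit.

Definition past s n : set O := [set w | s <= Sp n w].
(** Splits [reach s] by the index at which the elapsed time first attains [s]. Each piece belongs to
    the history of its index, which reduces conditioning at the passage time to fixed indices. At
    index 0 there is nothing earlier to exclude. *)
Definition first s n : set O :=
  alive n `&` past s n `&` (if n is n'.+1 then ~` past s n' else setT).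
(* The last jump before the exit occurs at time [s] or later. *)
Definition reach s : set O := \bigcup_n (alive n `&` past s n).

Lemma hist_past s n m : (m <= n)%N -> histn n (past s m).
Proof. exact: hist_Sp. Qed.

Lemma hist_first s n : histn n (first s n).
Proof.
rewrite /first; apply: histI; first by apply: histI; [exact: @hist_alive|exact: hist_past].
by case: n => [|n]; [exact: histT|apply: histC; exact: hist_past].
Qed.

Lemma first_alive s n : first s n `<=` alive n.
Proof. by move=> w [[]]. Qed.

Lemma first_lt s n m w : first s n w -> (m < n)%N -> Sp m w < s.
Proof.
case: n => // n [_ /= /negP]; rewrite -ltNge => H mn.
by apply: le_lt_trans H; exact: Sp_mono.
Qed.

Lemma first_trivIset s : trivIset setT (first s).
Proof.
move=> i j _ _ [w [wi wj]].
wlog ij : i j wi wj / (i <= j)%N.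
  by move=> H; have [/H|/ltnW /H h] := leqP i j; [exact|exact/esym/h].
move: ij; rewrite leq_eqVlt => /predU1P[//|ij].
by have := first_lt wj ij; case: wi => -[_]; rewrite /past /= leNgt => /negP.
Qed.

Lemma reach_first s : reach s = \bigcup_n first s n.
Proof.
apply/seteqP; split => w [n _ H]; last by exists n => //; case: H.
elim: n H => [|n IH] [al pa]; first by exists 0%N.
have [p'|p'] := pselect (past s n w); last by exists n.+1.
by apply: IH; split => //; apply: alive_sub al.
Qed.

Lemma measurable_first s n : measurable (first s n).
Proof. exact: (hist_measurable (@hist_first s n)). Qed.

Lemma measurable_reach s : measurable (reach s).
Proof. by rewrite reach_first; apply: bigcupT_measurable => n; exact: measurable_first. Qed.

Lemma measurable_alive n : measurable (alive n).
Proof. exact: (hist_measurable (@hist_alive n)). Qed.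

Lemma measurable_past s n : measurable (past s n).
Proof. exact: (hist_measurable (@hist_past s n n (leqnn n))). Qed.

Lemma reach_le0 s : s <= 0 -> reach s = setT.
Proof.
by move=> s0; apply/seteqP; split => // w _; exists 0%N => //; rewrite alive0; split => //=; rewrite /past /= Sp0.
Qed.

Lemma reach_prob s : P (reach s) = (\sum_(n <oo) P (first s n))%E.
Proof.
rewrite reach_first measure_disjoint_bigcup //; last exact: first_trivIset.
by move=> n; exact: measurable_first.
Qed.

Lemma reach_integral s (f : S -> \bar R) (a b : R) : measurable_fun setT f ->
  (forall y, 0 <= f y)%E -> 0 <= a -> 0 <= b ->
  (forall y, cls y \in A -> a%:E <= f y <= b%:E)%E ->
  (a%:E * P (reach s) <= \sum_(n <oo) \int[P]_(w in first s n) f (X n w)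
    <= b%:E * P (reach s))%E.
Proof.
move=> mf f0 a0 b0 H; rewrite reach_prob -!nneseriesZl //.
have mfX n : measurable_fun (first s n) (fun w => f (X n w)).
  by apply: measurable_funTS; exact: (measurableT_comp mf (mX n)).
have fA n w : first s n w -> cls (X n w) \in A by move=> /first_alive /(_ n (leqnn n)).
apply/andP; split; apply: lee_nneseries => [n _ _|n _].
- by rewrite mule_ge0.
- rewrite -integral_cst; last exact: measurable_first.
  apply: ge0_le_integral => //; first exact: measurable_first.
  by move=> w /fA /H /andP[].
- by apply: integral_ge0.
- rewrite -integral_cst; last exact: measurable_first.
  apply: ge0_le_integral => //; first exact: measurable_first.
  by move=> w /fA /H /andP[].
Qed.

Lemma integral_prob_cst (c : \bar R) : (\int[P]_w c = c)%E.
Proof.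
have -> : (\int[P]_w c = c * P setT)%E by exact: integral_cst.
by rewrite probability_setT mule1.
Qed.

Section ExitTime.
Variable L : {pred 'I_M}.
Hypothesis LA : forall j, j \in L -> j \notin A.

(** The elapsed time is taken at [m.+1] and so includes the final holding time, unlike in
    [reach]. *)
Definition exit_after s : set O := \bigcup_m (exits L m `&` past s m.+1).

Lemma measurable_exits m : measurable (exits L m).
Proof. exact: (hist_measurable (@hist_exits L m)). Qed.

Lemma measurable_exit : measurable (exit_ L).
Proof. by apply: bigcupT_measurable => m; exact: measurable_exits. Qed.

Lemma measurable_exit_after s : measurable (exit_after s).
Proof.
by apply: bigcupT_measurable => m; apply: measurableI; [exact: measurable_exits|exact: measurable_past].
Qed.

Lemma exit_total_prob : P (exit_ L) = Kexit cls Q A L x.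
Proof.
have := exit_prob LA (@histT 0) (F := setT); rewrite alive0 setTI => -> //.
by under eq_integral do rewrite X0; rewrite integral_prob_cst.
Qed.

Lemma reach_exit s : P (reach s `&` exit_ L) =
  (\sum_(n <oo) \int[P]_(w in first s n) Kexit cls Q A L (X n w))%E.
Proof.
rewrite reach_first setI_bigcupl measure_disjoint_bigcup.
- by apply: eq_eseriesr => n _; apply: exit_prob => //; [exact: hist_first|exact: first_alive].
- by move=> n; apply: measurableI; [exact: measurable_first|exact: measurable_exit].
- by move=> i j _ _ [w [[wi _] [wj _]]]; apply: (@first_trivIset s); rewrite // ; exists w.
Qed.

Lemma occupation (c : S -> \bar R) : (forall y, 0 <= c y)%E -> measurable_fun setT c ->
  (\sum_(m <oo) \int[P]_(w in alive m) c (X m w) = green cls Q A c x)%E.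
Proof.
move=> c0 mc; have := alive_green c0 mc (@histT 0).
rewrite alive0 setTI; under eq_integral do rewrite X0.
rewrite integral_prob_cst => ->.
by apply: eq_eseriesr => m _; rewrite add0n setTI.
Qed.

Definition late h : set O := \bigcup_m (exits L m `&` [set w | h <= Tp m.+1 w]).

Lemma measurable_Tp k : measurable_fun setT (Tp k).
Proof. by apply: measurable_maxr => //; exact: measurable_cst. Qed.

Lemma measurable_late1 h k : measurable [set w | h <= Tp k w].
Proof.
have mI : measurable [set y : R | h <= y] by rewrite -set_itvcy; exact: measurable_itv.
by have := measurable_Tp k measurableT mI; rewrite setTI.
Qed.

(** Markov's inequality for the final holding time at each exit index, summed over the index by the
    occupation formula. *)
Lemma late_prob (tau : 'I_M -> R) (ka h : R) : 0 < h -> 0 <= ka -> (forall i, 0 <= tau i) ->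
  (forall y, cls y \in A -> hold cls Q L y <= (ka * tau (cls y))%:E)%E ->
  (P (late h) <= (ka / h)%:E * green cls Q A (fun y => (tau (cls y))%:E) x)%E.
Proof.
move=> h0 ka0 tau0 H.
have hk0 : 0 <= h^-1 by rewrite invr_ge0 ltW.
have mex m : measurable (exits L m `&` [set w | h <= Tp m.+1 w]).
  by apply: measurableI; [exact: measurable_exits|exact: measurable_late1].
have mtau : measurable_fun setT (fun y => (tau (cls y))%:E) by exact: measurable_label.
have t0 y : (0 <= (tau (cls y))%:E)%E by rewrite lee_fin.
rewrite measure_disjoint_bigcup //; last first.
  by move=> i j _ _ [w [[wi _] [wj _]]]; exact: (exits_disjoint LA wi wj).
rewrite -occupation // -nneseriesZl; last by move=> m _; exact: integral_ge0.
apply: lee_nneseries => // m _.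
pose f (z : S * R) := (h^-1%:E * (Num.max z.2 0)%:E)%E.
have f0 z : (0 <= f z)%E by rewrite mule_ge0 ?lee_fin // le_max lexx orbT.
have mf : measurable_fun setT f by apply: measurable_funeM; exact: measurable_time.
have mfZ D : measurable_fun D (fun w => f (X m.+1 w, T m.+1 w)).
  by apply: measurable_funTS; exact: (measurableT_comp mf (mZ m.+1)).
apply: le_trans (_ : \int[P]_(w in exits L m) f (X m.+1 w, T m.+1 w) <= _)%E.
  rewrite -[leLHS]mul1e -integral_cst //.
  set Em := exits L m `&` _; have mEm : measurable Em by exact: mex.
  apply: le_trans (_ : \int[P]_(w in Em) f (X m.+1 w, T m.+1 w) <= _)%E.
    apply: ge0_le_integral => // w [_ /= hT]; rewrite /f -EFinM lee_fin mulrC.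
    by rewrite ler_pdivlMr // mul1r.
  by apply: ge0_subset_integral => //; [exact: measurable_exits|exact: subIsetl].
rewrite /exits (one_step_lands L (@hist_alive m) f0 mf).
have mal := measurable_alive m.
rewrite -ge0_integralZl_EFin //; last 2 first.
- by apply: measurable_funTS; exact: (measurableT_comp mtau (mX m)).
- by rewrite divr_ge0 // ltW.
apply: ge0_le_integral => //.
- by move=> w _; exact: integral_ge0.
- apply: measurable_funTS.
  have mh := measurable_kernel_integral Q (measurable_lands cls_meas L) f0 mf.
  exact: (measurableT_comp mh (mX m)).
- apply: measurable_funeM; apply: measurable_funTS; exact: (measurableT_comp mtau (mX m)).
- move=> w wa; rewrite /f ge0_integralZl_EFin //; last 3 first.
  + exact: measurable_lands.
  + by move=> z _; exact: time_ge0.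
  + exact: measurable_time.
  apply: le_trans (lee_wpmul2l _ (H _ (wa m (leqnn m)))) _; first by rewrite lee_fin.
  by rewrite -!EFinM lee_fin mulrA [h^-1 * ka]mulrC.
Qed.

Lemma exit_after_lower s : reach s `&` exit_ L `<=` exit_after s.
Proof.
move=> w [[n _ [al pa]] [m _ ex]]; exists m => //; split => //.
apply: le_trans pa _; apply: Sp_mono; rewrite leqNgt; apply/negP => mn.
by case: ex => _ /LA /negP; apply; exact: (al _ (ltnW mn)).
Qed.

Lemma exit_after_upper s h : exit_after (s + h) `<=` (reach s `&` exit_ L) `|` late h.
Proof.
move=> w [m _ [ex]]; rewrite /past /= SpS => sh.
have [hT|hT] := leP h (Tp m.+1 w); first by right; exists m.
left; split; last by exists m.
by exists m => //; split; [case: ex|rewrite /past /=; lra].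
Qed.

End ExitTime.

Definition overshoot s n w : R := Num.max (Sp n.+1 w - s) 0 - Num.max (Sp n w - s) 0.
(* Telescoping: the partial sums of [excess s] are [(Y - s)^+], with [Y] the time of the last jump
   that stays in [A]. *)
Definition excess_term s n : O -> \bar R := (fun w => (overshoot s n w)%:E) \_ (alive n.+1).
Definition excess s w : \bar R := (\sum_(n <oo) excess_term s n w)%E.

Lemma overshoot_ge0 s n w : 0 <= overshoot s n w.
Proof.
rewrite subr_ge0 ge_max !le_max lexx orbT andbT; apply/orP; left.
by rewrite lerD2r SpS lerDl Tp_ge0.
Qed.

Lemma overshoot_past s n w : s <= Sp n w -> overshoot s n w = Tp n.+1 w.
Proof.
move=> sn; have := Tp_ge0 n.+1 w; rewrite /overshoot SpS => t0.
rewrite !max_l; lra.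
Qed.

(** A step starting before [s - h] can pass [s] only if its length [t] exceeds [h], and then
    [t <= t ^+ 2 / h]. This is where second moments enter. *)
Lemma overshoot_le s n w h : 0 < h -> overshoot s n w <=
  (if s - h <= Sp n w then Tp n.+1 w else 0) + h^-1 * Tp n.+1 w ^+ 2.
Proof.
move=> h0; have := Tp_ge0 n.+1 w; rewrite /overshoot SpS.
set t := Tp n.+1 w => t0; have h2 : 0 <= h^-1 * t ^+ 2.
  by rewrite mulr_ge0 ?sqr_ge0 // invr_ge0 ltW.
case: ifPn => [_|]; last (rewrite -ltNge => sh).
  apply: le_trans (_ : t <= _); last by rewrite lerDl.
  by rewrite /Num.max; do 2 case: ifPn; rewrite -?leNgt => *; lra.
rewrite add0r [X in _ - X]max_r; last lra.
rewrite subr0 ge_max h2 andbT.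
have [th|th] := leP t h; first by apply: le_trans h2; lra.
apply: le_trans (_ : t <= _); first lra.
by rewrite expr2 mulrA ler_peMl // mulrC ler_pdivlMr // mul1r ltW.
Qed.

Lemma excess_term_ge0 s n w : (0 <= excess_term s n w)%E.
Proof. by apply: erestrict_ge0 => v; rewrite lee_fin overshoot_ge0. Qed.
Hint Resolve excess_term_ge0 : core.

Lemma excess_ge0 s w : (0 <= excess s w)%E.
Proof. exact: nneseries_ge0. Qed.

Lemma measurable_Sp n : measurable_fun setT (Sp n).
Proof.
elim: n => [|n IH].
  by rewrite (_ : Sp 0 = cst 0); [exact: measurable_cst|apply/funext => w; rewrite Sp0].
rewrite (_ : Sp n.+1 = Sp n \+ Tp n.+1); last by apply/funext => w; rewrite SpS.
by apply: measurable_funD => //; exact: measurable_Tp.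
Qed.

Lemma measurable_overshoot s n D : measurable_fun D (fun w => (overshoot s n w)%:E).
Proof.
have mm k : measurable_fun setT (fun w => Num.max (Sp k w - s) 0).
  apply: measurable_maxr; last exact: measurable_cst.
  by apply: measurable_funB; [exact: measurable_Sp|exact: measurable_cst].
by apply: measurable_funTS; apply/measurable_EFinP; apply: measurable_funB.
Qed.

Lemma measurable_excess_term s n : measurable_fun setT (excess_term s n).
Proof.
apply/(measurable_restrictT _ _).1; first exact: measurable_alive.
exact: measurable_overshoot.
Qed.
Hint Resolve measurable_excess_term : core.

Lemma measurable_excess s : measurable_fun setT (excess s).
Proof. exact: ge0_emeasurable_sum. Qed.

Definition is_last_alive N w k :=
  [/\ (k <= N)%N, alive k w & forall j, (j <= N)%N -> alive j w -> (j <= k)%N].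

Lemma last_aliveP N w : exists k, is_last_alive N w k.
Proof.
elim: N => [|N [k [kN ak kmax]]].
  by exists 0%N; split => //; rewrite alive0.
have [a|na] := pselect (alive N.+1 w); first by exists N.+1.
exists k; split => //; first exact: leqW.
by move=> j; rewrite leq_eqVlt => /predU1P[-> //|]; rewrite ltnS; exact: kmax.
Qed.

Lemma excess_partial s N w k : 0 <= s -> is_last_alive N w k ->
  (\sum_(0 <= n < N) excess_term s n w = (Num.max (Sp k w - s) 0)%:E)%E.
Proof.
move=> s0; elim: N k => [|N IH] k [kN ak kmax].
  move: kN; rewrite leqn0 => /eqP ->; rewrite big_geq // Sp0 max_r //; lra.
rewrite big_nat_recr //=; move: kN; rewrite leq_eqVlt => /predU1P[kE|kN].
  rewrite (IH N); last first.
    by split => //; apply: alive_sub ak; rewrite kE.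
  rewrite /excess_term patchT ?inE -?kE // -EFinD kE; congr (_%:E).
  by rewrite /overshoot addrC subrK.
rewrite (IH k); last first.
  by split=> // j jN; apply: kmax; exact: leqW.
rewrite /excess_term patchN ?adde0 // notin_setE => a.
by have := kmax N.+1 (leqnn _) a; rewrite leqNgt kN.
Qed.

Lemma excess_lim_le s w (y : \bar R) : (exists N0, forall N, (N0 <= N)%N ->
    (\sum_(0 <= n < N) excess_term s n w <= y)%E) -> (excess s w <= y)%E.
Proof.
move=> [N0 H]; apply: lime_le; first exact: is_cvg_nneseries.
by exists N0.
Qed.

(** As [s] grows by [h], the positive part of [Y - s] falls by at most [h], and only on [reach s].
    Together with the reverse bound this is the difference form of the tail being minus the
    derivative of the mean excess. *)
Lemma excess_decrease_le s h w : 0 <= s -> 0 <= h ->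
  (excess s w <= excess (s + h) w + (h * \1_(reach s) w)%:E)%E.
Proof.
move=> s0 h0; apply: excess_lim_le; exists 0%N => N _.
have [k kl] := last_aliveP N w.
have sh0 : 0 <= s + h by rewrite addr_ge0.
apply: le_trans (leeD2r _ (nneseries_lim_ge N _)); last by move=> *; exact: excess_term_ge0.
rewrite (excess_partial s0 kl) (excess_partial sh0 kl) -EFinD lee_fin.
case: kl => _ ak _.
have [sk|sk] := leP s (Sp k w).
  rewrite indicE mem_set ?mulr1; last by exists k.
  by rewrite /Num.max; do 2 case: ifPn; rewrite -?leNgt => *; lra.
rewrite [X in X <= _]max_r; last lra.
by rewrite addr_ge0 // ?le_max ?lexx ?orbT // mulr_ge0.
Qed.

Lemma excess_decrease_ge s h w : 0 <= s -> 0 <= h ->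
  (excess (s + h) w + (h * \1_(reach (s + h)) w)%:E <= excess s w)%E.
Proof.
move=> s0 h0; have sh0 : 0 <= s + h by rewrite addr_ge0.
rewrite -leeBrDr //; apply: excess_lim_le.
have [[j _ [aj pj]]|nr] := pselect (reach (s + h) w).
  (* Only partial sums up to an index at least [j] are certain to reflect the event
     [reach (s + h)]. *)
  exists j => N jN; have [k kl] := last_aliveP N w; rewrite leeBrDr //.
  apply: le_trans (nneseries_lim_ge N _); last by move=> *; exact: excess_term_ge0.
  rewrite (excess_partial s0 kl) (excess_partial sh0 kl) -EFinD lee_fin.
  case: kl => _ ak kmax.
  have : s + h <= Sp k w by apply: le_trans pj _; apply: Sp_mono; exact: kmax.
  move=> shk; rewrite indicE mem_set ?mulr1; last by exists j.
  rewrite !max_l; lra.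
exists 0%N => N _; have [k kl] := last_aliveP N w; rewrite leeBrDr //.
apply: le_trans (nneseries_lim_ge N _); last by move=> *; exact: excess_term_ge0.
rewrite (excess_partial s0 kl) (excess_partial sh0 kl) -EFinD lee_fin.
rewrite indicE memNset // mulr0 addr0.
by rewrite /Num.max; do 2 case: ifPn; rewrite -?leNgt => *; lra.
Qed.

Lemma integral_indic_reach s h : 0 <= h ->
  (\int[P]_w (h * \1_(reach s) w)%:E = h%:E * P (reach s))%E.
Proof.
move=> h0; have mr := measurable_reach s.
under eq_integral do rewrite EFinM.
rewrite ge0_integralZl_EFin //; first by rewrite integral_indic // setIT.
by apply/measurable_EFinP; exact: measurable_indic.
Qed.

Lemma measurable_indic_reach s h : measurable_fun setT (fun w => (h * \1_(reach s) w)%:E : \bar R).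
Proof.
apply/measurable_EFinP; apply: measurable_funM; first exact: measurable_cst.
by apply: measurable_indic; exact: measurable_reach.
Qed.

Lemma mean_excess_le s h : 0 <= s -> 0 <= h ->
  (\int[P]_w excess s w <= \int[P]_w excess (s + h) w + h%:E * P (reach s))%E.
Proof.
move=> s0 h0; rewrite -integral_indic_reach // -ge0_integralD //.
- apply: ge0_le_integral => //.
  + by move=> w _; exact: excess_ge0.
  + exact: measurable_excess.
  + by apply: emeasurable_funD; [exact: measurable_excess|exact: measurable_indic_reach].
  + by move=> w _; exact: excess_decrease_le.
- by move=> w _; exact: excess_ge0.
- exact: measurable_excess.
- by move=> w _; rewrite lee_fin mulr_ge0.
- exact: measurable_indic_reach.
Qed.

Lemma mean_excess_ge s h : 0 <= s -> 0 <= h ->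
  (\int[P]_w excess (s + h) w + h%:E * P (reach (s + h)%R) <= \int[P]_w excess s w)%E.
Proof.
move=> s0 h0; rewrite -integral_indic_reach // -ge0_integralD //.
- apply: ge0_le_integral => //.
  + by move=> w _; rewrite adde_ge0 ?excess_ge0 // lee_fin mulr_ge0.
  + by apply: emeasurable_funD; [exact: measurable_excess|exact: measurable_indic_reach].
  + exact: measurable_excess.
  + by move=> w _; exact: excess_decrease_ge.
- by move=> w _; exact: excess_ge0.
- exact: measurable_excess.
- by move=> w _; rewrite lee_fin mulr_ge0.
- exact: measurable_indic_reach.
Qed.

Lemma hist_alive_past s n : histn n (alive n `&` past s n).
Proof. by apply: histI; [exact: @hist_alive|exact: hist_past]. Qed.

Lemma measurable_alive_past s n : measurable (alive n `&` past s n).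
Proof. exact: (hist_measurable (@hist_alive_past s n)). Qed.

(** Elapsed time is monotone along a path, so after the first passage of [s] every later step is
    past [s]. The cost from the passage on is the Green function at the state occupied then. *)
Lemma occupation_past s (c : S -> \bar R) : (forall y, 0 <= c y)%E -> measurable_fun setT c ->
  (\sum_(n <oo) \int[P]_(w in alive n `&` past s n) c (X n w) =
   \sum_(n <oo) \int[P]_(w in first s n) green cls Q A c (X n w))%E.
Proof.
move=> c0 mc.
pose Wt m := (fun w => c (X m w)) \_ (alive m `&` past s m).
have mcX m D : measurable_fun D (fun w => c (X m w)).
  by apply: measurable_funTS; exact: (measurableT_comp mc (mX m)).
have Wt0 m w : (0 <= Wt m w)%E by apply: erestrict_ge0.
have mWt m : measurable_fun setT (Wt m).
  by apply/(measurable_restrictT _ _).1; [exact: measurable_alive_past|exact: mcX].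
pose W w := (\sum_(m <oo) Wt m w)%E.
have mW : measurable_fun setT W by exact: ge0_emeasurable_sum.
have W0 w : (0 <= W w)%E by exact: nneseries_ge0.
transitivity (\int[P]_w W w)%E.
  rewrite integral_nneseries //; apply: eq_eseriesr => m _.
  by rewrite -integral_mkcond.
transitivity (\int[P]_(w in reach s) W w)%E.
  rewrite [RHS]integral_mkcond; apply: eq_integral => w _; rewrite patchE.
  case: ifPn => // /negP wr; apply: eseries0 => m _ _; rewrite /Wt patchN // notin_setE => H.
  by apply: wr; rewrite inE; exists m.
rewrite reach_first (ge0_integral_bigcup P (measurable_first s) (measurable_funTS mW)
  (fun w _ => W0 w) (@first_trivIset s)).
apply: eq_eseriesr => n _.
have mf := measurable_first s n.
rewrite integral_nneseries //; last by move=> m; exact: measurable_funTS.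
have E m : (\int[P]_(w in first s n) Wt m w =
    \int[P]_(w in first s n `&` (alive m `&` past s m)) c (X m w))%E.
  by rewrite [RHS]integral_mkcondr.
under eq_eseriesr do rewrite E.
have I0 m : (0 <= \int[P]_(w in first s n `&` (alive m `&` past s m)) c (X m w))%E.
  by apply: integral_ge0 => w _; exact: c0.
rewrite (nneseries_split 0 n) // add0n big1_seq ?add0e; last first.
  move=> m /andP[_]; rewrite mem_index_iota => /andP[_ mn].
  rewrite (_ : _ `&` _ = set0) ?integral_set0 //; apply/seteqP; split => // w [wf [_ wp]].
  by have := first_lt wf mn; rewrite ltNge => /negP; apply.
rewrite -nneseries_addn //.
rewrite (_ : first s n = first s n `&` alive n); last first.
  by apply/esym/setIidPl; exact: first_alive.
rewrite alive_green //; last exact: hist_first.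
apply: eq_eseriesr => k _; rewrite addnC; congr (integral _ _ _).
apply/seteqP; split => w.
  by move=> [[wf _] [wa _]].
move=> [wf wa]; split; [split => //; exact: first_alive wf|split => //].
by case: wf => -[_ wp] _; apply: le_trans wp _; apply: Sp_mono; exact: leq_addr.
Qed.

(** After time [s] each jump inside [A] adds its full holding time to the excess. The jump that
    crosses [s] contributes a nonnegative amount and is dropped. *)
Lemma mean_excess_lower (tau : 'I_M -> R) (b : R) s : 0 <= b -> (forall i, 0 <= tau i) ->
  (forall y, cls y \in A -> (b * tau (cls y))%:E <= hold cls Q A y)%E ->
  (b%:E * \sum_(n <oo) \int[P]_(w in alive n `&` past s n) (tau (cls (X n w)))%:E
    <= \int[P]_w excess s w)%E.
Proof.
move=> b0 tau0 H.
have mtau : measurable_fun setT (fun y => (tau (cls y))%:E) by exact: measurable_label.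
have mt n D : measurable_fun D (fun w => (tau (cls (X n w)))%:E).
  by apply: measurable_funTS; exact: (measurableT_comp mtau (mX n)).
have mh : measurable_fun setT (hold cls Q A).
  apply: measurable_kernel_integral; [exact: measurable_lands|exact: time_ge0|exact: measurable_time].
have mTZ n D : measurable_fun D (fun w => (Tp n w)%:E).
  by apply: measurable_funTS; apply/measurable_EFinP; exact: measurable_Tp.
have map' n := measurable_alive_past s n.
rewrite -nneseriesZl; last by move=> n _; apply: integral_ge0 => w _; rewrite lee_fin.
rewrite integral_nneseries //; apply: lee_nneseries => [n _ _|n _].
  by rewrite mule_ge0 ?lee_fin //; apply: integral_ge0 => w _; rewrite lee_fin.
rewrite -integral_mkcond -ge0_integralZl_EFin //; last by move=> w _; rewrite lee_fin.
apply: le_trans (_ : \int[P]_(w in alive n `&` past s n) hold cls Q A (X n w) <= _)%E.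
  apply: ge0_le_integral => //.
  - by move=> w _; rewrite mule_ge0 // lee_fin.
  - exact: measurable_funeM.
  - by apply: measurable_funTS; exact: (measurableT_comp mh (mX n)).
  - by move=> w [/(_ n (leqnn n)) wA _]; rewrite -EFinM; exact: H.
rewrite /hold -(one_step_lands A (@hist_alive_past s n) (@time_ge0 R dS S)); last exact: measurable_time.
have -> : alive n `&` past s n `&` at_ n.+1 A = alive n.+1 `&` past s n.
  by rewrite aliveS -setIA (setIC (past s n)) setIA.
have m1 : measurable (alive n.+1 `&` past s n).
  by apply: measurableI; [exact: measurable_alive|exact: measurable_past].
apply: le_trans (_ : \int[P]_(w in alive n.+1 `&` past s n) (overshoot s n w)%:E <= _)%E.
  apply: ge0_le_integral => //.
  - by move=> w _; rewrite lee_fin Tp_ge0.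
  - exact: mTZ.
  - exact: measurable_overshoot.
  - by move=> w [_ wp]; rewrite lee_fin overshoot_past.
apply: ge0_subset_integral => //.
- exact: measurable_alive.
- exact: measurable_overshoot.
- by move=> w _; rewrite lee_fin overshoot_ge0.
Qed.

(** Lowering the threshold by [h] lets the first sum cover a crossing jump that starts within [h] of
    [s]. One that starts earlier is longer than [h] and is paid for by second moments over the whole
    occupation of [A]. *)
Lemma mean_excess_upper (tau : 'I_M -> R) (b ka h : R) s : 0 < h -> 0 <= b -> 0 <= ka ->
  (forall i, 0 <= tau i) ->
  (forall y, cls y \in A -> hold cls Q predT y <= (b * tau (cls y))%:E)%E ->
  (forall y, cls y \in A -> hold2 Q y <= (ka * tau (cls y))%:E)%E ->
  (\int[P]_w excess s w <=
   b%:E * \sum_(n <oo) \int[P]_(w in alive n `&` past (s - h)%R n) (tau (cls (X n w)))%:E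
   + (ka / h)%:E * green cls Q A (fun y => (tau (cls y))%:E) x)%E.
Proof.
move=> h0 b0 ka0 tau0 H1 H2.
have hi0 : 0 <= h^-1 by rewrite invr_ge0 ltW.
have mtau : measurable_fun setT (fun y => (tau (cls y))%:E) by exact: measurable_label.
have t0 y : (0 <= (tau (cls y))%:E)%E by rewrite lee_fin.
have mt n D : measurable_fun D (fun w => (tau (cls (X n w)))%:E).
  by apply: measurable_funTS; exact: (measurableT_comp mtau (mX n)).
have mTZ n D : measurable_fun D (fun w => (Tp n w)%:E).
  by apply: measurable_funTS; apply/measurable_EFinP; exact: measurable_Tp.
have mT2 n D : measurable_fun D (fun w => (Tp n w ^+ 2)%:E).
  by apply: measurable_funTS; apply/measurable_EFinP; apply: measurable_funX; exact: measurable_Tp.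
have mh : measurable_fun setT (hold cls Q predT).
  apply: measurable_kernel_integral; [exact: measurable_lands|exact: time_ge0|exact: measurable_time].
have mh2 : measurable_fun setT (hold2 Q).
  by apply: measurable_kernel_integral => //; [exact: time2_ge0|exact: measurable_time2].
have map' n := measurable_alive_past (s - h) n.
have mal n := measurable_alive n.
rewrite -occupation // -!nneseriesZl; last 2 first.
- by move=> n _; apply: integral_ge0.
- by move=> n _; apply: integral_ge0.
rewrite -nneseriesD; last 2 first.
- by move=> n _ _; rewrite mule_ge0 ?lee_fin //; apply: integral_ge0.
- by move=> n _ _; rewrite mule_ge0 ?lee_fin ?divr_ge0 ?(ltW h0) //; apply: integral_ge0.
rewrite integral_nneseries //; apply: lee_nneseries => [n _ _|n _]; first by apply: integral_ge0.
pose F1 := (fun w => (Tp n.+1 w)%:E) \_ (alive n `&` past (s - h) n).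
pose F2 := (fun w => (h^-1 * Tp n.+1 w ^+ 2)%:E) \_ (alive n).
have F10 w : (0 <= F1 w)%E by apply: erestrict_ge0 => v; rewrite lee_fin Tp_ge0.
have F20 w : (0 <= F2 w)%E.
  by apply: erestrict_ge0 => v; rewrite lee_fin mulr_ge0 // sqr_ge0.
have mF1 : measurable_fun setT F1.
  by apply/(measurable_restrictT _ _).1 => //; exact: mTZ.
have mF2 : measurable_fun setT F2.
  apply/(measurable_restrictT _ _).1 => //; under eq_fun do rewrite EFinM.
  by apply: measurable_funeM; exact: mT2.
apply: le_trans (_ : \int[P]_w (F1 w + F2 w) <= _)%E.
  apply: ge0_le_integral => //; first exact: emeasurable_funD.
  move=> w _; rewrite /excess_term patchE; case: ifPn => [wa|_]; last exact: adde_ge0.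
  have wan : w \in alive n by move: wa; rewrite !inE; apply: alive_sub.
  rewrite /F1 /F2 !patchE wan in_setI wan /=.
  have -> : (w \in past (s - h) n) = (s - h <= Sp n w) by apply/idP/idP; rewrite inE.
  by have := overshoot_le s n w h0; case: ifP => _ ov; rewrite ?add0e -?EFinD lee_fin; rewrite ?add0r in ov.
rewrite ge0_integralD // /F1 /F2 -!integral_mkcond; apply: leeD.
  have -> : (\int[P]_(w in alive n `&` past (s - h)%R n) (Tp n.+1 w)%:E =
     \int[P]_(w in alive n `&` past (s - h)%R n) hold cls Q predT (X n w))%E.
    rewrite /hold -(one_step_lands predT (@hist_alive_past (s - h) n) (@time_ge0 R dS S)).
      by congr (integral _ _ _); apply/seteqP; split => w //; case.
    exact: measurable_time.
  rewrite -ge0_integralZl_EFin //.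
  apply: ge0_le_integral => //.
  - by move=> w _; apply: integral_ge0 => z _; exact: time_ge0.
  - by apply: measurable_funTS; exact: (measurableT_comp mh (mX n)).
  - exact: measurable_funeM.
  - by move=> w [/(_ n (leqnn n)) wA _]; rewrite -EFinM; exact: H1.
under eq_integral do rewrite EFinM.
rewrite ge0_integralZl_EFin //; last by move=> w _; rewrite lee_fin sqr_ge0.
have -> : (\int[P]_(w in alive n) (Tp n.+1 w ^+ 2)%:E =
    \int[P]_(w in alive n) hold2 Q (X n w))%E.
  by rewrite /hold2 -(one_step (@hist_alive n) (@time2_ge0 R dS S)) //; exact: measurable_time2.
rewrite mulrC EFinM -muleA lee_wpmul2l ?lee_fin //.
rewrite -ge0_integralZl_EFin //.
apply: ge0_le_integral => //.
- by move=> w _; apply: integral_ge0 => z _; exact: time2_ge0.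
- by apply: measurable_funTS; exact: (measurableT_comp mh2 (mX n)).
- exact: measurable_funeM.
- by move=> w /(_ n (leqnn n)) wA; rewrite -EFinM; exact: H2.
Qed.

End Path.

(** * The exponential limit *)

Section Memoryless.
Context {R : realType}.

Lemma expR_neg_lipschitz (a b : R) : 0 <= a -> a <= b -> expR (- a) - expR (- b) <= b - a.
Proof.
move=> a0 ab; have -> : - b = - a + (a - b) by ring.
rewrite expRD -{1}[expR (- a)]mulr1 -mulrBr.
have e1 : expR (- a) <= 1 by rewrite expR_le1 oppr_le0.
have e2 := expR_ge1Dx (a - b).
have e3 : expR (a - b) <= 1 by rewrite expR_le1 subr_le0.
apply: le_trans (_ : 1 * (1 - expR (a - b)) <= _); last lra.
by rewrite ler_wpM2r // subr_ge0.
Qed.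

Lemma geometric_exp_upper (eta : R) n : 0 <= eta ->
  ((1 + eta)^-1) ^+ n <= expR (- (n%:R * eta / (1 + eta))).
Proof.
move=> e0; have p0 : 0 < 1 + eta by lra.
have -> : - (n%:R * eta / (1 + eta)) = n%:R * (- eta / (1 + eta)) by field; exact: lt0r_neq0.
rewrite expRM_natl lerXn2r // ?nnegrE ?invr_ge0 ?(ltW p0) ?expR_ge0 //.
apply: le_trans (expR_ge1Dx _); rewrite le_eqVlt; apply/orP; left; apply/eqP.
by field; exact: lt0r_neq0.
Qed.

Lemma geometric_exp_lower (eta : R) n : 0 <= eta -> eta <= 1 / 2 ->
  expR (- (n%:R * eta / (1 - eta))) <= (1 - eta) ^+ n.
Proof.
move=> e0 e1; have p0 : 0 < 1 - eta by lra.
have -> : - (n%:R * eta / (1 - eta)) = n%:R * (- (eta / (1 - eta))) by field; exact: lt0r_neq0.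
rewrite expRM_natl lerXn2r // ?nnegrE ?(ltW p0) ?expR_ge0 //.
rewrite expRN -[leRHS]invrK lef_pV2 ?posrE ?expR_gt0 ?invr_gt0 //.
apply: le_trans (expR_ge1Dx _); rewrite le_eqVlt; apply/orP; left; apply/eqP.
by field; exact: lt0r_neq0.
Qed.

(* A constant mean residual life forces the exponential law: [- h'] is the tail [G], and [h] is
   close to [G]. *)
Lemma memoryless_limit (t e : R) : 0 <= t -> 0 < e -> exists2 d : R, 0 < d &
  forall h G : R -> R,
    (forall s eta, 0 <= s -> 0 <= eta -> h s <= h (s + eta) + eta * G s) ->
    (forall s eta, 0 <= s -> 0 <= eta -> h (s + eta) + eta * G (s + eta) <= h s) ->
    (forall s, 0 <= s -> G s <= h s + d) ->
    (forall s, 0 <= s -> h s <= G s + d) ->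
    G 0 = 1 -> `|G t - expR (- t)| <= e.
Proof.
move=> t0 e0; pose d := e / (4 * (2 + t)).
have d0 : 0 < d by rewrite divr_gt0 // mulr_gt0 //; lra.
exists d => // h G hA hB hC hD G0.
(* Many enough steps for [eta <= 1 / 2] and [t * eta <= e / 4], which bring both geometric sequences
   close to [expR (- t)]. *)
pose n := (Num.truncn (2 * t + 4 * t ^+ 2 / e)).+1.
have nb : 2 * t + 4 * t ^+ 2 / e < n%:R by exact: truncnS_gt.
have n0 : 0 < n%:R :> R by rewrite ltr0n.
pose eta := t / n%:R.
have eta0 : 0 <= eta by rewrite divr_ge0 // ltW.
have te : 0 <= 4 * t ^+ 2 / e by rewrite divr_ge0 ?mulr_ge0 ?sqr_ge0 // ltW.
have eta2 : eta <= 1 / 2 by rewrite ler_pdivrMr //; lra.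
have neta : n%:R * eta = t by rewrite /eta mulrCA divff ?mulr1 // gt_eqF.
have teta : t * eta <= e / 4.
  rewrite /eta mulrA ler_pdivrMr //.
  have : 4 * t ^+ 2 / e <= n%:R by lra.
  rewrite ler_pdivrMr // expr2; lra.
(* Euler schemes for [h' = - h]: with [G] at the right end of a step the scheme is implicit, with
   factor the inverse of [1 + eta]; the lower bound below takes [G] at the left end, with factor
   [1 - eta]. *)
have up k : h (k%:R * eta) <= ((1 + eta)^-1) ^+ k * (1 + d) + k%:R * eta * d.
  elim: k => [|k IH].
    by rewrite !mul0r expr0 mul1r addr0; have := hD 0 (lexx 0); rewrite G0.
  have ke : 0 <= k%:R * eta by rewrite mulr_ge0.
  have -> : k.+1%:R * eta = k%:R * eta + eta by rewrite -natr1; ring.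
  have B := hB _ _ ke eta0; have C := hD (k%:R * eta + eta) (addr_ge0 ke eta0).
  have p0 : 0 < 1 + eta by lra.
  rewrite -(ler_pM2l p0) exprS.
  have -> : (1 + eta) * ((1 + eta)^-1 * (1 + eta)^-1 ^+ k * (1 + d) + (k%:R * eta + eta) * d) =
     (1 + eta)^-1 ^+ k * (1 + d) + (1 + eta) * ((k%:R * eta + eta) * d).
    by field; exact: lt0r_neq0.
  have : 0 <= k%:R * eta * d by rewrite mulr_ge0 // ltW.
  have : 0 <= eta * d by rewrite mulr_ge0 // ltW.
  have : 0 <= eta * ((k%:R * eta + eta) * d).
    by rewrite mulr_ge0 // mulr_ge0 ?addr_ge0 // ltW.
  have : eta * h (k%:R * eta + eta) <= eta * (G (k%:R * eta + eta) + d) by rewrite ler_wpM2l.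
  lra.
have lo k : (1 - eta) ^+ k * (1 - d) - k%:R * eta * d <= h (k%:R * eta).
  elim: k => [|k IH].
    by rewrite !mul0r expr0 mul1r subr0; have := hC 0 (lexx 0); rewrite G0; lra.
  have ke : 0 <= k%:R * eta by rewrite mulr_ge0.
  have -> : k.+1%:R * eta = k%:R * eta + eta by rewrite -natr1; ring.
  have A := hA _ _ ke eta0; have C := hC (k%:R * eta) ke.
  have : eta * G (k%:R * eta) <= eta * (h (k%:R * eta) + d) by rewrite ler_wpM2l.
  have : (1 - eta) * ((1 - eta) ^+ k * (1 - d) - k%:R * eta * d) <= (1 - eta) * h (k%:R * eta).
    by rewrite ler_wpM2l //; lra.
  have : 0 <= eta * (k%:R * eta * d) by rewrite mulr_ge0 // mulr_ge0 // ltW.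
  rewrite exprS; lra.
have := up n; have := lo n; rewrite neta => {lo up} lo up.
have g1 := geometric_exp_upper n eta0; have g2 := geometric_exp_lower n eta0 eta2.
rewrite neta in g1 g2.
have l1 : expR (- (t / (1 + eta))) - expR (- t) <= t * eta.
  apply: le_trans (expR_neg_lipschitz _ _) _.
  - by rewrite divr_ge0 //; lra.
  - by rewrite ler_pdivrMr; nra.
  - rewrite lerBlDr -lerBlDl ler_pdivlMr; nra.
have l2 : expR (- t) - expR (- (t / (1 - eta))) <= 2 * (t * eta).
  apply: le_trans (expR_neg_lipschitz t0 _) _.
  - by rewrite ler_pdivlMr; nra.
  - rewrite lerBlDr ler_pdivrMr; last lra.
    have : 0 <= t * eta by rewrite mulr_ge0.
    nra.
have q0 : 0 <= (1 + eta)^-1 ^+ n by rewrite exprn_ge0 // invr_ge0; lra.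
have q1 : (1 + eta)^-1 ^+ n <= 1 by rewrite exprn_ile1 // ?invr_ge0 ?invf_le1; lra.
have r0 : 0 <= (1 - eta) ^+ n by rewrite exprn_ge0 //; lra.
have r1 : (1 - eta) ^+ n <= 1 by rewrite exprn_ile1 //; lra.
have dE : d * (2 + t) = e / 4 by rewrite /d; field; apply: lt0r_neq0; lra.
have C := hC t t0; have D := hD t t0.
have qd : (1 + eta)^-1 ^+ n * d <= d by rewrite ler_piMl // ltW.
have rd : (1 - eta) ^+ n * d <= d by rewrite ler_piMl // ltW.
by rewrite ler_norml; apply/andP; split; lra.
Qed.

End Memoryless.

(** * Survival and exit estimates at a fixed parameter *)

Section FixedParameterEstimates.
Context {R : realType} {dS : measure_display} {S : measurableType dS} {M : nat}.
Context {dO : measure_display} {O : measurableType dO}.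
Variables (cls : S -> 'I_M) (Q : R.-pker S ~> (S * R)%type) (P : probability O R).
Variables (x : S) (X : nat -> O -> S) (T : nat -> O -> R) (A : {pred 'I_M}).
Hypotheses (cls_meas : forall i, measurable (Si cls i)) (MR : MRchain P Q x X T)
  (xA : cls x \in A).
Variables (tau : 'I_M -> R) (tr d c : R).
Hypotheses (tau0 : forall i, 0 <= tau i) (tr0 : 0 < tr) (d0 : 0 <= d) (d1 : d <= 1)
  (c0 : 0 <= c).
Hypothesis Hg : forall y, cls y \in A ->
  (((1 - d) * tr)%:E <= green cls Q A (fun y => (tau (cls y))%:E) y <= ((1 + d) * tr)%:E)%E.

Local Notation reach := (reach cls X T A).
Local Notation excess := (excess cls X T A).

Let mtau : measurable_fun setT (fun y => (tau (cls y))%:E).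
Proof. exact: measurable_label. Qed.

Let t0 y : (0 <= (tau (cls y))%:E)%E. Proof. by rewrite lee_fin. Qed.

Let reach_fin s : P (reach s) \is a fin_num.
Proof. exact: fin_num_measure (measurable_reach cls_meas MR xA s). Qed.

Let reach1 s : fine (P (reach s)) <= 1.
Proof.
by rewrite -lee_fin fineK // probability_le1 //; exact: (measurable_reach cls_meas MR xA).
Qed.

Section Survival.
Hypotheses
  (HA : forall y, cls y \in A -> (((1 - d) * tau (cls y))%:E <= hold cls Q A y)%E)
  (HT : forall y, cls y \in A -> (hold cls Q predT y <= ((1 + d) * tau (cls y))%:E)%E)
  (H2 : forall y, cls y \in A -> (hold2 Q y <= (c * tr * tau (cls y))%:E)%E).

Let mg : measurable_fun setT (green cls Q A (fun y => (tau (cls y))%:E)).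
Proof. exact: measurable_green. Qed.

Let reach_occupation s :
  (((1 - d) * tr)%:E * P (reach s) <=
   \sum_(n <oo) \int[P]_(w in alive cls X A n `&` past T s n) (tau (cls (X n w)))%:E
   <= ((1 + d) * tr)%:E * P (reach s))%E.
Proof.
rewrite (occupation_past cls_meas MR xA s t0 mtau).
apply: (reach_integral cls_meas MR xA s mg) => //.
- by move=> y; exact: green_ge0.
- by rewrite mulr_ge0 ?subr_ge0 // ltW.
- by rewrite mulr_ge0 ?addr_ge0 // ltW.
Qed.

Lemma excess_lower s : (((1 - d) ^+ 2 * tr)%:E * P (reach s) <= \int[P]_w excess s w)%E.
Proof.
have d1' : 0 <= 1 - d by rewrite subr_ge0.
apply: le_trans (mean_excess_lower cls_meas MR xA s d1' tau0 HA).
have /andP[lo _] := reach_occupation s.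
apply: le_trans (lee_wpmul2l _ lo); last by rewrite lee_fin.
by rewrite muleA -EFinM mulrA -expr2.
Qed.

Lemma excess_upper s h : 0 < h -> (\int[P]_w excess s w <=
  ((1 + d) ^+ 2 * tr)%:E * P (reach (s - h)%R) + (c * (1 + d) * tr ^+ 2 / h)%:E)%E.
Proof.
move=> h0; have d1' : 0 <= 1 + d by rewrite addr_ge0.
have ct0 : 0 <= c * tr by rewrite mulr_ge0 // ltW.
apply: le_trans (mean_excess_upper cls_meas MR xA s h0 d1' ct0 tau0 HT H2) _.
have /andP[_ hi] := reach_occupation (s - h).
apply: leeD.
  apply: le_trans (lee_wpmul2l _ hi) _; first by rewrite lee_fin.
  by rewrite muleA -EFinM mulrA -expr2.
have /andP[_ gx] := Hg xA.
apply: le_trans (lee_wpmul2l _ gx) _; first by rewrite lee_fin divr_ge0 // ltW.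
rewrite -EFinM lee_fin le_eqVlt; apply/orP; left; apply/eqP; ring.
Qed.

Let excess_fin s : (\int[P]_w excess s w)%E \is a fin_num.
Proof.
rewrite ge0_fin_numE; last by apply: integral_ge0 => w _; exact: excess_ge0.
apply: le_lt_trans (excess_upper s tr0) _.
by rewrite -(fineK (reach_fin _)) -EFinM -EFinD ltry.
Qed.

Lemma survival_functions z e : 0 < z -> 2 * d <= e -> 3 * d + 2 * c / z + z <= e ->
  exists h : R -> R, let G s := fine (P (reach (s * tr))) in
  [/\ (forall s eta, 0 <= s -> 0 <= eta -> h s <= h (s + eta) + eta * G s),
    (forall s eta, 0 <= s -> 0 <= eta -> h (s + eta) + eta * G (s + eta) <= h s),
    (forall s, 0 <= s -> G s <= h s + e),
    (forall s, 0 <= s -> h s <= G s + e) & G 0 = 1].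
Proof.
move=> z0 de ze; exists (fun s => fine (\int[P]_w excess (s * tr) w) / tr) => G.
pose I s := fine (\int[P]_w excess (s * tr) w).
have IE s : (\int[P]_w excess (s * tr)%R w = (I s)%:E)%E by rewrite fineK.
have GE s : P (reach (s * tr)) = (G s)%:E by rewrite fineK.
have G1 s : G s <= 1 by exact: reach1.
have G0 s : 0 <= G s by rewrite fine_ge0.
have hA s eta : 0 <= s -> 0 <= eta -> I s / tr <= I (s + eta) / tr + eta * G s.
  move=> s0 eta0; have st : 0 <= s * tr by rewrite mulr_ge0 // ltW.
  have et : 0 <= eta * tr by rewrite mulr_ge0 // ltW.
  have := mean_excess_le cls_meas MR xA st et; rewrite -mulrDl !IE GE -EFinM -EFinD lee_fin.
  move=> H; rewrite ler_pdivrMr // mulrDl divfK ?gt_eqF //.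
  by apply: le_trans H _; rewrite lerD2l mulrAC.
split => //.
- move=> s eta s0 eta0; have st : 0 <= s * tr by rewrite mulr_ge0 // ltW.
  have et : 0 <= eta * tr by rewrite mulr_ge0 // ltW.
  have := mean_excess_ge cls_meas MR xA st et; rewrite -mulrDl !IE GE -EFinM -EFinD lee_fin.
  move=> H; rewrite -/(I s) -/(I (s + eta)) ler_pdivlMr // mulrDl divfK ?gt_eqF //.
  by apply: le_trans H; rewrite lerD2l mulrAC.
- move=> s s0; rewrite -/(I s); have := excess_lower (s * tr); rewrite IE GE -EFinM lee_fin => H.
  have : (1 - d) ^+ 2 * G s <= I s / tr by rewrite ler_pdivlMr // mulrAC.
  have : (1 - 2 * d) * G s <= (1 - d) ^+ 2 * G s.
    by rewrite ler_wpM2r // expr2; have := mulr_ge0 d0 d0; lra.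
  have : d * G s <= d by rewrite ler_piMr.
  lra.
- move=> s s0; apply: le_trans (hA s z s0 (ltW z0)) _.
  have := excess_upper ((s + z) * tr) (mulr_gt0 z0 tr0).
  rewrite -mulrBl addrK IE GE -EFinM -EFinD lee_fin => H.
  have : I (s + z) / tr <= (1 + d) ^+ 2 * G s + c * (1 + d) / z.
    rewrite ler_pdivrMr //; apply: le_trans H _; rewrite mulrDl lerD //.
      by rewrite mulrAC.
    rewrite le_eqVlt; apply/orP; left; apply/eqP; field.
    by apply/andP; split; apply: lt0r_neq0.
  have : (1 + d) ^+ 2 * G s <= (1 + 3 * d) * G s.
    rewrite ler_wpM2r // expr2; have : d * d <= d by rewrite ler_piMr.
    lra.
  have : d * G s <= d by rewrite ler_piMr.
  have : c * (1 + d) / z <= 2 * c / z.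
    have : c * d <= c by rewrite ler_piMr.
    by rewrite ler_pM2r ?invr_gt0 // => cd; lra.
  have : z * G s <= z by rewrite ler_piMr // ltW.
  lra.
- by rewrite /G mul0r (reach_le0 MR xA) // probability_setT.
Qed.

End Survival.

Section ExitEstimate.
Variables (L : {pred 'I_M}) (u : R).
Hypotheses (LA : forall j, j \in L -> j \notin A) (u0 : 0 < u)
  (Ku : forall y, cls y \in A -> u / (1 + d) <= kexit cls Q A L y <= (1 + d) * u)
  (HL : forall y, cls y \in A -> (hold cls Q L y <= (c * u * tau (cls y))%:E)%E).

Local Notation exit_after := (exit_after cls X T A L).

Let mK : measurable_fun setT (Kexit cls Q A L).
Proof. by apply: measurable_green => //; exact: measurable_cost. Qed.

Let after_fin s : P (exit_after s) \is a fin_num.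
Proof. exact: fin_num_measure (measurable_exit_after cls_meas MR xA L s). Qed.

Let reach_exit_bounds s : ((u / (1 + d))%:E * P (reach s) <=
   P (reach s `&` exit_ cls X A L) <= ((1 + d) * u)%:E * P (reach s))%E.
Proof.
have d1' : 0 < 1 + d by rewrite ltr_pwDl.
rewrite (reach_exit cls_meas MR xA LA).
apply: (reach_integral cls_meas MR xA s mK) => //.
- by move=> y; exact: Kexit_ge0.
- by rewrite divr_ge0 // ltW.
- by rewrite mulr_ge0 // ltW.
- by move=> y yA; rewrite KexitE // !lee_fin; exact: Ku.
Qed.

Lemma exit_after_ge s :
  u / (1 + d) * fine (P (reach s)) <= fine (P (exit_after s)).
Proof.
rewrite -lee_fin EFinM !fineK //.
have /andP[lo _] := reach_exit_bounds s; apply: le_trans lo _.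
apply: le_measure; rewrite ?inE.
- apply: measurableI; first exact: (measurable_reach cls_meas MR xA).
  exact: (measurable_exit cls_meas MR xA).
- exact: (measurable_exit_after cls_meas MR xA).
- exact: exit_after_lower.
Qed.

Lemma exit_after_le s h : 0 < h -> fine (P (exit_after (s + h))) <=
  (1 + d) * u * fine (P (reach s)) + c * u * (1 + d) * tr / h.
Proof.
move=> h0; rewrite -lee_fin EFinD EFinM !fineK //.
have cu0 : 0 <= c * u by rewrite mulr_ge0 // ltW.
have mr : measurable (reach s `&` exit_ cls X A L).
  apply: measurableI; first exact: (measurable_reach cls_meas MR xA).
  exact: (measurable_exit cls_meas MR xA).
have ml : measurable (late cls X T A L h).
  apply: bigcupT_measurable => m; apply: measurableI.
    exact: (measurable_exits cls_meas MR xA).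
  exact: (measurable_late1 MR).
apply: le_trans (_ : P ((reach s `&` exit_ cls X A L) `|` late cls X T A L h) <= _)%E.
  apply: le_measure; rewrite ?inE.
  - exact: (measurable_exit_after cls_meas MR xA).
  - exact: measurableU.
  - exact: exit_after_upper.
apply: le_trans (measureU2 P mr ml) _; apply: leeD.
  by have /andP[] := reach_exit_bounds s.
apply: le_trans (late_prob cls_meas MR xA LA h0 cu0 tau0 HL) _.
have /andP[_ gx] := Hg xA.
apply: le_trans (lee_wpmul2l _ gx) _; first by rewrite lee_fin divr_ge0 // ltW.
rewrite -EFinM lee_fin le_eqVlt; apply/orP; left; apply/eqP; ring.
Qed.

Lemma exit_after_le_total s : fine (P (exit_after s)) <= fine (P (exit_ cls X A L)).
Proof.
have me := measurable_exit cls_meas MR xA L.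
rewrite fine_le //; first exact: fin_num_measure.
apply: le_measure; rewrite ?inE //; first exact: (measurable_exit_after cls_meas MR xA).
by move=> w [m _ [wm _]]; exists m.
Qed.

End ExitEstimate.
End FixedParameterEstimates.

(** * Exit from a cluster *)

Section ClusterExit.
Context {R : realType} {dS : measure_display} {S : measurableType dS} {M n : nat}.
Context {dO : measure_display} {O : measurableType dO}.
Variables (cls : S -> 'I_M) (Q : R.-pker S ~> (S * R)%type) (P : probability O R).
Variables (x : S) (X : nat -> O -> S) (T : nat -> O -> R).
Variables (p : 'I_M -> 'I_n) (k l : 'I_n).
Hypotheses (cls_meas : forall i, measurable (Si cls i)) (MR : MRchain P Q x X T)
  (xk : p (cls x) = k) (kl : l != k).
Hypothesis neg0 : forall y, Q y (setT `*` [set t | t < 0]) = 0%E.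

Local Notation A := [pred i | p i == k].
Local Notation L := [pred j | p j == l].
Local Notation lab := (fun y => p (cls y)).

Let xA : cls x \in A. Proof. by rewrite inE /= xk. Qed.
Let X0 w : X 0%N w = x. Proof. exact: (X0 MR). Qed.

Lemma alive_lab m w : alive cls X A m w <->
  (forall m', (0 < m' < m.+1)%N -> lab (X m' w) = lab (X 0%N w)).
Proof.
split => [H m' /andP[_ mm]|H m' mm]; first by have := H _ mm; rewrite inE X0 xk => /eqP.
case: m' mm => [|m'] mm; first by rewrite X0.
by rewrite inE H ?X0 ?xk //= ltnS.
Qed.

Lemma exits_lab m w :
  exits cls X A L m w <-> exit_at lab X w m.+1 /\ lab (X m.+1 w) = l.
Proof.
split => [[al /=]|[[_ _ H] E]].
  rewrite /at_ /= inE => /eqP E; split => //; split => //; last exact/alive_lab.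
  by rewrite E X0 xk.
by split; [exact/alive_lab|rewrite /at_ /= inE E].
Qed.

Lemma exit_to_exit : exit_to lab X l = exit_ cls X A L.
Proof.
apply/seteqP; split => w.
  by move=> [[|m] [H E]]; [case: H|exists m => //; exact/exits_lab].
by move=> [m _ /exits_lab[H E]]; exists m.+1.
Qed.

Let mT m : measurable_fun setT (T m). Proof. by case: MR => _ /(_ m). Qed.

Lemma negative_holding_null : P.-negligible (\bigcup_m [set w | T m w < 0]).
Proof.
apply: negligible_bigcup => -[|m].
  rewrite (_ : [set w | _] = set0); first exact: negligible_set0.
  by apply/seteqP; split => // w /=; case: MR => _ _ /(_ w)[_ ->]; rewrite ltxx.
have mneg : measurable [set t : R | t < 0] by rewrite -set_itvNyo; exact: measurable_itv.
have mB : measurable ([set: S] `*` [set t : R | t < 0]) by exact: measurableX.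
apply/negligibleP; first by have := mT m.+1 measurableT mneg; rewrite setTI.
case: MR => _ _ _ /(_ m setT (@histT _ _ _ _ _ X T m) _ mB); rewrite setTI integral0_eq => [<-|w _].
  by congr (P _); apply/seteqP; split => w //= [].
exact: neg0.
Qed.

(** One event sums the holding times, the other their positive parts. They differ only where some
    holding time is negative, a null set. *)
Lemma exit_event_prob s : P (exit_event lab X T l s) = P (exit_after cls X T A L s).
Proof.
have mE : measurable (exit_event lab X T l s).
  rewrite (_ : exit_event _ _ _ _ _ = \bigcup_m
      (exits cls X A L m `&` [set w | s <= \sum_(1 <= j < m.+2) T j w])); last first.
    apply/seteqP; split => w.
      by move=> [[|m] [H [E sT]]]; [case: H|exists m => //; split => //; exact/exits_lab].
    by move=> [m _ [/exits_lab[H E] sT]]; exists m.+1.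
  apply: bigcupT_measurable => m; apply: measurableI.
    exact: (measurable_exits cls_meas MR xA).
  have mI : measurable [set y : R | s <= y] by rewrite -set_itvcy; exact: measurable_itv.
  by have := measurable_sum (index_iota 1 m.+2) mT measurableT mI; rewrite setTI.
have mA := measurable_exit_after cls_meas MR xA L s.
pose N := \bigcup_m [set w | T m w < 0].
have mN : measurable N.
  have mneg : measurable [set t : R | t < 0] by rewrite -set_itvNyo; exact: measurable_itv.
  by apply: bigcupT_measurable => m; have := mT m measurableT mneg; rewrite setTI.
apply/eqP; rewrite eq_le; apply/andP; split.
  apply: le_measure; rewrite ?inE // => w [[|m] [H [E sT]]]; first by case: H.
  exists m => //; split; first exact/exits_lab.
  by apply: le_trans sT _; apply: ler_sum => j _; rewrite /Tp le_max lexx.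
apply: le_trans (_ : P (exit_event lab X T l s `|` N) <= _)%E.
  apply: le_measure; rewrite ?inE //; first exact: measurableU.
  move=> w [m _ [/exits_lab[H E] sT]].
  have [Nw|Nw] := pselect (N w); [by right|left].
  exists m.+1; split => //; split => //; apply: le_trans sT _; apply: ler_sum => j _.
  by rewrite /Tp ge_max lexx /= leNgt; apply/negP => Tj; apply: Nw; exists j.
apply: le_trans (measureU2 P mE mN) _.
by rewrite [X in (_ + X)%E](measure_negligible mN negative_holding_null) adde0.
Qed.

(** [Nvisits] includes the exit step itself, but the state reached there lies outside cluster [k]
    and so is not of class [i]; only the steps before the exit count. *)
Lemma mean_visits (i : 'I_M) : p i = k -> (\int[P]_w Nvisits cls lab X i w =
  \sum_(m <oo) \int[P]_(w in alive cls X A m) (\1_(Si cls i) (X m w))%:E)%E.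
Proof.
move=> ik; have mX m : measurable_fun setT (X m) by case: MR => /(_ m).
have mal m := measurable_alive cls_meas MR xA m.
have m1 m D : measurable_fun D (fun w => (\1_(Si cls i) (X m w))%:E : \bar R).
  apply: measurable_funTS; apply/measurable_EFinP.
  exact: (measurableT_comp (measurable_indic (cls_meas i)) (mX m)).
have E w : (Nvisits cls lab X i w =
  \sum_(m <oo) ((fun w => (\1_(Si cls i) (X m w))%:E) \_ (alive cls X A m)) w)%E.
  apply: eq_eseriesr => m _; rewrite patchE.
  case: asboolP => [[ci H]|H].
    rewrite mem_set.
      by rewrite indicE mem_set.
    apply/alive_lab => m' /andP[m0]; rewrite ltnS leq_eqVlt => /predU1P[->|mm].
      by rewrite ci X0 xk.
    by apply: H; rewrite m0.
  case: ifPn => //; rewrite inE => al; rewrite indicE memNset // => ci; apply: H; split => //.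
  by move/alive_lab: al => H m' /andP[m0 mm]; apply: H; rewrite m0 ltnW.
under eq_integral do rewrite E.
rewrite integral_nneseries //.
- by apply: eq_eseriesr => m _; rewrite -integral_mkcond.
- by move=> m; apply/(measurable_restrictT _ _).1.
- by move=> m w _; apply: erestrict_ge0 => v; rewrite lee_fin.
Qed.

Lemma visits_green (tau : 'I_M -> R) : (forall i, 0 <= tau i) ->
  (\sum_(i | p i == k) ((tau i)%:E * \int[P]_w Nvisits cls lab X i w) =
   green cls Q A (fun y => (tau (cls y))%:E) x)%E.
Proof.
move=> tau0; have mX m : measurable_fun setT (X m) by case: MR => /(_ m).
have mal m := measurable_alive cls_meas MR xA m.
have m1 i m D : measurable_fun D (fun w => (\1_(Si cls i) (X m w))%:E : \bar R).
  apply: measurable_funTS; apply/measurable_EFinP.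
  exact: (measurableT_comp (measurable_indic (cls_meas i)) (mX m)).
rewrite -(occupation cls_meas MR xA); last 2 first.
- by move=> y; rewrite lee_fin.
- exact: measurable_label.
transitivity (\sum_(i | p i == k) \sum_(m <oo)
   ((tau i)%:E * \int[P]_(w in alive cls X A m) (\1_(Si cls i) (X m w))%:E))%E.
  apply: eq_bigr => i /eqP ik; rewrite mean_visits // -nneseriesZl //.
  by move=> m _; apply: integral_ge0 => w _; rewrite lee_fin.
rewrite -nneseries_sum; last first.
  by move=> i m _; rewrite mule_ge0 ?lee_fin //; apply: integral_ge0 => w _; rewrite lee_fin.
apply: eq_eseriesr => m _.
under eq_bigr => i _ do rewrite -ge0_integralZl_EFin //.
rewrite -big_filter -ge0_integral_sum //; last 2 first.
- by move=> i; exact: measurable_funeM.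
- by move=> i w _; rewrite -EFinM lee_fin mulr_ge0.
apply: eq_integral => w; rewrite inE => /(_ m (leqnn m)); rewrite inE => wk.
rewrite big_filter (bigD1 (cls (X m w))) //= indicE mem_set // mule1 big1 ?adde0 //.
by move=> i /andP[_ ic]; rewrite indicE memNset ?mule0 // => E; move/eqP: ic; rewrite -E.
Qed.

Lemma exit_to_prob : P (exit_to lab X l) = Kexit cls Q A L x.
Proof.
rewrite exit_to_exit (exit_total_prob cls_meas MR xA) // => j; rewrite !inE => /eqP ->.
exact: kl.
Qed.

End ClusterExit.

(** * The limit law of the exit time *)

Lemma ratio_gt {R : realFieldType} (e d g E rho : R) : 0 < d -> d <= e / 8 ->
  0 <= g <= 1 -> `|g - E| <= e / 8 -> g / (1 + d) <= rho -> E - e < rho.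
Proof.
move=> d0 de /andP[g0 g1]; rewrite ler_distl => /andP[lo _]; apply: lt_le_trans.
rewrite ltr_pdivlMr; last lra.
have : g * d <= d by rewrite ler_piMl // ltW.
have := mulr_ge0 (ltW d0) (ltW d0); nra.
Qed.

Lemma ratio_lt {R : realFieldType} (e d c eta g E E' rho : R) : 0 < d -> d <= 1 ->
  d <= e / 8 -> 0 <= c -> 0 < eta -> eta <= e / 8 -> 2 * c / eta <= e / 8 ->
  0 <= g <= 1 -> `|g - E'| <= e / 8 -> E' - E <= eta ->
  rho <= (1 + d) * g + c * (1 + d) / eta -> rho < E + e.
Proof.
move=> d0 d1 de c0 eta0 etae ce /andP[g0 g1]; rewrite ler_distl => /andP[_ hi] EE H.
have : d * g <= d by rewrite ler_piMr // ltW.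
have : c * (1 + d) / eta <= 2 * c / eta.
  have : c * d <= c by rewrite ler_piMr // ltW.
  by rewrite ler_pM2r ?invr_gt0 // => cd; lra.
lra.
Qed.

Section ClusterExitLimit.
Context {R : realType} {dS : measure_display} {S : measurableType dS} {M n : nat}.
Variables (cls : S -> 'I_M).
Hypothesis cls_meas : forall i, measurable (Si cls i).
Variables (Q : R -> R.-pker S ~> (S * R)%type) (P : R -> 'I_M -> 'I_M -> R)
  (tau : R -> 'I_M -> R).
Hypotheses (neg0 : forall eps x, Q eps x (setT `*` [set t | t < 0]) = 0%E)
  (Pst : forall e : R, 0 < e -> stochastic (P e))
  (Pirr : forall e : R, 0 < e -> irreducible_chain (P e))
  (Pdiag : forall (e : R) i, 0 < e -> P e i i = 0)
  (Ppos : forall i j, nzP P i j -> forall e : R, 0 < e -> 0 < P e i j)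
  (QP : forall i j d, 0 < d -> \forall e \near (0:R)^'+, forall x, cls x = i ->
     `|Pk (Q e) x (Si cls j) - P e i j| <= d * P e i j)
  (tau0 : forall e i, 0 < e -> 0 < tau e i)
  (mean : forall i j, nzP P i j ->
     unif_lim (fun eps x => condE (Q eps) x (Si cls j) id / tau eps i) (Si cls i) 1)
  (var : exists (C eps0 : R), 0 < eps0 /\ forall eps, 0 < eps <= eps0 ->
     forall i j, nzP P i j -> forall x, Si cls i x ->
       (\int[Q eps x]_(z in Si cls j `*` setT)
           ((z.2 - condE (Q eps) x (Si cls j) id) ^+ 2)%:E
        <= (C * tau eps i ^+ 2 * Pk (Q eps) x (Si cls j))%:E)%E).
Variables (p : 'I_M -> 'I_n) (k l : 'I_n).
Hypotheses (psurj : forall k, exists i, p i = k) (n1 : (1 < n)%N)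
  (rec : recurrent_blocks P p) (big : (1 < #|[pred i | p i == k]|)%N) (lk : l != k)
  (edge : exists i j, [/\ p i = k, p j = l & nzP P i j]).
Variable tr : R -> R.
Hypotheses (tr0 : forall e, 0 < e -> 0 < tr e)
  (occ : forall d : R, 0 < d -> \forall e \near 0^'+, forall x, p (cls x) = k ->
    (`|green cls (Q e) [pred i | p i == k] (fun y => (tau e (cls y))%:E) x
        * ((tr e)^-1)%:E - 1| < d%:E)%E).

Local Notation A := [pred i | p i == k].
Local Notation L := [pred j | p j == l].
Local Notation g e x := (green cls (Q e) A (fun y => (tau e (cls y))%:E) x).

Let tau0' e : 0 < e -> forall i, 0 < tau e i. Proof. by move=> e0 i; exact: tau0. Qed.

Let LA j : j \in L -> j \notin A.
Proof. by rewrite !inE => /eqP ->. Qed.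

Let AP x : cls x \in A -> p (cls x) = k. Proof. by rewrite inE => /eqP. Qed.

Lemma occupation_bounds d : 0 < d -> \forall e \near (0:R)^'+, forall x, cls x \in A ->
  (((1 - d) * tr e)%:E <= g e x <= ((1 + d) * tr e)%:E)%E.
Proof.
move=> d0; near=> e => x /AP xk; have e0 : 0 < e by near: e; exact: nbhs_right_gt.
have t0 := tr0 e0.
have : forall x, p (cls x) = k -> (`|g e x * ((tr e)^-1)%:E - 1| < d%:E)%E.
  by near: e; exact: occ.
move=> /(_ x xk).
case: (green _ _ _ _ _) => [r| |].
- rewrite -EFinM -EFinB lte_fin ltr_distl => /andP[/ltW lo /ltW hi].
  rewrite !lee_fin; move: lo hi; rewrite ler_pdivlMr // ler_pdivrMr //; lra.
- by rewrite gt0_mulye ?lte_fin ?invr_gt0.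
- by rewrite gt0_mulNye ?lte_fin ?invr_gt0.
Unshelve. all: by end_near. Qed.

(** The chance of leaving the cluster in one step is at most [d / 2] times an exit probability,
    hence at most [d / 2]; nearly all of the mean holding time belongs to jumps that stay. *)
Lemma hold_inside d : 0 < d -> d <= 1 -> \forall e \near (0:R)^'+, forall x, cls x \in A ->
  (((1 - d) * tau e (cls x))%:E <= hold cls (Q e) A x)%E.
Proof.
move=> d0 d1; have h0 : 0 < d / 2 by rewrite divr_gt0.
have small : \forall e \near (0:R)^'+, forall i, p i = k -> forall x, cls x \in A ->
    \sum_(j | j \in predC A) P e i j <= d / 2 * kexit cls (Q e) A (predC A) x.
  apply: filter_forall => i; have [ik|ik] := eqVneq (p i) k; last first.
    by apply: nearW => e /eqP; rewrite (negPf ik).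
  by apply: filterS (exit_rate_small cls_meas Pst Pirr Pdiag QP rec big (L := predC A) _ ik h0) => [e He _|j].
near=> e => x xA; have e0 : 0 < e by near: e; exact: nbhs_right_gt.
have H1 : forall i, p i = k -> forall x, cls x \in A ->
    \sum_(j | j \in predC A) P e i j <= d / 2 * kexit cls (Q e) A (predC A) x by near: e.
have H2 : forall x,
  (((1 - d / 2) * (tau e (cls x) * \sum_(j | j \in A) P e (cls x) j))%:E <= hold cls (Q e) A x
   <= ((1 + d / 2) * (tau e (cls x) * \sum_(j | j \in A) P e (cls x) j))%:E)%E.
  by near: e; exact: hold_asymp.
have /andP[lo _] := H2 x; apply: le_trans lo; rewrite lee_fin.
have out : \sum_(j | j \notin A) P e (cls x) j <= d / 2.
  apply: le_trans (H1 _ (AP xA) x xA) _; rewrite ler_piMr ?(ltW h0) //.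
  by apply: kexit_le1 => // j.
have [_ /(_ (cls x))] := Pst e0; rewrite (bigID (mem A)) /= => tot.
have t0 := tau0' e0 (cls x).
set a := \sum_(j | j \in A) _; have a1 : 1 - d / 2 <= a.
  by rewrite lerBlDr -[leLHS]tot; apply: lerD => //; exact: out.
rewrite [leRHS]mulrCA mulrC ler_pM2l //.
apply: le_trans (_ : (1 - d / 2) * (1 - d / 2) <= _).
  by have := mulr_ge0 (ltW h0) (ltW h0); lra.
by rewrite ler_wpM2l //; lra.
Unshelve. all: by end_near. Qed.

Lemma hold2_small c : 0 < c -> \forall e \near (0:R)^'+, forall x, cls x \in A ->
  (hold2 (Q e) x <= (c * tr e * tau e (cls x))%:E)%E.
Proof.
move=> c0; have [C C0 H2] := hold2_asymp cls_meas QP tau0 mean var.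
(* The 2 absorbs the crude bound of the occupation by [(1 + 1) * tr e]. *)
have d0 : 0 < c / (2 * C) by rewrite divr_gt0 // mulr_gt0.
have dom : \forall e \near (0:R)^'+, forall i, p i = k -> forall x, cls x \in A ->
    ((tau e i)%:E <= (c / (2 * C))%:E * g e x)%E.
  apply: filter_forall => i; have [ik|ik] := eqVneq (p i) k; last first.
    by apply: nearW => e /eqP; rewrite (negPf ik).
  by apply: filterS (green_dominates cls_meas Pst Pirr Pdiag QP rec big tau0' ik d0) => e He _.
near=> e => x xA; have e0 : 0 < e by near: e; exact: nbhs_right_gt.
have D1 : forall i, p i = k -> forall x, cls x \in A ->
    ((tau e i)%:E <= (c / (2 * C))%:E * g e x)%E by near: e.
have D2 : forall x, (hold2 (Q e) x <= (C * tau e (cls x) ^+ 2)%:E)%E by near: e.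
have D3 : forall x, cls x \in A ->
    (((1 - 1) * tr e)%:E <= g e x <= ((1 + 1) * tr e)%:E)%E.
  by near: e; exact: occupation_bounds.
apply: le_trans (D2 x) _; rewrite lee_fin expr2 mulrA ler_wpM2r ?(ltW (tau0 _ e0)) //.
have /andP[_ gx] := D3 x xA.
have : ((tau e (cls x))%:E <= (c / (2 * C))%:E * ((1 + 1) * tr e)%:E)%E.
  by apply: le_trans (D1 _ (AP xA) x xA) _; rewrite lee_wpmul2l // lee_fin ltW.
rewrite -EFinM lee_fin => H.
apply: le_trans (_ : C * (c / (2 * C) * ((1 + 1) * tr e)) <= _); first by rewrite ler_pM2l.
rewrite le_eqVlt; apply/orP; left; apply/eqP; field.
exact: lt0r_neq0.
Unshelve. all: by end_near. Qed.

Lemma exit_rate_pos : \forall e \near (0:R)^'+, forall x, cls x \in A ->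
  0 < kexit cls (Q e) A L x.
Proof.
have [i [j [ik jl ij]]] := edge.
near=> e => x xA; have e0 : 0 < e by near: e; exact: nbhs_right_gt.
have : forall x, cls x \in A -> \sum_(j | j \in L) P e i j <= 1 * kexit cls (Q e) A L x.
  by near: e; exact: (exit_rate_small cls_meas Pst Pirr Pdiag QP rec big LA ik ltr01).
move=> /(_ x xA); rewrite mul1r; apply: lt_le_trans.
rewrite (bigD1 j) /=; last by rewrite inE jl.
rewrite ltr_pwDl ?Ppos // sumr_ge0 // => j' _.
by have [P0 _] := Pst e0; exact: P0.
Unshelve. all: by end_near. Qed.

Lemma exit_rate_flat d : 0 < d -> \forall e \near (0:R)^'+, forall x y,
  cls x \in A -> cls y \in A -> kexit cls (Q e) A L x / (1 + d) <=
    kexit cls (Q e) A L y <= (1 + d) * kexit cls (Q e) A L x.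
Proof.
move=> d0; near=> e => x y xA yA.
have H : forall x y, cls x \in A -> cls y \in A ->
    kexit cls (Q e) A L x <= (1 + d) * kexit cls (Q e) A L y.
  by near: e; apply: (kexit_osc cls_meas Pst Pirr Pdiag QP psurj n1 rec big).
by rewrite H // andbT ler_pdivrMr 1?mulrC ?H //; lra.
Unshelve. all: by end_near. Qed.

(** The bound is relative to the exit probability into [l], which may itself tend to zero, because
    the final law is conditioned on that exit. *)
Lemma last_hold_small c : 0 < c -> \forall e \near (0:R)^'+, forall x y,
  cls x \in A -> cls y \in A ->
  (hold cls (Q e) L y <= (c * kexit cls (Q e) A L x * tau e (cls y))%:E)%E.
Proof.
move=> c0; have h0 : 0 < c / 2 by rewrite divr_gt0.
have small : \forall e \near (0:R)^'+, forall i, p i = k -> forall x, cls x \in A ->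
    \sum_(j | j \in L) P e i j <= c / 2 * kexit cls (Q e) A L x.
  apply: filter_forall => i; have [ik|ik] := eqVneq (p i) k; last first.
    by apply: nearW => e /eqP; rewrite (negPf ik).
  by apply: filterS (exit_rate_small cls_meas Pst Pirr Pdiag QP rec big LA ik h0) => e He _.
near=> e => x y xA yA; have e0 : 0 < e by near: e; exact: nbhs_right_gt.
have H1 : forall i, p i = k -> forall x, cls x \in A ->
    \sum_(j | j \in L) P e i j <= c / 2 * kexit cls (Q e) A L x by near: e.
have H2 : forall x,
  (((1 - 1) * (tau e (cls x) * \sum_(j | j \in L) P e (cls x) j))%:E <= hold cls (Q e) L x
   <= ((1 + 1) * (tau e (cls x) * \sum_(j | j \in L) P e (cls x) j))%:E)%E.
  by near: e; exact: hold_asymp.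
have /andP[_ hi] := H2 y; apply: le_trans hi _; rewrite lee_fin.
rewrite [leLHS]mulrCA mulrC ler_pM2r ?tau0 //.
have := H1 _ (AP yA) x xA; lra.
Unshelve. all: by end_near. Qed.

(** For the lower bound the time of the last inner jump is compared with [t] itself. For the upper
    bound a share [eta] of [t] is left to the final holding time, so the tail is also needed at
    [t - eta], and the memoryless criterion is invoked at both times. *)
Lemma cluster_exit_exponential {dO : measure_display} {O : measurableType dO}
    (Prob : R -> S -> probability O R) (X : R -> S -> nat -> O -> S)
    (T : R -> S -> nat -> O -> R) (t : R) :
  (forall eps x, 0 < eps -> MRchain (Prob eps x) (Q eps) x (X eps x) (T eps x)) -> 0 <= t ->
  unif_lim (fun eps x =>
      fine (Prob eps x (exit_event (fun y => p (cls y)) (X eps x) (T eps x) l (t * tr eps)))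
      / fine (Prob eps x (exit_to (fun y => p (cls y)) (X eps x) l)))
    [set x | p (cls x) = k] (expR (- t)).
Proof.
move=> MR t0 e e0.
(* For [t = 0] this is 0 and no time can be set aside; there the upper bound is just that a
   conditional probability is at most 1. *)
pose eta := Num.min t (e / 8); have e80 : 0 < e / 8 by rewrite divr_gt0.
have eta_t : eta <= t by rewrite ge_min lexx.
have eta_e : eta <= e / 8 by rewrite ge_min lexx orbT.
have te0 : 0 <= t - eta by rewrite subr_ge0.
have [b1 b10 B1] := memoryless_limit t0 e80.
have [b2 b20 B2] := memoryless_limit te0 e80.
pose b := Num.min (Num.min b1 b2) 1; have b0 : 0 < b by rewrite !lt_min b10 b20 ltr01.
have bb1 : b <= b1 by rewrite !ge_min lexx.
have bb2 : b <= b2 by rewrite !ge_min lexx orbT.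
have b_1 : b <= 1 by rewrite ge_min lexx orbT.
(* [d], [z] and [c] are fitted to [3 * d + 2 * c / z + z <= b], with at most [b / 4] for each term;
   for positive [t], [c] must also be small against [eta]. *)
pose d := Num.min (b / 12) (e / 8); have d0 : 0 < d by rewrite lt_min e80 divr_gt0.
have db : d <= b / 12 by rewrite ge_min lexx.
have de : d <= e / 8 by rewrite ge_min lexx orbT.
have d1 : d <= 1 by lra.
pose z := b / 4; have z0 : 0 < z by rewrite divr_gt0.
have [c c0 [cz ce]] : exists2 c, 0 < c & 2 * c / z <= b / 4 /\
    (0 < t -> 2 * c / eta <= e / 8).
  have [tz|tz] := ltP 0 t; last first.
    exists (b / 4 * z / 2); first by rewrite !mulr_gt0 // divr_gt0.
    split=> //; rewrite le_eqVlt; apply/orP; left; apply/eqP; field.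
    exact: lt0r_neq0.
  have eta0 : 0 < eta by rewrite lt_min tz.
  exists (Num.min (b / 4 * z / 2) (e / 8 * eta / 2)).
    by rewrite lt_min !divr_gt0 // mulr_gt0 // divr_gt0.
  split=> [|_]; rewrite ler_pdivrMr // -ler_pdivlMl //.
    by rewrite ge_min [_^-1 * _]mulrC lexx.
  by rewrite ge_min [_^-1 * _]mulrC lexx orbT.
near=> f => x /= xk; have f0 : 0 < f by near: f; exact: nbhs_right_gt.
have xA : cls x \in A by rewrite inE xk.
have Hg : forall x, cls x \in A ->
  (((1 - d) * tr f)%:E <= g f x <= ((1 + d) * tr f)%:E)%E.
  by near: f; exact: occupation_bounds.
have HA : forall x, cls x \in A ->
  (((1 - d) * tau f (cls x))%:E <= hold cls (Q f) A x)%E.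
  by near: f; exact: hold_inside.
have HT1 : forall x,
  (((1 - d) * (tau f (cls x) * \sum_(j | j \in predT) P f (cls x) j))%:E
   <= hold cls (Q f) predT x
   <= ((1 + d) * (tau f (cls x) * \sum_(j | j \in predT) P f (cls x) j))%:E)%E.
  by near: f; exact: hold_asymp.
have HT y : cls y \in A -> (hold cls (Q f) predT y <= ((1 + d) * tau f (cls y))%:E)%E.
  move=> _; have /andP[_] := HT1 y; have [_ /(_ (cls y))] := Pst f0.
  by rewrite (eq_bigl xpredT) // => ->; rewrite mulr1.
have H2 : forall x, cls x \in A -> (hold2 (Q f) x <= (c * tr f * tau f (cls x))%:E)%E.
  by near: f; exact: hold2_small.
have u0 : 0 < kexit cls (Q f) A L x by move: x xA {xk}; near: f; exact: exit_rate_pos.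
have Ku : forall x y, cls x \in A -> cls y \in A ->
    kexit cls (Q f) A L x / (1 + d) <=
    kexit cls (Q f) A L y <= (1 + d) * kexit cls (Q f) A L x.
  by near: f; exact: exit_rate_flat.
have HL : forall x y, cls x \in A -> cls y \in A ->
    (hold cls (Q f) L y <= (c * kexit cls (Q f) A L x * tau f (cls y))%:E)%E.
  by near: f; exact: last_hold_small.
have MRx := MR f x f0.
have tf0 i : 0 <= tau f i by rewrite ltW // tau0.
rewrite (exit_event_prob cls_meas MRx xk lk (neg0 f)) (exit_to_prob cls_meas MRx xk lk) KexitE //=.
set u := kexit _ _ _ _ _ in u0 *; set V := fine _.
have db2 : 2 * d <= b by lra.
have zb : 3 * d + 2 * c / z + z <= b by rewrite {2}/z; lra.
have [h] := survival_functions cls_meas MRx xA tf0 (tr0 f0) (ltW d0) d1 (ltW c0) Hg HA HT H2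
   z0 db2 zb.
set G := (fun s => _) => /= -[hA hB hC hD G1].
have G1' : `|G t - expR (- t)| <= e / 8.
  apply: (B1 h) => // s s0; first by apply: le_trans (hC s s0) _; rewrite lerD2l.
  by apply: le_trans (hD s s0) _; rewrite lerD2l.
have G2' : `|G (t - eta) - expR (- (t - eta))| <= e / 8.
  apply: (B2 h) => // s s0; first by apply: le_trans (hC s s0) _; rewrite lerD2l.
  by apply: le_trans (hD s s0) _; rewrite lerD2l.
have G01 s : 0 <= G s <= 1.
  rewrite /G fine_ge0 //=; have mr := measurable_reach cls_meas MRx xA (s * tr f).
  by rewrite -lee_fin fineK ?probability_le1 // fin_num_measure.
have lower : G t / (1 + d) <= V / u.
  rewrite ler_pdivlMr //.
  apply: le_trans (exit_after_ge cls_meas MRx xA (ltW d0) LA u0 (fun y => Ku x y xA) (t * tr f)).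
  by rewrite [leLHS]mulrC mulrA mulrAC.
have le1 : V / u <= 1.
  rewrite ler_pdivrMr // mul1r.
  apply: le_trans (exit_after_le_total cls_meas MRx xA L _) _.
  by rewrite (exit_total_prob cls_meas MRx xA) // KexitE.
rewrite ltr_distl (ratio_gt d0 de (G01 t) G1' lower) /=.
have [tz|tz] := ltP 0 t; last first.
  have -> : t = 0 by apply/eqP; rewrite eq_le tz t0.
  by rewrite oppr0 expR0 (le_lt_trans le1) // ltrDl.
have eta0 : 0 < eta by rewrite lt_min tz.
have lip : expR (- (t - eta)) - expR (- t) <= eta.
  apply: le_trans (expR_neg_lipschitz te0 _) _; first by rewrite gerBl ltW.
  by rewrite opprB addrC subrK.
apply: (ratio_lt d0 d1 de (ltW c0) eta0 eta_e (ce tz) (G01 _) G2' lip).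
have := exit_after_le cls_meas MRx xA tf0 (ltW d0) (ltW c0) Hg LA u0
  (fun y => Ku x y xA) (fun y => HL x y xA) ((t - eta) * tr f) (mulr_gt0 eta0 (tr0 f0)).
rewrite -mulrDl subrK -/V -/(G (t - eta)) => H.
rewrite ler_pdivrMr //; apply: le_trans H _.
rewrite le_eqVlt; apply/orP; left; apply/eqP; field.
by rewrite !lt0r_neq0 ?tr0.
Unshelve. all: by end_near. Qed.

End ClusterExitLimit.

Theorem theorem6p5 (R : realType) (dS : measure_display) (S : measurableType dS)
  (Mr : nat -> nat) (Rtop : nat)
  (Pr : forall r, R -> 'I_(Mr r) -> 'I_(Mr r) -> R)
  (pi : forall r, 'I_(Mr 0%N) -> 'I_(Mr r))
  (cls : S -> 'I_(Mr 0%N))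
  (Q : R -> R.-pker S ~> (S * R)%type)
  (tau : R -> 'I_(Mr 0%N) -> R)
  (dO : measure_display) (O : measurableType dO)
  (Prob : R -> S -> probability O R)
  (X : R -> S -> nat -> O -> S) (T : R -> S -> nat -> O -> R) :
  (* S = S_1 u ... u S_M, measurable partition *)
  (forall i, measurable (Si cls i)) ->
  (* holding times are nonnegative *)
  (forall eps x, Q eps x (setT `*` [set t | t < 0]) = 0%E) ->
  (* the embedded chain started at (x,0) *)
  (forall eps x, 0 < eps -> MRchain (Prob eps x) (Q eps) x (X eps x) (T eps x)) ->
  (* the hierarchy, with P^{0,eps} = Pr 0 *)
  @hierarchy R Mr Rtop Pr pi ->
  (* (a) *)
  (forall eps x, 0 < eps -> Pk (Q eps) x (Si cls (cls x)) = 0) ->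
  (forall eps i, 0 < eps -> Pr 0%N eps i i = 0) ->
  (forall i j, i != j ->
     (forall eps, 0 < eps -> Pr 0%N eps i j = 0 /\
        forall x, Si cls i x -> Pk (Q eps) x (Si cls j) = 0) \/
     ((forall eps, 0 < eps -> 0 < Pr 0%N eps i j) /\
      unif_lim (fun eps x => Pk (Q eps) x (Si cls j) / Pr 0%N eps i j) (Si cls i) 1)) ->
  (forall eps i, 0 < eps -> \sum_j Pr 0%N eps i j = 1) ->
  (forall i j, connect (nzP (Pr 0%N)) i j) ->
  (* (b) *)
  (forall eps i, 0 < eps -> 0 < tau eps i) ->
  (forall i j, nzP (Pr 0%N) i j ->
     unif_lim (fun eps x => condE (Q eps) x (Si cls j) id / tau eps i) (Si cls i) 1) ->
  (* (c) *)
  (exists (C eps0 : R), 0 < eps0 /\ forall eps, 0 < eps <= eps0 ->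
     forall i j, nzP (Pr 0%N) i j -> forall x, Si cls i x ->
       (\int[Q eps x]_(z in Si cls j `*` setT)
           ((z.2 - condE (Q eps) x (Si cls j) id) ^+ 2)%:E
        <= (C * tau eps i ^+ 2 * Pk (Q eps) x (Si cls j))%:E)%E) ->
  (* (d) *)
  (forall i j1 j2, nzP (Pr 0%N) i j1 -> nzP (Pr 0%N) i j2 ->
     forall f, bcont f ->
     unif_lim (fun eps (xx : S * S) =>
        condE (Q eps) xx.1 (Si cls j1) (fun s => f (s / tau eps i))
        - condE (Q eps) xx.2 (Si cls j2) (fun s => f (s / tau eps i)))
       (Si cls i `*` Si cls i) 0) ->
  (* (e) *)
  (forall i j, nzP (Pr 0%N) i j ->
     forall (en : nat -> R) (xn : nat -> S) (mu : probability R R),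
       (forall n, 0 < en n) -> (forall n, en n.+1 <= en n) -> en @ \oo --> 0 ->
       (forall n, Si cls i (xn n)) ->
       (forall f, bcont f ->
          (fun n => condE (Q (en n)) (xn n) (Si cls j) (fun s => f (s / tau (en n) i)))
            @ \oo --> fine (\int[mu]_s (f s)%:E)) ->
       forall a, mu [set a] = 0%E) ->
  (* (f) *)
  (forall n (a b d : 'I_n -> 'I_(Mr 0%N)) (a0 c : 'I_(Mr 0%N)),
     (forall q, nzP (Pr 0%N) (a q) (d q)) ->
     exists lim : \bar R,
       (fun eps => ((\prod_q (Pr 0%N eps (a q) (b q) / Pr 0%N eps (a q) (d q)))
                    * (tau eps a0 / tau eps c))%:E) @ 0^'+ --> lim) ->
  (* the theorem *)
  forall (r : nat) (k : 'I_(Mr r)), (1 <= r < Rtop)%N ->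
  (1 < #|[pred i | pi r i == k]|)%N ->
  forall taur : R -> R, (forall eps, 0 < eps -> 0 < taur eps) ->
  (forall e : R, 0 < e -> \forall eps \near 0^'+, forall x, pi r (cls x) = k ->
     (`| (\sum_(i | pi r i == k)
            ((tau eps i)%:E * \int[Prob eps x]_w
                Nvisits cls (fun y => pi r (cls y)) (X eps x) i w))
          * ((taur eps)^-1)%:E - 1 | < e%:E)%E) ->
  forall (t : R) (l : 'I_(Mr r)), 0 <= t -> nzP (Pr r) k l ->
  unif_lim (fun eps x =>
      fine (Prob eps x (exit_event (fun y => pi r (cls y)) (X eps x) (T eps x) l
                                   (t * taur eps)))
      / fine (Prob eps x (exit_to (fun y => pi r (cls y)) (X eps x) l)))
    [set x | pi r (cls x) = k] (expR (- t)).

Proof.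
move=> cls_meas neg0 MR hier self0 Pdiag tr_or row1 comm tau0 mean var _ _ _ r k.
move=> /andP[_ rR] big taur taur0 occ t l t0 kl.
have nz_cases i j : nzP (Pr 0%N) i j \/ forall e : R, 0 < e -> Pr 0%N e i j = 0.
  exact: nzP_cases.
have Pnn e i j : 0 < e -> 0 <= Pr 0%N e i j.
  move=> e0; have [->|ij] := eqVneq i j; first by rewrite Pdiag.
  by have [/(_ e e0)[-> _]|[/(_ e e0) /ltW]] := tr_or i j ij.
have Ppos i j : nzP (Pr 0%N) i j -> forall e : R, 0 < e -> 0 < Pr 0%N e i j.
  move=> /asboolP[e1 [e10 nz]] e e0.
  have ij : i != j by apply: contraNneq nz => ->; rewrite Pdiag.
  have [/(_ e1 e10)[z _]|[/(_ e e0)]] := tr_or i j ij; last by [].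
  by rewrite z eqxx in nz.
have Pst (e : R) : 0 < e -> stochastic (Pr 0%N e).
  by move=> e0; split => *; [exact: Pnn|exact: row1].
have Pirr (e : R) : 0 < e -> irreducible_chain (Pr 0%N e).
  move=> e0 i j; apply: connect_sub (comm i j) => a b ab.
  by apply: connect1; exact: Ppos.
(* The relative form of (a) covers positive, identically zero and diagonal entries at once. *)
have QP i j (d : R) : 0 < d -> \forall e \near (0:R)^'+, forall x, cls x = i ->
     `|Pk (Q e) x (Si cls j) - Pr 0%N e i j| <= d * Pr 0%N e i j.
  move=> d0; have [<-|ij] := eqVneq i j.
    near=> e => x xi; have e0 : 0 < e by near: e; exact: nbhs_right_gt.
    by rewrite -{1}xi self0 // Pdiag // subrr normr0 mulr0.
  have [z|[pos lim]] := tr_or i j ij.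
    near=> e => x xi; have e0 : 0 < e by near: e; exact: nbhs_right_gt.
    by have [-> /(_ x xi) ->] := z e e0; rewrite subrr normr0 mulr0.
  near=> e => x xi; have e0 : 0 < e by near: e; exact: nbhs_right_gt.
  have : forall x, Si cls i x -> `|Pk (Q e) x (Si cls j) / Pr 0%N e i j - 1| < d.
    by near: e; exact: lim.
  move=> /(_ x xi) /ltW; have p0 := pos e e0.
  have -> : Pk (Q e) x (Si cls j) - Pr 0%N e i j =
      (Pk (Q e) x (Si cls j) / Pr 0%N e i j - 1) * Pr 0%N e i j.
    by rewrite mulrBl mul1r divfK // lt0r_neq0.
  by rewrite normrM (gtr0_norm p0) ler_pM2r.
have M0 : (0 < Mr 0%N)%N.
  by have [i _] := cluster_surj hier (ltnW rR) k; case: i => i /(leq_ltn_trans (leq0n i)).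
(* An invariant measure is chosen for each [eps] separately, with no regularity in [eps]; the zero
   function fills in for [eps <= 0]. *)
have /choice[mu muE] : forall e : R, exists m : 'I_(Mr 0%N) -> R, 0 < e ->
    (forall i, 0 < m i) /\ (forall j, \sum_i m i * Pr 0%N e i j = m j).
  move=> e; have [e0|e0] := ltP 0 e; last by exists (fun=> 0).
  by have [m mE] := invariant_measure (Pst e e0) (Pirr e e0) M0; exists m.
have [rec [_ diag0]] := clusters_recurrent_ratio hier Pst Pirr Pdiag
  (fun e e0 => (muE e e0).1) (fun e e0 => (muE e e0).2) rR.
have [e1 [e10 kl1]] : exists e : R, 0 < e /\ Pr r e k l != 0 by apply/asboolP.
have lk : l != k by apply: contraNneq kl1 => ->; rewrite diag0.
have edge : exists i j, [/\ pi r i = k, pi r j = l & nzP (Pr 0%N) i j].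
  have [i [j [ik jl nz]]] := rank_edge hier (ltnW rR) kl1.
  by exists i, j; split=> //; apply/asboolP; exists e1.
have [_ /(_ r rR) M1 _ _] := hier.
apply: (cluster_exit_exponential cls_meas neg0 Pst Pirr Pdiag Ppos QP tau0 mean var
  (cluster_surj hier (ltnW rR)) M1 rec big lk edge taur0) => //.
move=> d d0; near=> e => x xk; have e0 : 0 < e by near: e; exact: nbhs_right_gt.
(* The mean visit counts under [Prob] become the Green function of the kernel, in which the cluster
   estimates are phrased. *)
rewrite -(visits_green cls_meas (MR e x e0) xk); last by move=> i; rewrite ltW // tau0.
by move: x xk; near: e; exact: occ.
Unshelve. all: by end_near. Qed.
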